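(* For nonnegative integers $w$ and $k$, \[ \sum_{\substack{\lambda:\lambda_1\le 2w+1\\ r(\lambda)=k}} s_{\lambda}(\mathbf{x}) = e_k(\mathbf{x})\det_{1\le i,j \leq w}\left( (p_1^{\perp})^{i+j-2} (f_{0}(\mathbf{x})-f_{2}(\mathbf{x})) \right) \] and \[ \sum_{\substack{\lambda:\lambda_1\le 2w\\ r(\lambda)=k}} s_{\lambda}(\mathbf{x}) = \det_{1\le i,j\le w} \left( (p_1^{\perp})^{j-1} \big(f_{i+k\delta_{i,w}-1}(\mathbf{x})-f_{i+k\delta_{i,w}+1}(\mathbf{x})\big) \right), \] where $\delta_{i,w}=1$ if $i=w$ and $0$ otherwise.
   Context: Symmetric functions are in infinitely many variables $\mathbf{x}=(x_1,x_2,\dots)$. Sums range over partitions $\lambda$ with the indicated bound on the largest part $\lambda_1$; $s_\lambda$ is the Schur function; $r(\lambda)$ is the number of rows of odd length of $\lambda$ (the number of $i$ with $\lambda_i$ odd). $e_n(\mathbf{x})$ is the $n$-th elementary symmetric function ($e_0=1$, $e_n=0$ for $n<0$), and $f_r(\mathbf{x})=\sum_{n\in\mathbb{Z}} e_n(\mathbf{x})e_{n+r}(\mathbf{x})$ for $r\in\mathbb{Z}$. With the Hall inner product $\langle s_\lambda,s_\mu\rangle=\delta_{\lambda,\mu}$, $p_1^\perp$ is the adjoint of multiplication by $p_1(\mathbf{x})=x_1+x_2+\cdots$. The determinant of an empty matrix is $1$.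
   Formalization: The second identity is stated only when w > 0 or k = 0: for w = 0 and k > 0 its left side is the empty sum 0 while the empty determinant on the right is 1, so the claim as written fails exactly there. *)

(* Defs.v *)
From HB Require Import structures.
From mathcomp Require Import all_boot all_order all_algebra.
From mathcomp Require Import finmap multiset.
From mathcomp Require Import mathcomp_extra boolp classical_sets functions.
From mathcomp Require Import cardinality fsbigop.

Set Implicit Arguments.
Unset Strict Implicit.
Unset Printing Implicit Defensive.

Import GRing.Theory.

Local Open Scope classical_set_scope.
Local Open Scope ring_scope.

(* Variables are x_0, x_1, x_2, ...; the monomial x_{i_1} ... x_{i_d} is the
   multiset {i_1, ..., i_d} of the indices of its variables. *)
Notation monomial := ({mset nat}%mset).

(* Formal power series of possibly unbounded degree: the identities below live
   in the completion of the ring of symmetric functions, not in that ring. *)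
Definition fps (R : comNzRingType) : Type := monomial -> R.

Definition antidiag (m : monomial) : set (monomial * monomial) :=
  [set ab | (ab.1 `+` ab.2)%mset = m].

Section FpsRing.
Variable R : comNzRingType.

HB.instance Definition _ := GRing.Zmodule.copy (fps R) (monomial -> R).

Implicit Types (f g h : fps R) (m : monomial).

Definition fps_mul f g : fps R :=
  fun m => \sum_(ab \in antidiag m) f ab.1 * g ab.2.

Definition xmon (a : monomial) : fps R := fun m => (m == a)%:R.

Let msubs m : seq monomial :=
  undup [seq seq_mset (mask b (m : seq nat)) | b : (size m).-tuple bool].

Let msubsP m (a : monomial) : (a \in msubs m) = (a `<=` m)%mset.
Proof.
rewrite mem_undup; apply/mapP/msubsetP => [[b _ ->] i|sam].
  rewrite mset_seqE -count_mem_mset.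
  exact: leq_count_mask.
have /count_subseqP[s /subseqP[b szb ->] pas] :
    forall x, (count_mem x a <= count_mem x m)%N.
  by move=> x; rewrite !count_mem_mset.
exists (Tuple (introT eqP szb)); first by rewrite mem_enum.
by rewrite -[LHS]seq_mset_id; apply/eq_seq_msetP.
Qed.

Let msubs_uniq m : uniq (msubs m). Proof. exact: undup_uniq. Qed.

Let addl_msubs m (a b : monomial) : (a `+` b)%mset = m -> a \in msubs m.
Proof.
by move=> <-; rewrite msubsP; apply/msubsetP => i; rewrite msetE2 leq_addr.
Qed.

Let addr_msubs m (a b : monomial) : (a `+` b)%mset = m -> b \in msubs m.
Proof. by rewrite msetDC; apply: addl_msubs. Qed.

Let msubs_trans m (n a : monomial) : n \in msubs m -> a \in msubs n -> a \in msubs m.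
Proof. by rewrite !msubsP => nm an; apply: msubset_trans an nm. Qed.

Lemma fps_mulE m (n : monomial) f g : n \in msubs m ->
  fps_mul f g n =
  \sum_(a <- msubs m) \sum_(b <- msubs m) ((a `+` b)%mset == n)%:R * (f a * g b).
Proof.
move=> nm; rewrite /fps_mul.
rewrite (fsbigE [seq ab <- [seq (a, b) | a <- msubs m, b <- msubs m]
                 | (ab.1 `+` ab.2)%mset == n]); first last.
- move=> [a b] /= abn; rewrite mem_filter /= abn eqxx /=.
  case/negP; apply/allpairsP; exists (a, b).
  by split=> //=; apply: msubs_trans nm _; [apply: addl_msubs abn|apply: addr_msubs abn].
- by move=> ab /=; rewrite mem_filter => /andP[/eqP].
- by rewrite filter_uniq // allpairs_uniq // => -[? ?] [? ?].
rewrite big_filter_cond big_mkcond big_allpairs; apply: eq_bigr => a _.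
apply: eq_big_seq => b bm /=.
have [abn|] := eqVneq (a `+` b)%mset n; last by rewrite mul0r.
by rewrite mul1r ifT //=; apply/mem_set.
Qed.

Let msubs_refl m : m \in msubs m.
Proof. by rewrite msubsP msubset_refl. Qed.

Lemma fps_mulC : commutative fps_mul.
Proof.
move=> f g; apply/funext => m; rewrite !(fps_mulE _ _ (msubs_refl m)).
rewrite exchange_big; apply: eq_bigr => a _; apply: eq_bigr => b _ /=.
by rewrite msetDC [f b * _]mulrC.
Qed.

Let sum_pick m (s : monomial) (F : monomial -> R) : s \in msubs m ->
  \sum_(u <- msubs m) (s == u)%:R * F u = F s.
Proof.
move=> sm; rewrite (bigD1_seq s) //= eqxx mul1r big1 ?addr0 // => u.
by rewrite eq_sym => /negPf->; rewrite mul0r.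
Qed.

Let fps_mul3 f g h m : fps_mul f (fps_mul g h) m =
  \sum_(a <- msubs m) \sum_(b <- msubs m) \sum_(c <- msubs m)
    ((a `+` (b `+` c))%mset == m)%:R * (f a * (g b * h c)).
Proof.
rewrite (fps_mulE _ _ (msubs_refl m)); apply: eq_bigr => a _.
under eq_big_seq => u um.
  rewrite (fps_mulE _ _ um) !mulr_sumr.
  under eq_bigr do rewrite !mulr_sumr.
  over.
rewrite exchange_big; apply: eq_bigr => b _ /=.
rewrite exchange_big; apply: eq_bigr => c _ /=.
pose F u := ((a `+` u)%mset == m)%:R * (f a * (g b * h c)).
transitivity (\sum_(u <- msubs m) ((b `+` c)%mset == u)%:R * F u).
  by apply: eq_bigr => u _; rewrite /F [RHS]mulrCA; congr (_ * _); rewrite mulrCA.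
have [|bcm] := boolP ((b `+` c)%mset \in msubs m); first exact: (sum_pick F).
have /negPf-> : (a `+` (b `+` c))%mset != m.
  by apply: contraNneq bcm => /addr_msubs.
rewrite mul0r big1_seq // => u /andP[_ um].
have /negPf-> : (b `+` c)%mset != u by apply: contraNneq bcm => ->.
by rewrite mul0r.
Qed.

Lemma fps_mulA : associative fps_mul.
Proof.
move=> f g h; rewrite [RHS]fps_mulC; apply/funext => m; rewrite !fps_mul3.
rewrite [RHS]exchange_big; apply: eq_bigr => a _ /=.
rewrite [RHS]exchange_big; apply: eq_bigr => b _ /=; apply: eq_bigr => c _.
by rewrite msetDA [(a `+` b `+` c)%mset]msetDC; congr (_ * _); rewrite mulrA mulrC.
Qed.

Lemma fps_mul1 : left_id (xmon mset0) fps_mul.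
Proof.
move=> f; apply/funext => m; rewrite (fps_mulE _ _ (msubs_refl m)).
rewrite (bigD1_seq mset0) //=; last by rewrite msubsP msub0set.
rewrite [X in _ + X]big1 ?addr0 => [|a /negPf a0]; last first.
  by rewrite big1 // => b _; rewrite /xmon a0 mul0r mulr0.
rewrite -[RHS](sum_pick f (msubs_refl m)); apply: eq_bigr => b _.
by rewrite mset0D eq_sym /xmon eqxx mul1r.
Qed.

Lemma fps_mulDl : left_distributive fps_mul +%R.
Proof.
move=> f g h; apply/funext => m; rewrite [RHS]/GRing.add /=.
rewrite !(fps_mulE _ _ (msubs_refl m)) -big_split; apply: eq_bigr => a _ /=.
by rewrite -big_split; apply: eq_bigr => b _ /=; rewrite -mulrDr -mulrDl.
Qed.

Lemma fps_1_neq0 : xmon mset0 != 0.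
Proof.
apply/eqP => /(congr1 (fun f => f mset0)).
by rewrite /xmon eqxx => /eqP; apply/negP/oner_neq0.
Qed.

HB.instance Definition _ := GRing.Zmodule_isComNzRing.Build (fps R)
  fps_mulA fps_mulC fps_mul1 fps_mulDl fps_1_neq0.

End FpsRing.

(* Coefficientwise sum of a locally finite family: each monomial occurs in
   finitely many F i. (If it does not, \sum_(i \in A) returns the junk value 0;
   this never happens for the families considered here.) *)
Definition lfsum (R : comNzRingType) (I : choiceType) (A : set I)
    (F : I -> fps R) : fps R :=
  fun m => \sum_(i \in A) F i m.

Definition intpart (la : seq nat) : bool :=
  sorted geq la && all (ltn 0%N) la.

Definition part1 (la : seq nat) : nat := head 0%N la.

Definition oddrows (la : seq nat) : nat := count odd la.

(* A tableau is the list of its rows, from the longest one to the shortest. *)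
Definition colstrict (r s : seq nat) : bool :=
  all (fun j => nth 0 r j < nth 0 s j)%N (iota 0%N (size s)).

Definition ssyt (la : seq nat) (T : seq (seq nat)) : bool :=
  [&& shape T == la, all (sorted leq) T & sorted colstrict T].

Section SymmetricFunctions.
Variable R : comNzRingType.

Definition schur (la : seq nat) : fps R :=
  lfsum [set T | ssyt la T] (fun T => xmon R (seq_mset (flatten T))).

Definition elem (n : int) : fps R :=
  lfsum [set s : seq nat | sorted ltn s /\ (size s)%:Z = n]
        (fun s => xmon R (seq_mset s)).

Lemma elem0 : elem 0 = 1.
Proof.
rewrite /elem /lfsum; apply/funext => m.
rewrite (_ : [set _ | _] = [set [::]]) ?fsbig_set1.
  by congr (xmon R _ m); apply/msetP => i; rewrite mset_seqE mset0E.
by apply/seteqP; split=> s /= => [[_ [/size0nil]]|->].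
Qed.

Lemma elem_neg (n : nat) : elem (Negz n) = 0.
Proof. by apply/funext => m; apply: fsbig1 => s /= []. Qed.

Definition fser (r : int) : fps R :=
  lfsum [set: int] (fun n => elem n * elem (n + r)).

Definition p1 : fps R := lfsum [set: nat] (fun i => xmon R [mset i]%mset).

Definition symmetric_fps (f : fps R) : Prop :=
  forall s : nat -> nat, bijective s ->
  forall l : seq nat, f (seq_mset (map s l)) = f (seq_mset l).

Definition bounded_degree (f : fps R) : Prop :=
  exists d : nat, forall m : monomial, (d < size m)%N -> f m = 0.

(* The Schur expansion f = \sum_la c_la s_la; every symmetric power series has
   exactly one, with infinitely many nonzero c_la if its degree is unbounded. *)
Definition schur_coef (f : fps R) : seq nat -> R :=
  xget (fun=> 0) [set c | (forall la, ~~ intpart la -> c la = 0) /\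
    f = lfsum [set la | intpart la] (fun la m => c la * schur la m)].

(* The bilinear form for which the Schur functions are orthonormal. The sum is
   finite as soon as one of f and g has bounded degree. *)
Definition hall (f g : fps R) : R :=
  \sum_(la \in [set la | intpart la]) schur_coef f la * schur_coef g la.

(* The adjoint of multiplication by p_1 is needed on symmetric power series, so
   only the test function g is required to have bounded degree. *)
Definition p1perp (f : fps R) : fps R :=
  xget 0 [set h : fps R | symmetric_fps h /\
    forall g : fps R, symmetric_fps g -> bounded_degree g ->
      hall h g = hall f (p1 * g)].

End SymmetricFunctions.

Arguments schur {R} la.
Arguments elem {R} n.
Arguments fser {R} r.

(* Main.v *)
(* The Schur function of a partition with at most n columns is an n x n minor of
   the Toeplitz matrix (e_(y - j)) (dual Jacobi-Trudi), so the left-hand side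
   is a coefficient of a sum of maximal minors weighted by q to the number of odd
   rows. That weight is the Pfaffian of the form q^(b - a - 1) restricted to the
   selected rows, so the minor summation formula turns the sum into the Pfaffian
   of a skew Toeplitz form G with (1 + q^2) G(d) - q (G(d+1) + G(d-1)) = f_(d-1) -
   f_(d+1). A change of basis by polynomials in 1 + X^2 exhibits an isotropic
   subspace of half the dimension, which reduces the Pfaffian to a determinant
   whose entries are iterates of g |-> (d |-> g(d+1) + g(d-1)) on g_d = f_d -
   f_(d+2). Constants are fixed by specializing e_n to 0 for n > 0.

   On the other hand g_k = \sum_a s_(2^a 1^k), whence the Pieri rule gives
   p_1^perp g_d = g_(d+1) + g_(d-1). *)
Require Import Defs.
From HB Require Import structures.
From mathcomp Require Import finmap multiset.
From mathcomp Require Import mathcomp_extra boolp classical_sets functions.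
From mathcomp Require Import cardinality fsbigop.
From mathcomp Require Import all_boot all_order all_algebra all_fingroup.
From mathcomp Require Import zify ring.

Set Implicit Arguments.
Unset Strict Implicit.
Unset Printing Implicit Defensive.

Import GRing.Theory Num.Theory.

Local Open Scope ring_scope.

(** * Sums of minors and unnormalized Pfaffians *)

(** Pfaffians enter only as unnormalized alternating sums, so the minor summation and the reduction
    give proportionalities: one side carries a positive integer, the other an unevaluated
    polynomial. Cancelling the integer needs torsion-freeness. Hence the identities are proved with
    integer coefficients and carried to [R] by a ring morphism. Working in N variables makes the
    sequence e_n finitely supported and every sum finite; a series is determined by its truncations.

    A Pfaffian has even size, so the bound 2w+1 is treated with 2w+2 columns, one of them empty,
    which means that the smallest selected index is 0. This is imposed by replacing one row of the
    Toeplitz matrix by a unit vector. Its pairing with the other rows produces the generating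
    polynomial of the e_s in q, the origin of the factor e_k.

    For an even bound, q survives in a single row of the reduced matrix, and the normalization
    contributes a power of q equal to the number of other rows. Reading off one coefficient
    therefore changes that row alone, which is the shift by k in the last row. *)

Definition torsion_free (V : zmodType) : Prop :=
  forall (n : nat) (x : V), x *+ n.+1 = 0 -> x = 0.

Definition incr n L (y : {ffun 'I_n -> 'I_L}) : bool :=
  [forall i : 'I_n, forall j : 'I_n, (i < j)%N ==> (y i < y j)%N].

Lemma incrP n L (y : {ffun 'I_n -> 'I_L}) :
  reflect (forall i j : 'I_n, (i < j)%N -> (y i < y j)%N) (incr y).
Proof.
apply: (iffP forallP) => [H i j ij|H i].
  by move/forallP: (H i) => /(_ j) /implyP; apply.
by apply/forallP => j; apply/implyP; apply: H.
Qed.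

(* An unnormalized Pfaffian, which only depends on the skew part of [H]. *)
Definition pairsum (A : comNzRingType) m (H : 'M[A]_(m + m)) : A :=
  \sum_(s : 'S_(m + m)) (-1) ^+ s *
    \prod_(i < m) H (s (lshift m i)) (s (rshift m i)).

Section Sorting.
Variables (n L : nat).

Let rk (phi : 'I_n -> 'I_L) (i : 'I_n) : nat := #|[set j | (phi j < phi i)%N]|.

Let rk_lt (phi : 'I_n -> 'I_L) i : (rk phi i < n)%N.
Proof.
rewrite -[X in (_ < X)%N]card_ord -cardsT; apply: proper_card.
apply/properP; split; first exact: subsetT.
by exists i; rewrite ?inE ?ltnn.
Qed.

Let rk_mono (phi : 'I_n -> 'I_L) i j : (phi i < phi j)%N -> (rk phi i < rk phi j)%N.
Proof.
move=> ij; apply: proper_card; apply/properP; split.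
  by apply/subsetP => k; rewrite !inE => /ltn_trans; apply.
by exists i; rewrite !inE ?ltnn.
Qed.

(** The sorting permutation is the inverse of the rank map [rk], a bijection because the values are
    distinct. *)
Lemma exists_unique_sorting (phi : {ffun 'I_n -> 'I_L}) : injective phi ->
  #|[pred s : 'S_n | incr [ffun i => phi (s i)]]| = 1%N.
Proof.
move=> inj.
have rinj : injective (fun i => Ordinal (rk_lt phi i)).
  move=> i j /(congr1 val) /= eqr; apply/eqP; apply: contraT => nij.
  have : phi i != phi j by apply: contraNneq nij => /inj ->.
  by rewrite neq_ltn => /orP[] /rk_mono; rewrite eqr ltnn.
transitivity #|pred1 (perm rinj)^-1%g|; last exact: card1.
apply: eq_card => s; rewrite !inE; apply/incrP/eqP => [inc|-> i j ij].
  suff E : (s * perm rinj = 1)%g by rewrite -[s]mulg1 -(mulgV (perm rinj)) mulgA E mul1g.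
  apply/permP => i; rewrite permM perm1 permE; apply: val_inj => /=.
  rewrite /rk.
  have -> : [set j | (phi j < phi (s i))%N] = s @: [set k : 'I_n | (k < i)%N].
    apply/setP => j; rewrite !inE; apply/idP/imsetP => [ji|[k ki ->]].
      exists (s^-1 j)%g; rewrite ?permKV // inE ltnNge leq_eqVlt.
      apply/negP => /orP[/eqP/val_inj E|H].
        by move: ji; rewrite E permKV ltnn.
      have := inc _ _ H; rewrite !ffunE permKV => H2.
      by move: (ltn_trans H2 ji); rewrite ltnn.
    by have := inc k i; rewrite !ffunE; apply; rewrite inE in ki.
  rewrite card_imset; last exact: perm_inj.
  have winj : injective (widen_ord (ltnW (ltn_ord i))).
    by move=> a b /(congr1 val) /= /val_inj.
  rewrite cardsE -[RHS](card_ord i) -(card_codom winj).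
  apply: eq_card => k; apply/idP/codomP => [ki|[l ->]].
    by exists (Ordinal ki); apply: val_inj.
  exact: (ltn_ord l).
rewrite !ffunE; set p := perm rinj.
case: (ltngtP (phi (p^-1 i)%g) (phi (p^-1 j)%g)) => // [/rk_mono|/val_inj/inj/perm_inj E].
  have E k : rk phi (p^-1 k)%g = k.
    have := permKV p k; rewrite [X in X = _]permE => /(congr1 val).
    by [].
  by rewrite !E ltnNge ltnW.
by move: ij; rewrite E ltnn.
Qed.

End Sorting.

Section PairSum.
Variable A : comNzRingType.

Lemma pairsum_mul m L (B : 'M[A]_(m + m, L)) (M : 'M[A]_L) :
  pairsum (B *m M *m B^T) =
  \sum_(phi : {ffun 'I_(m + m) -> 'I_L})
    (\prod_(i < m) M (phi (lshift m i)) (phi (rshift m i)))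
    * \det (\matrix_(k, a) B a (phi k)).
Proof.
pose ext (pp : {ffun 'I_m -> 'I_L} * {ffun 'I_m -> 'I_L}) : {ffun 'I_(m + m) -> 'I_L} :=
  [ffun k => match split k with inl i => pp.1 i | inr i => pp.2 i end].
pose res (phi : {ffun 'I_(m + m) -> 'I_L}) :=
  ([ffun i => phi (lshift m i)], [ffun i => phi (rshift m i)]).
have extl pp i : ext pp (lshift m i) = pp.1 i.
  by rewrite ffunE (unsplitK (inl _ i)).
have extr pp i : ext pp (rshift m i) = pp.2 i.
  by rewrite ffunE (unsplitK (inr _ i)).
rewrite (reindex ext) /=; last first.
  exists res => [[p1 p2]|phi] _.
    by congr (_, _); apply/ffunP => i; rewrite ffunE (extl, extr).
  apply/ffunP => k; rewrite ffunE; case: splitP => i e; rewrite ffunE;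
  by congr (phi _); apply: val_inj.
rewrite -(pair_bigA _ (fun p1 p2 =>
   (\prod_i M (ext (p1, p2) (lshift m i)) (ext (p1, p2) (rshift m i))) *
   \det (\matrix_(k, a) B a (ext (p1, p2) k)))) /=.
rewrite /pairsum.
transitivity (\sum_(s : 'S_(m + m)) \sum_(p1 : {ffun 'I_m -> 'I_L})
    \sum_(p2 : {ffun 'I_m -> 'I_L}) (\prod_i M (p1 i) (p2 i)) *
     ((-1) ^+ s * \prod_k B (s k) (ext (p1, p2) k))).
  apply: eq_bigr => s _.
  transitivity ((-1) ^+ s * \prod_(i < m) \sum_(x < L) \sum_(y < L)
      (B (s (lshift m i)) x * M x y * B (s (rshift m i)) y)).
    congr (_ * _); apply: eq_bigr => i _; rewrite exchange_big mxE.
    apply: eq_bigr => y _; rewrite !mxE mulr_suml; apply: eq_bigr => x _ //.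
  rewrite bigA_distr_bigA mulr_sumr; apply: eq_bigr => p1 _ /=.
  rewrite bigA_distr_bigA mulr_sumr; apply: eq_bigr => p2 _ /=.
  rewrite mulrCA; congr (_ * _); rewrite big_split_ord /= -!big_split /=.
  by apply: eq_bigr => i _; rewrite extl extr /= [RHS]mulrCA mulrA.
rewrite exchange_big; apply: eq_bigr => p1 _ /=.
rewrite exchange_big; apply: eq_bigr => p2 _ /=.
rewrite -mulr_sumr; congr (_ * _).
  by apply: eq_bigr => i _; rewrite extl extr.
by apply: eq_bigr => s _; congr (_ * _); apply: eq_bigr => k _; rewrite mxE.
Qed.

Lemma sum_sorted n L (F : {ffun 'I_n -> 'I_L} -> A) :
  (forall phi : {ffun 'I_n -> 'I_L}, ~ injective phi -> F phi = 0) ->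
  \sum_phi F phi =
  \sum_(y : {ffun 'I_n -> 'I_L} | incr y) \sum_(s : 'S_n) F [ffun i => y (s i)].
Proof.
move=> F0.
(* Summing over the sorting permutations changes nothing: there is exactly one if [phi] is
   injective, and otherwise the term is zero. *)
transitivity (\sum_(phi : {ffun 'I_n -> 'I_L}) \sum_(s : 'S_n | incr [ffun i => phi (s i)]) F phi).
  apply: eq_bigr => phi _; rewrite sumr_const.
  have [/injectiveP inj|/injectiveP ninj] := boolP (injectiveb phi).
    by rewrite exists_unique_sorting.
  by rewrite F0 // mul0rn.
rewrite (exchange_big_dep xpredT) //= exchange_big /=.
rewrite (reindex_inj (@invg_inj _)) /=; apply: eq_bigr => s _.
rewrite (reindex (fun y : {ffun 'I_n -> 'I_L} => [ffun i => y (s i)])) /=.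
  apply: eq_bigl => y; congr incr; apply/ffunP => i.
  by rewrite !ffunE permKV.
exists (fun y => [ffun i => y (s^-1%g i)]) => y _; apply/ffunP => i;
by rewrite !ffunE (permK, permKV).
Qed.

Lemma det_row_perm_ffun n L (B : 'M[A]_(n, L)) (y : {ffun 'I_n -> 'I_L}) (s : 'S_n) :
  \det (\matrix_(k, a) B a ([ffun i => y (s i)] k)) =
  (-1) ^+ s * \det (\matrix_(k, a) B a (y k)).
Proof.
rewrite -det_perm -det_mulmx -row_permE; congr (\det _).
by apply/matrixP => k a; rewrite !mxE ffunE.
Qed.

(** The minor summation formula, proved like Cauchy-Binet: an injective index map is an increasing
    one composed with a permutation, whose sign rebuilds a [pairsum]. *)
Lemma pairsum_sorted m L (B : 'M[A]_(m + m, L)) (M : 'M[A]_L) :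
  pairsum (B *m M *m B^T) =
  \sum_(y : {ffun 'I_(m + m) -> 'I_L} | incr y)
    pairsum (\matrix_(a, b) M (y a) (y b)) * \det (\matrix_(k, a) B a (y k)).
Proof.
rewrite pairsum_mul sum_sorted => [|phi /injectiveP/injectivePn[i [j nij eij]]].
  apply: eq_bigr => y _; rewrite mulr_suml; apply: eq_bigr => s _.
  rewrite det_row_perm_ffun mulrCA mulrA; congr (_ * _ * _).
  by apply: eq_bigr => i _; rewrite !mxE !ffunE.
rewrite [X in _ * X](determinant_alternate nij) ?mulr0 // => a.
by rewrite !mxE eij.
Qed.

Lemma incr_id n (y : {ffun 'I_n -> 'I_n}) : incr y -> y = [ffun i => i].
Proof.
move=> /incrP inc; apply/ffunP => i; rewrite ffunE; apply: val_inj => /=.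
have lo : forall k (i : 'I_n), i = k :> nat -> (k <= y i)%N.
  elim=> // k IH j jk; have kn : (k < n)%N by apply: ltnW; rewrite -jk.
  apply: leq_ltn_trans (IH (Ordinal kn) erefl) _; apply: inc.
  by rewrite /= jk.
have hi : forall k (i : 'I_n), (i + k.+1 = n)%N -> (y i + k < n)%N.
  elim=> [j _|k IH j jk]; first by rewrite addn0.
  have jn : (j.+1 < n)%N by lia.
  rewrite addnS; apply: leq_ltn_trans (IH (Ordinal jn) _); last by move=> /=; lia.
  by rewrite -addSn leq_add2r; apply: inc => /=.
apply/eqP; rewrite eqn_leq lo // andbT.
have := hi (n - i.+1)%N i; rewrite addnS -addSn subnKC // => /(_ erefl).
rewrite -[X in (_ < X)%N](subnKC (ltn_ord i)) ltn_add2r ltnS //.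
Qed.

(** With as many columns as rows only one increasing map remains, and minor summation becomes Pf(B M
    B^T) = det(B) Pf(M). *)
Lemma pairsum_congr m (B M : 'M[A]_(m + m)) :
  pairsum (B *m M *m B^T) = \det B * pairsum M.
Proof.
rewrite pairsum_sorted (bigD1 [ffun i => i]) /=; last first.
  by apply/incrP => i j; rewrite !ffunE.
rewrite [X in _ + X]big1 => [|y /andP[/incr_id -> /eqP //]].
rewrite addr0 mulrC; congr (_ * _); last first.
  by congr pairsum; apply/matrixP => a b; rewrite !mxE !ffunE.
by rewrite -det_tr; congr (\det _); apply/matrixP => a b; rewrite !mxE ffunE.
Qed.

(** A term with a symmetric factor cancels against the term in which the two indices of that factor
    are exchanged. This gives S = - S, and 2 has to be cancelled. *)
Lemma pairsum_addsym m (X Y : 'M[A]_(m + m)) :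
  torsion_free A -> Y^T = Y -> pairsum (X + Y) = pairsum X.
Proof.
move=> tf symY; rewrite /pairsum.
under eq_bigr => s _.
  under eq_bigr do rewrite mxE.
  rewrite bigA_distr mulr_sumr; over.
rewrite exchange_big (bigD1 [set: 'I_m]) //= [X in _ + X]big1 ?addr0 => [|J nJ].
  by apply: eq_bigr => s _; congr (_ * _); apply: eq_bigr => i _; rewrite inE.
have [i iJ] : exists i, i \notin J.
  by apply/existsP; rewrite -negb_forall; apply: contra nJ => /forallP H;
     apply/eqP/setP => i; rewrite inE H.
set S := \sum_ _ _; suff E : S = - S.
  by apply: (tf 1%N); rewrite mulr2n {1}E addNr.
rewrite {1}/S (reindex_inj (mulgI (tperm (lshift m i) (rshift m i)))) /=.
rewrite -sumrN; apply: eq_bigr => s _.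
have nlr : lshift m i != rshift m i by rewrite eq_lrshift.
rewrite odd_permM odd_tperm nlr signr_addb expr1 mulN1r mulNr; congr (- (_ * _)).
apply: eq_bigr => j _; rewrite !permM; have [->|nji] := eqVneq j i.
  by rewrite tpermL tpermR (negPf iJ) -{1}symY mxE.
by rewrite !tpermD // ?eq_lshift ?eq_rshift ?eq_lrshift ?eq_rlshift // eq_sym.
Qed.

(** The permutation matrix is block diagonal with two equal blocks, so the sign is the square of a
    determinant. Computing over the integers makes it nonnegative. *)
Lemma even_perm_blocks m (s : 'S_(m + m)) :
  (forall i, exists2 p, s (lshift m i) = lshift m p & s (rshift m i) = rshift m p) ->
  odd_perm s = false.
Proof.
move=> H; pose P : 'M[int]_m := \matrix_(i, j) (s (lshift m i) == lshift m j)%:R.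
have E : perm_mx s = block_mx P 0 0 P :> 'M[int]_(m + m).
  apply/matrixP => i j; rewrite !mxE.
  case: (split_ordP i) => i' ->; case: (split_ordP j) => j' ->;
    rewrite !mxE ?(unsplitK (inl _ _)) ?(unsplitK (inr _ _)) !mxE;
    case: (H i') => p e1 e2; rewrite ?e1 ?e2 ?eq_lshift ?eq_rshift //.
  - by rewrite eq_lrshift.
  - by rewrite eq_rlshift.
have := @det_perm int _ s; rewrite E det_ublock => D.
have : (0 <= (-1) ^+ s :> int)%R by rewrite -D -expr2 sqr_ge0.
by case: (odd_perm s).
Qed.

(** The left columns vanish, so in a nonzero term every second index lies in the right half, hence
    every first index in the left half. The identity block then forces the same permutation on both
    halves; such a term equals 1 and does not meet [Z]. *)
Lemma pairsum_block1 m : exists c : nat, forall Z : 'M[A]_m,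
  pairsum (block_mx 0 1%:M 0 Z) = c.+1%:R.
Proof.
pose good (s : 'S_(m + m)) := [forall i, exists p,
   (s (lshift m i) == lshift m p) && (s (rshift m i) == rshift m p)].
have good1 : good 1%g.
  by apply/forallP => i; apply/existsP; exists i; rewrite !perm1 !eqxx.
exists #|[pred s | good s && (s != 1%g)]| => Z.
rewrite /pairsum (eq_bigr (fun s => (good s)%:R)) => [|s _].
  rewrite (bigD1 1%g) //= good1 -natr1 addrC; congr (_ + _).
  rewrite -sum1_card natr_sum [LHS]big_mkcond [RHS]big_mkcond /=.
  by apply: eq_bigr => s _; rewrite !inE; case: (good s); case: (s != _).
have [/forallP g|/forallPn[i ng]] := boolP (good s).
  have H i : exists2 p, s (lshift m i) = lshift m p & s (rshift m i) = rshift m p.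
    by case/existsP: (g i) => p /andP[/eqP e1 /eqP e2]; exists p.
  rewrite (even_perm_blocks H) expr0 mul1r big1 // => i _.
  by case: (H i) => p -> ->; rewrite block_mxEur mxE eqxx.
have [j Hj|all_r] := pickP (fun j => [exists p, s (rshift m j) == lshift m p]).
  rewrite (bigD1 j) //=; case/existsP: Hj => p /eqP ->.
  case: (split_ordP (s (lshift m j))) => p' ->.
    by rewrite block_mxEul mxE mul0r mulr0.
  by rewrite block_mxEdl mxE mul0r mulr0.
have R j : exists p, s (rshift m j) = rshift m p.
  case: (split_ordP (s (rshift m j))) => p E; last by exists p.
  by have /existsP[] := negbT (all_r j); exists p; rewrite E.
have Ls j : exists p, s (lshift m j) = lshift m p.
  case: (split_ordP (s (lshift m j))) => p E; first by exists p.
  pose r j := projT1 (sigW (P := fun p => s (rshift m j) == rshift m p)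
      (let: ex_intro p e := R j in ex_intro _ p (introT eqP e))).
  have rE k : s (rshift m k) = rshift m (r k).
    by apply/eqP; rewrite /r; case: sigW.
  have rinj : injective r.
    move=> a b ab; apply/(@rshift_inj m m)/(@perm_inj _ s).
    by rewrite !rE ab.
  have := rE (invF rinj p); rewrite f_invF -E => /perm_inj /eqP.
  by rewrite eq_rlshift.
rewrite (bigD1 i) //=; case: (Ls i) => p e1; case: (R i) => p' e2.
rewrite e1 e2 block_mxEur mxE; case: eqVneq => [pp|]; last by rewrite mul0r mulr0.
by case/existsP: ng; exists p; rewrite e1 e2 pp !eqxx.
Qed.

(** The hypothesis says that the skew part of [X] vanishes on the first half. Removing the symmetric
    matrix [Y] clears the left columns, and the corner [N] comes out as a determinant by a block
    diagonal congruence. *)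
Lemma pairsum_isotropic m : torsion_free A ->
  exists c : nat, forall X : 'M[A]_(m + m), (ulsubmx X)^T = ulsubmx X ->
  pairsum X = c.+1%:R * \det (ursubmx X - (dlsubmx X)^T).
Proof.
move=> tf; have [c Hc] := pairsum_block1 m; exists c => X symX.
set N := _ - _.
pose Y := block_mx (ulsubmx X) (dlsubmx X)^T (dlsubmx X) 0.
have -> : X = block_mx 0 N 0 (drsubmx X) + Y.
  by rewrite add_block_mx !add0r addr0 subrK submxK.
rewrite pairsum_addsym //; last first.
  by rewrite tr_block_mx trmxK trmx0 symX.
have -> : block_mx 0 N 0 (drsubmx X) =
   block_mx N 0 0 1%:M *m block_mx 0 1%:M 0 (drsubmx X) *m (block_mx N 0 0 1%:M)^T.
  by rewrite tr_block_mx !mulmx_block !trmx0 trmx1 !mulmx0 !mul0mx !mulmx1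
     ?mul1mx ?add0r ?addr0 ?mul0mx.
by rewrite pairsum_congr Hc det_ublock det1 mulr1 mulrC.
Qed.

End PairSum.

(** * The gap form and its Pfaffian *)

Definition natval n L (y : {ffun 'I_n -> 'I_L}) (k : nat) : nat :=
  if insub k is Some i then y i : nat else 0%N.

Lemma natvalE n L (y : {ffun 'I_n -> 'I_L}) (i : 'I_n) : natval y i = y i.
Proof. by rewrite /natval valK. Qed.

(** The total gap inside the pairs of positions (0,1), (2,3), and so on. For even [n] the default
    value of [natval] is not reached. *)
Definition altsum n L (y : {ffun 'I_n -> 'I_L}) : nat :=
  \sum_(i < n | ~~ odd i) (natval y i.+1 - (natval y i).+1)%N.

(** The pairs are dominoes tiling 0, ..., 2m-1. If a domino starts at a+1, the one covering a cannot
    start there, so it starts at a-1, which is even by induction. *)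
Lemma domino_even m (s : 'S_(m + m)) :
  (forall i, s (rshift m i) = (s (lshift m i)).+1 :> nat) ->
  forall i, ~~ odd (s (lshift m i)).
Proof.
move=> H i; move: {2}(nat_of_ord _) (erefl (nat_of_ord (s (lshift m i)))) => a.
elim/ltn_ind: a i => -[|a] IH i sia; first by rewrite sia.
have an : (a < m + m)%N by have := ltn_ord (s (lshift m i)); rewrite sia; lia.
have := permKV s (Ordinal an); case: (split_ordP (s^-1%g (Ordinal an))) => j -> /(congr1 val)/= sj.
  have : s (rshift m j) = s (lshift m i) by apply: val_inj; rewrite /= H sj sia.
  by move/perm_inj/eqP; rewrite eq_rlshift.
rewrite H in sj; have := IH _ _ j erefl; rewrite sia -sj /= negbK => -> //.
Qed.

Lemma domino_sum m (s : 'S_(m + m)) (F : nat -> nat) :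
  (forall i, s (rshift m i) = (s (lshift m i)).+1 :> nat) ->
  (\sum_(i < m) F (s (lshift m i)) = \sum_(a < m + m | ~~ odd a) F a)%N.
Proof.
move=> H; have ev := domino_even H.
rewrite [RHS](reindex_inj (@perm_inj _ s)) /= big_split_ord /=.
rewrite [X in _ = (_ + X)%N]big1 ?addn0 => [|i]; last by rewrite H /= ev.
by apply: eq_bigl => i; rewrite ev.
Qed.

Lemma sum_pick_ord (B : pzRingType) n (a : 'I_n) (F : 'I_n -> B) :
  \sum_k (a == k)%:R * F k = F a.
Proof.
rewrite (bigD1 a) //= eqxx mul1r big1 ?addr0 // => k /negPf.
by rewrite eq_sym => ->; rewrite mul0r.
Qed.

Section Gap.
Variable A : comNzRingType.

Definition gapmx L : 'M[{poly A}]_L :=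
  \matrix_(a, b) if (a < b)%N then 'X^(b - a.+1) else 0.

(* Congruence by the bidiagonal matrix [C] turns the form [q^(y_b - y_a - 1)]
   into one that only pairs consecutive indices. *)
Lemma pairsum_gap m : exists c : {poly A}, forall L (y : {ffun 'I_(m + m) -> 'I_L}),
  incr y -> pairsum (\matrix_(a, b) gapmx L (y a) (y b)) = c * 'X^(altsum y).
Proof.
(* The signed number of permutations whose pairs are consecutive indices. It depends on neither [L]
   nor [y], which is what the normalization requires. *)
exists (\sum_(s : 'S_(m + m)) (-1) ^+ s *
   \prod_(i < m) (s (rshift m i) == (s (lshift m i)).+1 :> nat)%:R).
move=> L y /incrP inc; set n := (m + m)%N in y inc *.
pose d (a : nat) := (natval y a.+1 - natval y a)%N.
pose C : 'M[{poly A}]_n := \matrix_(a, b) ((a == b)%:R - (b == a.+1 :> nat)%:R * 'X^(d a)).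
pose My : 'M[{poly A}]_n := \matrix_(a, b) gapmx L (y a) (y b).
pose S (a b : 'I_n) : {poly A} := (b == a.+1 :> nat)%:R * 'X^((d a).-1).
have detC : \det C = 1.
  rewrite -det_tr det_trig ?big1 // => [i _|].
    by rewrite !mxE eqxx ltn_eqF // mul0r subr0.
  apply/is_trig_mxP => i j ij; rewrite !mxE -val_eqE /= gtn_eqF // ltn_eqF; last by lia.
  by rewrite mul0r subr0.
have -> : pairsum My = pairsum (C *m My *m C^T) by rewrite pairsum_congr detC mul1r.
(* Row a minus q^(y_(a+1) - y_a) times row a+1 cancels everything beyond the superdiagonal, because
   the exponents add up. *)
have CM : C *m My = \matrix_(a, b) S a b.
  apply/matrixP => a b; rewrite !mxE.
  under eq_bigr do rewrite !mxE mulrBl.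
  rewrite sumrB sum_pick_ord.
  have E (k : 'I_n) : k = a.+1 :> nat -> d a = (y k - y a)%N.
    by move=> ka; rewrite /d -ka !natvalE.
  have [an|an] := ltnP a.+1 n; last first.
    rewrite big1 => [|k _]; last by rewrite ltn_eqF ?mul0r //; apply: leq_trans an.
    rewrite subr0 /S ltn_eqF ?(leq_trans (ltn_ord b)) // mul0r ifF //.
    apply/negbTE; rewrite -leqNgt leq_eqVlt.
    have [ab|] := eqVneq a b; first by rewrite ab eqxx.
    rewrite -val_eqE /= neq_ltn => /orP[|/inc ->]; last by rewrite orbT.
    by have := ltn_ord b; lia.
  pose a1 := Ordinal an.
  rewrite (bigD1 a1) //= eqxx mul1r big1 ?addr0 => [|k]; last first.
    by rewrite -val_eqE /= => /negPf ->; rewrite !mul0r.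
  rewrite (E a1) // /S (E a1) //.
  have ya := inc a a1 (ltnSn a).
  have [ba|ab] := leqP b a.
    rewrite ltn_eqF // mul0r.
    have yba : (y b <= y a)%N.
      have [->//|] := eqVneq b a; rewrite -val_eqE /= => nba.
      by apply/ltnW/inc; rewrite ltn_neqAle nba.
    rewrite !ifF ?mulr0 ?subr0 //; apply/negbTE; rewrite -leqNgt //.
    exact: leq_trans (ltnW ya).
  have yab := inc a b ab; rewrite yab.
  have [ba1|nba1] := eqVneq (b : nat) a.+1.
    have -> : b = a1 by apply: val_inj.
    by rewrite ltnn mulr0 subr0 mul1r; congr ('X^_); lia.
  have yab1 : (y a1 < y b)%N by apply: inc => /=; lia.
  rewrite yab1 mul0r -exprD; apply/eqP; rewrite subr_eq0; apply/eqP.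
  by congr ('X^_); lia.
rewrite CM /pairsum mulr_suml; apply: eq_bigr => s _.
rewrite -mulrA; congr (_ * _).
(* The right factor alters only diagonal entries, and a permutation never pairs an index with
   itself. *)
have entry (a b : 'I_n) : a != b -> ((\matrix_(a, b) S a b) *m C^T) a b = S a b.
  move=> nab; rewrite !mxE.
  under eq_bigr do rewrite !mxE mulrBr [X in X - _]mulrC.
  rewrite sumrB sum_pick_ord big1 ?subr0 // => k _.
  rewrite /S; case: eqP => [->|]; last by rewrite !mul0r.
  by rewrite eqSS val_eqE (negPf nab) mul0r mulr0.
under eq_bigr => i _.
  rewrite entry ?(inj_eq perm_inj) ?eq_lrshift // /S; over.
rewrite big_split /= -expr_sum.
have [all_dom|/forallPn[i ndom]] := boolP [forall i, s (rshift m i) == (s (lshift m i)).+1 :> nat].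
  congr (_ * 'X^_).
  rewrite (domino_sum (fun a => (d a).-1) (fun i => eqP (forallP all_dom i))).
  by apply: eq_bigr => a _; rewrite /d subnS.
by rewrite (bigD1 i) //= (negPf ndom) !mul0r.
Qed.

Lemma gap_minor_sum m : exists c : {poly A}, forall L (B : 'M[{poly A}]_(m + m, L)),
  pairsum (B *m gapmx L *m B^T) =
  c * \sum_(y : {ffun 'I_(m + m) -> 'I_L} | incr y)
        'X^(altsum y) * \det (\matrix_(k, a) B a (y k)).
Proof.
have [c Hc] := pairsum_gap m; exists c => L B.
rewrite pairsum_sorted mulr_sumr; apply: eq_bigr => y inc.
by rewrite Hc // mulrA.
Qed.

End Gap.

(** * Toeplitz forms *)

Definition nbsum (V : zmodType) (G : int -> V) (d : int) : V := G (d + 1) + G (d - 1).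

Section NbSum.
Variable V : zmodType.
Implicit Types G : int -> V.

Lemma eq_iter_nbsum G1 G2 n d : G1 =1 G2 ->
  iter n (@nbsum V) G1 d = iter n (@nbsum V) G2 d.
Proof. by move=> E; elim: n d => [|n IH] d //=; rewrite /nbsum !IH. Qed.

Lemma iter_nbsumD G1 G2 n d : iter n (@nbsum V) (fun x => G1 x + G2 x) d =
  iter n (@nbsum V) G1 d + iter n (@nbsum V) G2 d.
Proof. by elim: n d => [|n IH] d //=; rewrite /nbsum !IH addrACA. Qed.

Lemma iter_nbsum_shift G n c d : iter n (@nbsum V) (fun x => G (x + c)) d =
  iter n (@nbsum V) G (d + c).
Proof.
elim: n d => [|n IH] d //=; rewrite /nbsum !IH.
by congr (_ + _); congr (iter _ _ _ _); ring.
Qed.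

(** The hypothesis is a discrete wave equation: neighbour sums in one variable can be traded for
    neighbour sums in the other. *)
Lemma iter_nbsum_swap (F : int -> int -> V) n k d :
  (forall k d, F k (d + 1) + F k (d - 1) = F (k + 1) d + F (k - 1) d) ->
  iter n (@nbsum V) (F k) d = iter n (@nbsum V) (F^~ d) k.
Proof.
move=> H; elim: n k d => [|n IH] k d //.
rewrite iterS /nbsum !IH -/(@nbsum V) -iter_nbsumD iterSr.
by apply: eq_iter_nbsum => x; rewrite H.
Qed.

Lemma iter_nbsum_anti G c n : (forall d, G (c - d) = - G d) ->
  forall d, iter n (@nbsum V) G (c - d) = - iter n (@nbsum V) G d.
Proof.
move=> H; elim: n => [|n IH] d //=; rewrite /nbsum.
rewrite (_ : c - d + 1 = c - (d - 1)); last by ring.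
by rewrite (_ : c - d - 1 = c - (d + 1)) ?IH ?opprD 1?addrC //; ring.
Qed.

Lemma iter_nbsum_odd G n : (forall d, G (- d) = - G d) ->
  forall d, iter n (@nbsum V) G (- d) = - iter n (@nbsum V) G d.
Proof.
by move=> H d; rewrite -[- d]add0r iter_nbsum_anti // => d'; rewrite add0r.
Qed.

End NbSum.

Section Toep.
Variable B : comNzRingType.
Implicit Types (u v : {poly B}).

Definition pev (G : nat -> B) u : B := \sum_(a < size u) u`_a * G a.

Lemma pevE n G u : (size u <= n)%N -> pev G u = \sum_(a < n) u`_a * G a.
Proof.
move=> le; rewrite /pev (big_ord_widen n (fun a => u`_a * G a) le) big_mkcond.
by apply: eq_bigr => a _; case: ltnP => // ?; rewrite nth_default // mul0r.
Qed.

Lemma eq_pev G1 G2 u : G1 =1 G2 -> pev G1 u = pev G2 u.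
Proof. by move=> E; apply: eq_bigr => a _; rewrite E. Qed.

Lemma pevD G u v : pev G (u + v) = pev G u + pev G v.
Proof.
pose n := maxn (size u) (size v).
rewrite !(@pevE n) ?leq_maxl ?leq_maxr //; last exact: size_polyD.
by rewrite -big_split; apply: eq_bigr => a _; rewrite coefD mulrDl.
Qed.

Lemma pevZ G c u : pev G (c *: u) = c * pev G u.
Proof.
rewrite !(@pevE (size u)) ?size_scale_leq // mulr_sumr.
by apply: eq_bigr => a _; rewrite coefZ mulrA.
Qed.

Lemma pevXM G u : pev G ('X * u) = pev (fun a => G a.+1) u.
Proof.
rewrite (@pevE (size u).+1); last first.
  by apply: leq_trans (size_polyMleq _ _) _; rewrite size_polyX.
rewrite big_ord_recl coefXM eqxx mul0r add0r.
by apply: eq_bigr => a _; rewrite coefXM.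
Qed.

Lemma pev1 G : pev G 1 = G 0%N.
Proof. by rewrite /pev size_poly1 big_ord1 coef1 eqxx mul1r. Qed.

Lemma pev_lin G1 G2 c1 c2 u :
  pev (fun a => c1 * G1 a + c2 * G2 a) u = c1 * pev G1 u + c2 * pev G2 u.
Proof.
rewrite /pev !mulr_sumr -big_split; apply: eq_bigr => a _ /=.
by ring.
Qed.

(** The linear functional sending X^d to G(d), applied to u(1/X) v(X). *)
Definition toep (G : int -> B) u v : B :=
  pev (fun a => pev (fun b => G (b%:Z - a%:Z)) v) u.

Lemma eq_toep G1 G2 u v : G1 =1 G2 -> toep G1 u v = toep G2 u v.
Proof. by move=> E; apply: eq_pev => a; apply: eq_pev => b. Qed.

Lemma toep_lin G1 G2 c1 c2 u v : toep (fun d => c1 * G1 d + c2 * G2 d) u v =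
  c1 * toep G1 u v + c2 * toep G2 u v.
Proof. by rewrite -pev_lin; apply: eq_pev => a; rewrite pev_lin. Qed.

Lemma toepDl G u1 u2 v : toep G (u1 + u2) v = toep G u1 v + toep G u2 v.
Proof. exact: pevD. Qed.

Lemma toepZl G c u v : toep G (c *: u) v = c * toep G u v.
Proof. exact: pevZ. Qed.

Lemma toepDr G u v1 v2 : toep G u (v1 + v2) = toep G u v1 + toep G u v2.
Proof.
rewrite -[toep G u v1]mul1r -[toep G u v2]mul1r -pev_lin; apply: eq_pev => a.
by rewrite pevD !mul1r.
Qed.

Lemma toepZr G c u v : toep G u (c *: v) = c * toep G u v.
Proof.
rewrite -[RHS]addr0 -[0](mul0r (toep G u v)) -pev_lin; apply: eq_pev => a.
by rewrite pevZ mul0r addr0.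
Qed.

Lemma toepXl G u v : toep G ('X * u) v = toep (fun d => G (d - 1)) u v.
Proof.
rewrite /toep pevXM; apply: eq_pev => a; apply: eq_pev => b.
by congr (G _); lia.
Qed.

Lemma toepXr G u v : toep G u ('X * v) = toep (fun d => G (d + 1)) u v.
Proof.
apply: eq_pev => a; rewrite pevXM; apply: eq_pev => b.
by congr (G _); lia.
Qed.

Lemma toepXX G u v : toep G ('X * u) ('X * v) = toep G u v.
Proof. by rewrite toepXl toepXr; apply: eq_toep => d; rewrite addrK. Qed.

Lemma toepXnXn G n u v : toep G ('X^n * u) ('X^n * v) = toep G u v.
Proof.
by elim: n => [|n IH]; rewrite ?expr0 ?mul1r // exprS -!mulrA toepXX.
Qed.

(** This is X (X + 1/X), and X + 1/X is invariant under inversion of X. Against a factor 'X in the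
    other argument it acts on [G] as [nbsum]. *)
Definition polyK : {poly B} := 1 + 'X^2.

Lemma toepKX G u v : toep G (polyK * u) ('X * v) = toep (nbsum G) u v.
Proof.
rewrite /polyK mulrDl mul1r toepDl expr2 -mulrA toepXX toepXl toepXr.
rewrite -[RHS](eq_toep (G1 := fun d => 1 * G (d + 1) + 1 * G (d - 1))); last first.
  by move=> d; rewrite !mul1r.
by rewrite toep_lin !mul1r.
Qed.

Lemma toepXK G u v : toep G ('X * u) (polyK * v) = toep (nbsum G) u v.
Proof.
rewrite /polyK mulrDl mul1r toepDr expr2 -mulrA toepXX toepXl toepXr addrC.
rewrite -[RHS](eq_toep (G1 := fun d => 1 * G (d + 1) + 1 * G (d - 1))); last first.
  by move=> d; rewrite !mul1r.
by rewrite toep_lin !mul1r.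
Qed.

Lemma toepKnXn G n u v :
  toep G (polyK ^+ n * u) ('X^n * v) = toep (iter n (@nbsum _) G) u v.
Proof.
elim: n G => [|n IH] G; first by rewrite !expr0 !mul1r.
by rewrite !exprS -!mulrA toepKX IH iterSr.
Qed.

Lemma toepXnKn G n u v :
  toep G ('X^n * u) (polyK ^+ n * v) = toep (iter n (@nbsum _) G) u v.
Proof.
elim: n G => [|n IH] G; first by rewrite !expr0 !mul1r.
by rewrite !exprS -!mulrA toepXK IH iterSr.
Qed.

(** The two prefixes are X^(p+i) (X + 1/X)^i and X^(r+j) (X + 1/X)^j. The equal shifts cancel and
    the powers of X + 1/X multiply. *)
Lemma toep_iter G p r i j u v : (p + i = r + j)%N ->
  toep G ('X^p * polyK ^+ i * u) ('X^r * polyK ^+ j * v) =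
  toep (iter (i + j) (@nbsum _) G) u v.
Proof.
move=> E; rewrite -(toepXnXn _ i).
rewrite (_ : 'X^i * ('X^p * polyK ^+ i * u) = polyK ^+ i * ('X^(r + j) * u)); last first.
  by rewrite -E exprD; ring.
by rewrite toepKnXn exprD -!mulrA toepXnXn toepXnKn addnC iterD.
Qed.

Lemma toepQX G c1 c2 u v :
  toep G ((c1 *: 'X - c2 *: polyK) * u) ('X * v) =
  toep (fun d => c1 * G d - c2 * nbsum G d) u v.
Proof.
rewrite mulrBl -!scalerAl -scaleNr toepDl !toepZl toepXX toepKX -toep_lin.
by apply: eq_toep => d; rewrite mulNr.
Qed.

(** (1/X - c)(X - c) = 1 + c^2 - c (X + 1/X). *)
Lemma toepXqXq G c u v :
  toep G (('X - c%:P) * u) (('X - c%:P) * v) =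
  toep (fun d => (1 + c ^+ 2) * G d - c * nbsum G d) u v.
Proof.
rewrite !mulrBl !mul_polyC -!scaleNr !(toepDl, toepDr, toepZl, toepZr) toepXX.
rewrite toepXl toepXr.
transitivity (1 * ((1 + c ^+ 2) * toep G u v + (- c) * toep (fun d => G (d + 1)) u v)
    + (- c) * toep (fun d => G (d - 1)) u v); first by ring.
rewrite -toep_lin -toep_lin; apply: eq_toep => d; rewrite /nbsum; ring.
Qed.

Lemma toep_base G : toep G ('X - 1) ('X + 1) = G (-1) - G 1.
Proof.
have X1 : ('X : {poly B}) = 'X * 1 by rewrite mulr1.
rewrite -scaleN1r !(toepDl, toepDr, toepZl) X1 toepXX !toepXl toepXr /toep !pev1.
by rewrite subrr add0r sub0r; ring.
Qed.

(** The value is 2 G(0) - G(1) - G(-1), and oddness gives G(0) + G(0) = 0 without dividing by 2.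
    Pairings of the isotropic rows all reduce to this one value, for various odd [G]. *)
Lemma toep_base_anti G : (forall d, G (- d) = - G d) ->
  toep G ('X - 1) ('X - 1) = 0.
Proof.
move=> od; have X1 : ('X : {poly B}) = 'X * 1 by rewrite mulr1.
rewrite -scaleN1r !(toepDl, toepDr, toepZl, toepZr) X1 toepXX !toepXl toepXr /toep !pev1.
have G00 : G 0 + G 0 = 0 by have := od 0; rewrite oppr0 => {1}->; rewrite addNr.
by rewrite subrr !add0r (od 1) -[RHS]G00; ring.
Qed.

End Toep.

(** * Ballot numbers and the two shapes of determinants *)

Section Ballot.
Variable A : comNzRingType.

(* The number of nonnegative lattice paths of length [n] from 0 to [l]; they give
   the change of basis between the two shapes of determinants. *)
Fixpoint ballot (n l : nat) : A :=
  if n is n'.+1 then ballot n' l.+1 + (if l is l'.+1 then ballot n' l' else 0)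
  else (l == 0%N)%:R.

Lemma ballotS n l : ballot n.+1 l =
  ballot n l.+1 + (if l is l'.+1 then ballot n l' else 0).
Proof. by []. Qed.

Arguments ballot : simpl never.

Lemma ballot_gt n l : (n < l)%N -> ballot n l = 0.
Proof.
elim: n l => [|n IH] [|l] // nl; rewrite ballotS !IH ?addr0 //; lia.
Qed.

Lemma ballot_diag n : ballot n n = 1.
Proof. by elim: n => // n IH; rewrite ballotS IH ballot_gt ?add0r. Qed.

(** The reflection principle: [G] is antisymmetric about -1, so only the paths that stay nonnegative
    contribute. The induction passes to [nbsum G], which has the same symmetry. *)
Lemma iter_nbsum_ballot n (G : int -> A) m : (n < m)%N ->
  (forall d, G (- 2 - d) = - G d) -> G (-1) = 0 ->
  iter n (@nbsum A) G 0 = \sum_(l < m) ballot n l * G l%:Z.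
Proof.
elim: n G m => [|n IH] G [|m] // nm sG G1.
  by rewrite big_ord_recl /= mul1r big1 ?addr0 // => i _; rewrite mul0r.
rewrite iterSr (IH _ m.+1); last 3 first.
- by lia.
- move=> d; rewrite /nbsum (_ : - 2 - d + 1 = -2 - (d - 1)); last by ring.
  by rewrite (_ : - 2 - d - 1 = -2 - (d + 1)) ?sG ?opprD 1?addrC //; ring.
- by rewrite /nbsum (_ : -1 + 1 = 0) // (_ : -1 - 1 = -2 - 0) // sG subrr.
rewrite /nbsum; under eq_bigr do rewrite mulrDr.
under [RHS]eq_bigr do rewrite ballotS mulrDl.
rewrite !big_split /= addrC; congr (_ + _).
  rewrite big_ord_recl /= sub0r G1 mulr0 add0r [RHS]big_ord_recr /= ballot_gt ?mul0r ?addr0; last by lia.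
  by apply: eq_bigr => l _; rewrite /bump /=; congr (_ * G _); lia.
rewrite big_ord_recr /= ballot_gt ?mul0r ?addr0; last by lia.
rewrite [RHS]big_ord_recl /= mul0r add0r.
by apply: eq_bigr => l _; rewrite /bump /=; congr (_ * G _); lia.
Qed.

(** Ballot numbers give a unitriangular change of basis among the first w rows. Paths shorter than w
    do not reach w, so the last row stays out of it. *)
Lemma det_ballot w (r : 'I_w.+1 -> A) (g : int -> A) :
  (forall d, g (- 2 - d) = - g d) -> g (-1) = 0 ->
  \det (\matrix_(i < w.+1, j < w.+1)
     if (i < w)%N then iter (i + j) (@nbsum A) g 0 else r j) =
  \det (\matrix_(i < w.+1, j < w.+1)
     if (i < w)%N then iter j (@nbsum A) g i%:Z else r j).
Proof.
move=> sg g1; set M1 := \matrix_(_, _) _; set M2 := (X in _ = \det X).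
pose t : 'M[A]_w.+1 := \matrix_(i, l) if (i < w)%N then ballot i l else (i == l)%:R.
have -> : M1 = t *m M2.
  apply/matrixP => i j; rewrite !mxE.
  under eq_bigr do rewrite !mxE.
  have [iw|wi] := ltnP i w; last by rewrite sum_pick_ord ltnNge wi.
  rewrite iterD (@iter_nbsum_ballot i _ w.+1) ?ltnS 1?ltnW //; last 2 first.
  - exact: iter_nbsum_anti.
  - case: (nat_of_ord j) => //= k; rewrite /nbsum (_ : -1 + 1 = 0) //.
    by rewrite (_ : -1 - 1 = -2 - 0) // iter_nbsum_anti // subrr.
  apply: eq_bigr => l _; case: ltnP => // wl.
  by rewrite ballot_gt ?mul0r //; apply: leq_trans wl.
rewrite det_mulmx det_trig ?big1 ?mul1r // => [i _|].
  by rewrite mxE eqxx ballot_diag; case: ifP.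
apply/is_trig_mxP => i j ij; rewrite !mxE ballot_gt //.
by rewrite -val_eqE /= ltn_eqF // if_same.
Qed.

Lemma det_ballot_full w (g : int -> A) :
  (forall d, g (- 2 - d) = - g d) -> g (-1) = 0 ->
  \det (\matrix_(i < w, j < w) iter (i + j) (@nbsum A) g 0) =
  \det (\matrix_(i < w, j < w) iter j (@nbsum A) g i%:Z).
Proof.
move=> sg g1; set M1 := \matrix_(_, _) _; set M2 := (X in _ = \det X).
pose t : 'M[A]_w := \matrix_(i, l) ballot i l.
have -> : M1 = t *m M2.
  apply/matrixP => i j; rewrite !mxE.
  under eq_bigr do rewrite !mxE.
  rewrite iterD (@iter_nbsum_ballot i _ w) //.
  - exact: iter_nbsum_anti.
  - case: (nat_of_ord j) => //= k; rewrite /nbsum (_ : -1 + 1 = 0) //.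
    by rewrite (_ : -1 - 1 = -2 - 0) // iter_nbsum_anti // subrr.
rewrite det_mulmx det_trig ?big1 ?mul1r // => [i _|].
  by rewrite mxE ballot_diag.
by apply/is_trig_mxP => i j ij; rewrite !mxE ballot_gt.
Qed.

End Ballot.

Lemma torsion_free_poly (A : nzRingType) : torsion_free A -> torsion_free {poly A}.
Proof.
move=> tf n p /polyP E; apply/polyP => i; have := E i.
by rewrite coefMn !coef0 => /tf.
Qed.

(** * The skew Toeplitz form and its recurrence *)

Section Kappa.
Variable A : comNzRingType.

(** The skew part of the form q^(b-a-1), as a function of d = b - a. *)
Definition kap (d : int) : {poly A} :=
  match d with Posz n.+1 => 'X^n | Posz 0 => 0 | Negz n => - 'X^n end.

Lemma kapN d : kap (- d) = - kap d.
Proof. by case: d => [[|n]|n] //=; rewrite ?oppr0 ?opprK. Qed.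

Lemma kap_coef d k : (kap d)`_k = (d == k.+1%:Z)%:R - (d == - k.+1%:Z)%:R.
Proof.
case: d => [[|n]|n]; rewrite /kap ?coef0 ?coefN ?coefXn ?subrr //.
  by rewrite subr0 eq_sym.
by rewrite sub0r eq_sym.
Qed.

(** [kap] is a Green function: powers of q and of 1/q solve the homogeneous recurrence, and the
    change of sign at 0 leaves sources at 1 and -1 only. *)
Lemma kap_rel d : (1 + 'X^2) * kap d - 'X * nbsum kap d =
  (d == 1)%:R - (d == -1)%:R.
Proof.
rewrite /nbsum; case: d => [[|[|n]]|[|n]].
- rewrite (_ : Posz 0 + 1 = 1) // (_ : Posz 0 - 1 = -1) //=.
  by rewrite subrr mulr0; ring.
- rewrite (_ : Posz 1 + 1 = 2) // (_ : Posz 1 - 1 = 0) //= expr0.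
  by rewrite expr1; ring.
- rewrite (_ : Posz n.+2 + 1 = Posz n.+3); last by lia.
  rewrite (_ : Posz n.+2 - 1 = Posz n.+1); last by lia.
  by rewrite /= !exprS expr0; ring.
- rewrite (_ : Negz 0 + 1 = 0) // (_ : Negz 0 - 1 = Negz 1) //= expr0.
  by rewrite !exprS expr0; ring.
- rewrite (_ : Negz n.+1 + 1 = Negz n); last by lia.
  rewrite (_ : Negz n.+1 - 1 = Negz n.+2); last by lia.
  by rewrite /= !exprS expr0; ring.
Qed.

End Kappa.

Arguments kap : simpl never.

Section Correlation.
Variable A : comNzRingType.
Implicit Types (e : int -> A) (N : nat).

Definition supported N e : Prop :=
  (forall n, e (Negz n) = 0) /\ (forall n : nat, (N < n)%N -> e n%:Z = 0).

Definition corr N e (r : int) : A := \sum_(s < N.+1) e s%:Z * e (s%:Z + r).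

Definition corr2 N e (r : int) : A := corr N e r - corr N e (r + 2).

Lemma corrE N e r : supported N e ->
  corr N e r = \sum_(s < N.+1) \sum_(t < N.+1)
    (t%:Z - s%:Z == r)%:R * (e s%:Z * e t%:Z).
Proof.
move=> [e0 eN]; apply: eq_bigr => s _.
have E (t : 'I_N.+1) : (t%:Z - s%:Z == r) = (t%:Z == s%:Z + r) by lia.
under eq_bigr do rewrite E mulrCA.
rewrite -mulr_sumr; congr (_ * _).
case: (s%:Z + r) => [p|p]; last first.
  by rewrite e0 big1 // => t _; rewrite mul0r.
have [pN|Np] := ltnP p N.+1; last first.
  rewrite eN // big1 // => t _; rewrite eqz_nat ltn_eqF ?mul0r //.
  exact: leq_trans Np.
rewrite (bigD1 (Ordinal pN)) //= eqxx mul1r big1 ?addr0 // => t.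
by rewrite -val_eqE /= eqz_nat => /negPf ->; rewrite mul0r.
Qed.

Lemma corrN N e r : supported N e -> corr N e (- r) = corr N e r.
Proof.
move=> se; rewrite !corrE // exchange_big; apply: eq_bigr => s _.
apply: eq_bigr => t _; rewrite [e s%:Z * _]mulrC; congr (_%:R * _).
by congr nat_of_bool; lia.
Qed.

Lemma corr2_anti N e d : supported N e -> corr2 N e (- 2 - d) = - corr2 N e d.
Proof.
move=> se; rewrite /corr2 opprB; congr (_ - _); rewrite -corrN //; congr corr; ring.
Qed.

Lemma corr2_N1 N e : supported N e -> corr2 N e (-1) = 0.
Proof. by move=> se; rewrite /corr2 corrN // subrr. Qed.

Definition qcorr N e (d : int) : {poly A} :=
  \sum_(s < N.+1) \sum_(t < N.+1) (e s%:Z * e t%:Z)%:P * kap A (t%:Z - s%:Z + d).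

Lemma qcorr_odd N e d : qcorr N e (- d) = - qcorr N e d.
Proof.
rewrite /qcorr exchange_big -sumrN; apply: eq_bigr => s _.
rewrite -sumrN; apply: eq_bigr => t _.
rewrite -mulrN -kapN mulrC [e t%:Z * _]mulrC mulrC; congr (_ * kap A _); ring.
Qed.

Lemma qcorr_rel N e d : supported N e ->
  (1 + 'X^2) * qcorr N e d - 'X * nbsum (qcorr N e) d = (corr2 N e (d - 1))%:P.
Proof.
move=> se; rewrite /nbsum /qcorr -big_split /= !mulr_sumr -sumrB.
have -> : corr2 N e (d - 1) = corr N e (1 - d) - corr N e (- 1 - d).
  by rewrite /corr2 -corrN // -[X in _ - X]corrN //; congr (corr _ _ _ - corr _ _ _); ring.
rewrite !corrE // -sumrB raddf_sum /=; apply: eq_bigr => s _.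
rewrite -big_split /= !mulr_sumr -!sumrB raddf_sum /=; apply: eq_bigr => t _.
rewrite -mulrDr mulrCA [X in _ - X]mulrCA -mulrBr.
rewrite (_ : t%:Z - s%:Z + (d + 1) = t%:Z - s%:Z + d + 1); last by ring.
rewrite (_ : t%:Z - s%:Z + (d - 1) = t%:Z - s%:Z + d - 1); last by ring.
rewrite -/(nbsum (kap A) (t%:Z - s%:Z + d)) kap_rel -mulrBl [RHS]polyCM mulrC.
congr (_ * _); rewrite polyCB !polyC_natr.
by congr (_%:R - _%:R); congr nat_of_bool; lia.
Qed.

(** The coefficient of q^k in G(d) is f_(k+1-d) - f_(k+1+d), which solves the wave equation in k and
    d. So neighbour sums in d become neighbour sums in k, and d = 1 gives f_k - f_(k+2). *)
Lemma qcorr_coef N e j k : supported N e ->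
  (iter j (@nbsum _) (qcorr N e) 1)`_k = iter j (@nbsum A) (corr2 N e) k%:Z.
Proof.
move=> se; pose F (k d : int) := corr N e (k + 1 - d) - corr N e (k + 1 + d).
have cF d : (qcorr N e d)`_k = F k%:Z d.
  rewrite /F -[X in _ - X]corrN // !corrE // /qcorr coef_sum -sumrB.
  apply: eq_bigr => s _; rewrite coef_sum -sumrB; apply: eq_bigr => t _.
  rewrite coefCM kap_coef mulrC -mulrBl; congr ((_%:R - _%:R) * _);
  by congr nat_of_bool; lia.
have cT d : (iter j (@nbsum _) (qcorr N e) d)`_k = iter j (@nbsum _) (F k%:Z) d.
  by elim: j d => [|j IH] d //=; rewrite /nbsum coefD !IH.
rewrite cT iter_nbsum_swap => [|k' d]; last first.
  rewrite /F; rewrite [k' + 1 - (d + 1)](_ : _ = k' - 1 + 1 - d); last by ring.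
  rewrite [k' + 1 + (d + 1)](_ : _ = k' + 1 + 1 + d); last by ring.
  rewrite [k' + 1 - (d - 1)](_ : _ = k' + 1 + 1 - d); last by ring.
  by rewrite [k' + 1 + (d - 1)](_ : _ = k' - 1 + 1 + d); ring.
apply: eq_iter_nbsum => x; rewrite /F /corr2.
by congr (corr _ _ _ - corr _ _ _); ring.
Qed.

Lemma sum_shift N e L j (F : nat -> {poly A}) : supported N e -> (j + N < L)%N ->
  \sum_(a < L) (e (a%:Z - j%:Z))%:P * F a =
  \sum_(s < N.+1) (e s%:Z)%:P * F (j + s)%N.
Proof.
move=> [e0 eN] jL.
rewrite -(big_mkord xpredT (fun a => (e (a%:Z - j%:Z))%:P * F a)).
rewrite (big_cat_nat (n := j)) //=; last by lia.
rewrite big_nat_cond big1 ?add0r => [|a /andP[/andP[_ aj] _]]; last first.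
  rewrite (_ : a%:Z - j%:Z = Negz (j - a).-1) ?e0 ?mul0r //; lia.
rewrite (big_cat_nat (n := j + N.+1)) //=; [|lia|lia].
rewrite [X in _ + X]big_nat_cond [X in _ + X]big1 ?addr0 => [|a /andP[/andP[ja _] _]]; last first.
  rewrite (_ : a%:Z - j%:Z = (a - j)%N%:Z) ?eN ?mul0r //; lia.
rewrite -{1}[j]add0n big_addn addKn big_mkord; apply: eq_bigr => s _.
by rewrite addnC; congr ((e _)%:P * _); lia.
Qed.

Definition toepmx e n L : 'M[{poly A}]_(n, L) := \matrix_(j, y) (e (y%:Z - j%:Z))%:P.

Lemma skew_entry n L (B : 'M[{poly A}]_(n, L)) j k :
  (B *m gapmx A L *m B^T) j k - (B *m gapmx A L *m B^T) k j =
  \sum_a B j a * \sum_b B k b * kap A (b%:Z - a%:Z).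
Proof.
have E i l : (B *m gapmx A L *m B^T) i l =
    \sum_a \sum_b B i a * B l b * gapmx A L a b.
  rewrite exchange_big mxE; apply: eq_bigr => b _; rewrite !mxE mulr_suml.
  by apply: eq_bigr => a _; rewrite -mulrA [_ * B l b]mulrC mulrA.
rewrite !E [X in _ - X]exchange_big -sumrB; apply: eq_bigr => a _.
rewrite -sumrB mulr_sumr; apply: eq_bigr => b _.
rewrite [B k b * B j a]mulrC -mulrBr -mulrA; congr (_ * (_ * _)); rewrite !mxE.
case: (ltngtP a b) => ab.
- rewrite subr0 (_ : b%:Z - a%:Z = Posz (b - a.+1).+1) //; lia.
- rewrite sub0r (_ : b%:Z - a%:Z = Negz (a - b.+1)) //; lia.
- by rewrite (_ : b%:Z - a%:Z = 0) ?subrr //; lia.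
Qed.

(** The bounds keep the support of both shifted rows inside the [L] columns, so the form depends
    only on k - j. *)
Lemma toepmx_skew N e j k L : supported N e -> (j + N < L)%N -> (k + N < L)%N ->
  \sum_(a < L) (e (a%:Z - j%:Z))%:P * \sum_(b < L) (e (b%:Z - k%:Z))%:P * kap A (b%:Z - a%:Z)
  = qcorr N e (k%:Z - j%:Z).
Proof.
move=> se jL kL; under eq_bigr do rewrite (sum_shift (fun b => kap A (b%:Z - _)) se kL).
rewrite (sum_shift (fun a => \sum_(s < N.+1) (e s%:Z)%:P * kap A ((k + s)%N%:Z - a%:Z)) se jL).
apply: eq_bigr => s _; rewrite mulr_sumr; apply: eq_bigr => t _.
by rewrite mulrA -polyCM; congr (_ * kap A _); lia.
Qed.

End Correlation.

Section Sizes.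
Variable B : comNzRingType.

Lemma size_XnM n (u : {poly B}) : (size ('X^n * u)%R <= n + size u)%N.
Proof. by apply: leq_trans (size_polyMleq _ _) _; rewrite size_polyXn. Qed.

Lemma size_XM (u : {poly B}) : (size ('X * u)%R <= (size u).+1)%N.
Proof. by rewrite -(expr1 'X); exact: size_XnM. Qed.

Lemma size_KnM n (u : {poly B}) : (size (polyK B ^+ n * u)%R <= n.*2 + size u)%N.
Proof.
elim: n => [|n IH]; first by rewrite expr0 mul1r.
rewrite exprS -mulrA; apply: leq_trans (size_polyMleq _ _) _.
have : (size (polyK B) <= 3)%N.
  by apply: leq_trans (size_polyD _ _) _; rewrite size_poly1 size_polyXn.
by move: IH; lia.
Qed.

Lemma size_Xsub1 : (size ('X - 1 : {poly B})%R <= 2)%N.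
Proof. by rewrite size_XsubC. Qed.

Lemma size_Xadd1 : (size ('X + 1 : {poly B})%R <= 2)%N.
Proof. by rewrite size_XaddC. Qed.

Lemma size_Q (c1 c2 : B) : (size (c1 *: 'X - c2 *: polyK B)%R <= 3)%N.
Proof.
apply: leq_trans (size_polyD _ _) _; rewrite geq_max size_polyN.
apply/andP; split; apply: leq_trans (size_scale_leq _ _) _; rewrite ?size_polyX //.
by apply: leq_trans (size_polyD _ _) _; rewrite size_poly1 size_polyXn.
Qed.

End Sizes.

Lemma iter_nbsum_polyC (A : nzRingType) (G : int -> A) n d :
  iter n (@nbsum _) (fun x => (G x)%:P) d = (iter n (@nbsum _) G d)%:P.
Proof. by elim: n d => [|n IH] d //=; rewrite /nbsum !IH polyCD. Qed.

Lemma congr_skew (B : comNzRingType) n (C H : 'M[B]_n) i j :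
  (C *m H *m C^T) i j - (C *m H *m C^T) j i =
  \sum_k C i k * \sum_l C j l * (H k l - H l k).
Proof.
have E a b : (C *m H *m C^T) a b = \sum_k \sum_l C a k * C b l * H k l.
  rewrite exchange_big mxE; apply: eq_bigr => l _; rewrite !mxE mulr_suml.
  by apply: eq_bigr => k _; rewrite -mulrA [_ * C b l]mulrC mulrA.
rewrite !E [X in _ - X]exchange_big -sumrB; apply: eq_bigr => k _.
rewrite -sumrB mulr_sumr; apply: eq_bigr => l _.
by rewrite [C j l * C i k]mulrC -mulrBr -mulrA.
Qed.

(** * Weighted sums of Toeplitz minors *)

Section Identity.
Variable A : comNzRingType.
Hypothesis tfA : torsion_free A.

Let tfP : torsion_free {poly A} := torsion_free_poly tfA.

Definition qminors N (e : int -> A) n : {poly A} :=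
  \sum_(y : {ffun 'I_n -> 'I_(N + n)} | incr y)
    'X^(altsum y) * \det (\matrix_(k, a) (e ((y k)%:Z - a%:Z))%:P).

Local Notation q := ('X : {poly A}).
Local Notation K := (polyK {poly A}).
(** [Q] divided by 'X acts as the operator of the recurrence: one factor [Q] replaces the form G,
    whose values involve q, by one whose values do not. *)
Local Notation Q := ((1 + q ^+ 2) *: 'X - q *: K).

Section Reduce.
Variables (N : nat) (e : int -> A).
Hypothesis se : supported N e.
Let G := qcorr N e.
Let h d := (corr2 N e (d - 1))%:P.

Let h_odd d : h (- d) = - h d.
Proof. by rewrite /h -polyCN -corr2_anti //; congr ((corr2 _ _ _)%:P); ring. Qed.

Let reduceQ w i j u v : (i < w)%N -> (j <= w)%N ->
  toep G ('X^(w - i.+1) * K ^+ i * (Q * u)) ('X^(w - j) * K ^+ j * v) =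
  toep (iter (i + j) (@nbsum _) h) u v.
Proof.
move=> iw jw; rewrite -toepXX.
rewrite (_ : 'X * ('X^(w - i.+1) * K ^+ i * (Q * u)) =
             Q * ('X^(w - i) * K ^+ i * u)); last first.
  by rewrite (_ : (w - i = (w - i.+1).+1)%N) ?exprS; [ring|lia].
rewrite toepQX -(@toep_iter _ h (w - i) (w - j)); last by lia.
by apply: eq_toep => d; rewrite qcorr_rel.
Qed.

Let reduce1 w j u v : (j <= w)%N ->
  toep G ('X^w * u) ('X^(w - j) * K ^+ j * v) = toep (iter j (@nbsum _) G) u v.
Proof.
by move=> jw; rewrite -(@toep_iter _ G w (w - j) 0) ?expr0 ?mulr1 //; lia.
Qed.

Let Qsplit w i u : (i < w)%N -> 'X^(w - i.+1) * K ^+ i * (Q * u) =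
  (1 + q ^+ 2) *: ('X^(w - i) * K ^+ i * u) + (- q) *: ('X^(w - i.+1) * K ^+ i.+1 * u).
Proof.
move=> iw; rewrite (_ : (w - i = (w - i.+1).+1)%N); last by lia.
by rewrite -!mul_polyC polyCN !exprS; ring.
Qed.

(** Palindromes centred at degree w, times X - 1 in the first half and X + 1 in the second. The
    degree bound leaves room for [Q] in only w rows of the first half; the remaining one is the row
    whose pairings keep q. *)
Definition evenrow w (i : 'I_(w.+1 + w.+1)) : {poly {poly A}} :=
  match split i with
  | inl i => if (i < w)%N then 'X^(w - i.+1) * K ^+ i * (Q * ('X - 1))
             else 'X^w * ('X - 1)
  | inr j => 'X^(w - j) * K ^+ j * ('X + 1)
  end.

Lemma size_evenrow w i : (size (@evenrow w i) <= w.+1 + w.+1)%N.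
Proof.
rewrite /evenrow; case: split => j.
  case: ltnP => jw.
    rewrite -mulrA; apply: leq_trans (size_XnM _ _) _.
    apply: leq_trans (leq_add (leqnn _) (size_KnM _ _)) _.
    have le4 a b : (a <= 3 -> b <= 2 -> (a + b).-1 <= 4)%N by lia.
    apply: leq_trans (leq_add (leqnn _) (leq_add (leqnn _) (leq_trans (size_polyMleq _ _)
      (le4 _ _ (size_Q _ _) (size_Xsub1 _))))) _.
    by lia.
  apply: leq_trans (size_XnM _ _) _.
  by apply: leq_trans (leq_add (leqnn _) (size_Xsub1 _)) _; lia.
rewrite -mulrA; apply: leq_trans (size_XnM _ _) _.
apply: leq_trans (leq_add (leqnn _) (size_KnM _ _)) _.
apply: leq_trans (leq_add (leqnn _) (leq_add (leqnn _) (size_Xadd1 _))) _.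
by have := ltn_ord j; lia.
Qed.

(** Each pairing reduces to an odd form evaluated at X - 1 twice. The reduction consumes a single
    [Q], so when both rows carry one, the second is split by [Qsplit]. *)
Lemma evenrow_iso w (i j : 'I_w.+1) :
  toep G (evenrow (lshift _ i)) (evenrow (lshift _ j)) = 0.
Proof.
rewrite /evenrow !(unsplitK (inl _ _)).
have G_odd d : G (- d) = - G d by exact: qcorr_odd.
case: (ltnP i w) => iw; case: (ltnP j w) => jw.
- rewrite [X in toep G _ X]Qsplit // toepDr !toepZr !reduceQ ?(ltnW jw) //.
  by rewrite !toep_base_anti ?mulr0 ?addr0 //; exact: iter_nbsum_odd.
- have -> : 'X^w * ('X - 1) = 'X^(w - 0) * K ^+ 0 * ('X - 1) :> {poly {poly A}}.
    by rewrite subn0 expr0 mulr1.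
  rewrite reduceQ //.
  by rewrite toep_base_anti //; exact: iter_nbsum_odd.
- rewrite Qsplit // toepDr !toepZr !reduce1 ?(ltnW jw) //.
  by rewrite !toep_base_anti ?mulr0 ?addr0 //; exact: iter_nbsum_odd.
- by rewrite toepXnXn toep_base_anti.
Qed.

Lemma evenrow_pair w (i j : 'I_w.+1) :
  toep G (evenrow (lshift _ i)) (evenrow (rshift _ j)) =
  - 2%:R * (if (i < w)%N then (iter (i + j) (@nbsum _) (corr2 N e) 0)%:P
            else iter j (@nbsum _) G 1).
Proof.
rewrite /evenrow (unsplitK (inl _ _)) (unsplitK (inr _ _)).
have G_odd d : G (- d) = - G d by exact: qcorr_odd.
have jw : (j <= w)%N by rewrite -ltnS.
case: ltnP => iw; rewrite ?reduceQ ?reduce1 // toep_base iter_nbsum_odd //.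
  rewrite -[0](subrr 1) -iter_nbsum_shift -iter_nbsum_polyC -/h.
  by ring.
by ring.
Qed.

End Reduce.

Lemma even_proportional w : exists (a : {poly A}) (b : nat), forall N e,
  supported N e -> a * qminors N e (w.+1 + w.+1) = b.+1%:R *
   \det (\matrix_(i < w.+1, j < w.+1)
     if (i < w)%N then (iter (i + j) (@nbsum _) (corr2 N e) 0)%:P
     else iter j (@nbsum _) (qcorr N e) 1).
Proof.
have [c Hc] := gap_minor_sum A w.+1.
have [b Hb] := pairsum_isotropic w.+1 tfP.
pose C : 'M[{poly A}]_(w.+1 + w.+1) := \matrix_(i, j) (evenrow i)`_j.
(* The pairing block is -2 times the wanted matrix: the sign goes to the left-hand factor, 2^(w+1)
   into the positive integer. *)
exists ((-1) ^+ w.+1 * (\det C * c)), (b.+1 * 2 ^ w.+1).-1 => N e se.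
rewrite prednK ?muln_gt0 ?expn_gt0 //; set D := \matrix_(_, _) _.
set n := (w.+1 + w.+1)%N in C *.
pose B := toepmx e n (N + n); 
have [X defX] : {X | X = C *m (B *m gapmx A _ *m B^T) *m C^T} by eexists.
have Xskew i j : X i j - X j i = toep (qcorr N e) (evenrow i) (evenrow j).
  rewrite defX congr_skew /toep (pevE _ (size_evenrow i)); apply: eq_bigr => k _.
  rewrite mxE (pevE _ (size_evenrow j)); congr (_ * _); apply: eq_bigr => l _.
  rewrite mxE skew_entry; congr (_ * _).
  rewrite -(@toepmx_skew _ N e k l (N + n)) //; [|have := ltn_ord k; lia|have := ltn_ord l; lia].
  apply: eq_bigr => a _; rewrite mxE; congr (_ * _).
  by apply: eq_bigr => b' _; rewrite mxE.
have XN : ursubmx X - (dlsubmx X)^T = (- 2%:R) *: D.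
  by apply/matrixP => i j; rewrite !mxE Xskew evenrow_pair.
have Xsym : (ulsubmx X)^T = ulsubmx X.
  apply/matrixP => i j; rewrite !mxE; apply/eqP.
  by rewrite -subr_eq0 Xskew evenrow_iso.
have := Hb X Xsym; rewrite XN detZ defX pairsum_congr Hc.
have -> : \sum_(y : {ffun 'I_n -> 'I_(N + n)} | incr y)
     'X^(altsum y) * \det (\matrix_(k, a) B a (y k)) = qminors N e n.
  apply: eq_bigr => y _; congr (_ * \det _); apply/matrixP => k a.
  by rewrite !mxE.
rewrite -!mulrA => ->; rewrite natrM natrX mulrCA -!mulrA; congr (_ * _).
by rewrite [LHS]mulrA -exprMn mulrNN mul1r.
Qed.

Lemma cofactor_last (R1 R2 : comNzRingType) (f : {rmorphism R1 -> R2}) w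
   (M1 : 'M[R1]_w.+1) (M2 : 'M[R2]_w.+1) j :
  (forall i k : 'I_w.+1, (i < w)%N -> M2 i k = f (M1 i k)) ->
  cofactor M2 ord_max j = f (cofactor M1 ord_max j).
Proof.
move=> H; rewrite /cofactor rmorphM rmorphXn rmorphN1 -det_map_mx; congr (_ * \det _).
by apply/matrixP => i k; rewrite !mxE H // lift_max; exact: ltn_ord.
Qed.

(** Only the last row involves q, so the coefficient can be taken inside its cofactor expansion;
    [det_ballot] then reshapes the constant rows. *)
Lemma even_det_coef w N (e : int -> A) k : supported N e ->
  (\det (\matrix_(i < w.+1, j < w.+1)
     if (i < w)%N then (iter (i + j) (@nbsum _) (corr2 N e) 0)%:P
     else iter j (@nbsum _) (qcorr N e) 1))`_k =
  \det (\matrix_(i < w.+1, j < w.+1)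
     iter j (@nbsum _) (corr2 N e) (if (i < w)%N then i : nat else k)%:Z).
Proof.
move=> se; set M := \matrix_(_, _) _; set M' := (X in _ = \det X).
pose M1 : 'M[A]_w.+1 := \matrix_(i, j) if (i < w)%N
   then iter (i + j) (@nbsum _) (corr2 N e) 0 else iter j (@nbsum _) (corr2 N e) k%:Z.
have -> : \det M' = \det M1.
  rewrite det_ballot; [|by move=> d; exact: corr2_anti|exact: corr2_N1].
  by congr (\det _); apply/matrixP => i j; rewrite !mxE; case: ifP.
rewrite (expand_det_row M ord_max) (expand_det_row M1 ord_max) coef_sum.
apply: eq_bigr => j _; rewrite (@cofactor_last _ _ (@polyC A) _ M1); last first.
  by move=> i l iw; rewrite !mxE iw.
by rewrite mulrC coefCM mulrC !mxE ltnn qcorr_coef.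
Qed.

Let delta (n : int) : A := (n == 0)%:R.

Let delta_supp : supported 0 delta.
Proof. by split=> // [[]]. Qed.

Let delta_corr2 d : corr2 0 delta d = (d == 0)%:R - (d == - 2)%:R.
Proof.
rewrite /corr2 /corr !big_ord1 /delta eqxx !mul1r !add0r.
by congr (_ - _%:R); congr nat_of_bool; lia.
Qed.

Let delta_iter j (l : int) : (j%:Z <= l) ->
  iter j (@nbsum _) (corr2 0 delta) l = (l == j%:Z)%:R.
Proof.
elim: j l => [|j IH] l jl.
  by rewrite /= delta_corr2 [l == - 2](_ : _ = false) ?subr0 //; lia.
rewrite iterS /nbsum !IH; [|lia|lia].
rewrite [l + 1 == _](_ : _ = false) ?add0r; last by lia.
by congr (_%:R); congr nat_of_bool; lia.
Qed.

Lemma delta_det w : \det (\matrix_(i < w, j < w)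
     iter j (@nbsum _) (corr2 0 delta) i%:Z) = 1.
Proof.
rewrite -det_tr det_trig ?big1 // => [i _|]; rewrite ?mxE ?delta_iter ?eqxx //.
apply/is_trig_mxP => i j ij; rewrite !mxE delta_iter; last by lia.
by rewrite eqz_nat gtn_eqF.
Qed.

Lemma delta_minors n : qminors 0 delta n = 1.
Proof.
rewrite /qminors (bigD1 ([ffun i => i] : {ffun 'I_n -> 'I_(0 + n)})) /=; last first.
  by apply/incrP => i j; rewrite !ffunE.
rewrite [X in _ + X]big1 => [|y /andP[/incr_id -> /eqP //]].
rewrite addr0 (_ : \matrix_(_, _) _ = 1%:M) ?det1 ?mulr1; last first.
  apply/matrixP => i j; rewrite !mxE ffunE /delta polyC_natr; congr (_%:R).
  by congr nat_of_bool; rewrite subr_eq0 eqz_nat.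
rewrite /altsum big1 // => i _; rewrite natvalE ffunE.
by rewrite /natval; case: insubP => [j _ ji|_]; rewrite ?ffunE ?ji ?subnn ?sub0n.
Qed.

Lemma even_qidentity w N e : supported N e ->
  'X^w * qminors N e (w.+1 + w.+1) =
   \det (\matrix_(i < w.+1, j < w.+1)
     if (i < w)%N then (iter (i + j) (@nbsum _) (corr2 N e) 0)%:P
     else iter j (@nbsum _) (qcorr N e) 1).
Proof.
have [a [b Hab]] := even_proportional w.
have := Hab _ _ delta_supp; rewrite delta_minors mulr1.
(* Coefficient of q^k: for k < w the last row repeats row k, for k > w it is zero, and for k = w the
   matrix is unitriangular. *)
have -> : \det (\matrix_(i < w.+1, j < w.+1)
     if (i < w)%N then (iter (i + j) (@nbsum _) (corr2 0 delta) 0)%:P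
     else iter j (@nbsum _) (qcorr 0 delta) 1) = 'X^w.
  apply/polyP => k; rewrite even_det_coef // coefXn.
  case: (ltngtP k w) => kw.
  - pose k' : 'I_w.+1 := Ordinal (ltnW kw : (k < w.+1)%N).
    rewrite (@determinant_alternate _ _ _ k' ord_max) // => [|j].
      by rewrite -val_eqE /= ltn_eqF.
    by rewrite !mxE /= kw ltnn.
  - rewrite (expand_det_row _ ord_max) big1 // => j _.
    rewrite mxE ltnn delta_iter; last by have := ltn_ord j; lia.
    by rewrite eqz_nat gtn_eqF ?mul0r //; have := ltn_ord j; lia.
  - rewrite -[RHS](delta_det w.+1); congr (\det _); apply/matrixP => i j.
    rewrite !mxE; case: ltnP => // wi; congr (iter _ _ _ _%:Z); have := ltn_ord i; lia.
move=> Ea se; have := Hab _ _ se; rewrite Ea -mulrA => H.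
apply/eqP; rewrite -subr_eq0; apply/eqP/(tfP (n := b)).
by rewrite -mulr_natl mulrBr H subrr.
Qed.

Theorem even_identity w N (e : int -> A) k : supported N e ->
  \sum_(y : {ffun 'I_(w.+1 + w.+1) -> 'I_(N + (w.+1 + w.+1))}
        | incr y && (altsum y == k)) \det (\matrix_(i, j) e ((y i)%:Z - j%:Z)) =
  \det (\matrix_(i < w.+1, j < w.+1)
     iter j (@nbsum _) (corr2 N e) (if (i < w)%N then i : nat else w + k)%N%:Z).
Proof.
move=> se; rewrite -even_det_coef // -even_qidentity // coefXnM.
rewrite ltnNge leq_addr /= addKn /qminors coef_sum [LHS]big_mkcondr /=.
apply: eq_bigr => y _.
rewrite (_ : \matrix_(_, _) _ = map_mx polyC (\matrix_(i, j) e ((y i)%:Z - j%:Z))).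
  by rewrite det_map_mx mulrC coefCM coefXn eq_sym; case: eqP; rewrite ?mulr1 ?mulr0.
by apply/matrixP => i j; rewrite !mxE.
Qed.


(** * The odd bound: a bordered Toeplitz matrix *)

Definition qminors0 N (e : int -> A) n : {poly A} :=
  \sum_(y : {ffun 'I_n -> 'I_(N + n)} | incr y && (natval y 0 == 0%N))
    'X^(altsum y) * \det (\matrix_(k, a) (e ((y k)%:Z - a%:Z))%:P).

(** A unit vector as row 0 annihilates the minors that do not select column 0. The others keep their
    value when e_0 = 1 and e_n = 0 for n < 0. *)
Definition bordermx (e : int -> A) n L : 'M[{poly A}]_(n, L) :=
  \matrix_(j, y) if j == 0%N :> nat then (y == 0%N :> nat)%:R
                 else (e (y%:Z - j%:Z))%:P.

Definition genpoly N (e : int -> A) : {poly A} :=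
  \sum_(s < N.+1) (e s%:Z)%:P * 'X^s.

Lemma coef_genpoly N e k : supported N e -> (genpoly N e)`_k = e k%:Z.
Proof.
move=> [_ eN]; rewrite /genpoly coef_sum.
have E (s : 'I_N.+1) : ((e s%:Z)%:P * 'X^s)`_k = (s == k :> nat)%:R * e k%:Z.
  by rewrite coefCM coefXn eq_sym; case: eqP => [->|]; rewrite ?mulr1 ?mul1r ?mulr0 ?mul0r.
rewrite (eq_bigr _ (fun s _ => E s)) -mulr_suml.
have [kN|Nk] := ltnP k N.+1; last by rewrite eN ?mulr0.
rewrite (bigD1 (Ordinal kN)) //= eqxx big1 ?addr0 ?mul1r // => s.
by rewrite -val_eqE /= => /negPf ->.
Qed.

Lemma border_minors N (e : int -> A) n : e 0 = 1 -> (forall m, e (Negz m) = 0) ->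
  \sum_(y : {ffun 'I_n.+1 -> 'I_(N + n.+1)} | incr y)
    'X^(altsum y) * \det (\matrix_(k, a) bordermx e n.+1 _ a (y k)) =
  qminors0 N e n.+1.
Proof.
move=> e0 eneg; rewrite /qminors0 [RHS]big_mkcondr; apply: eq_bigr => y /incrP inc.
rewrite (natvalE y ord0); case: eqP => y0; last first.
  rewrite (expand_det_col _ ord0) big1 ?mulr0 // => k _; rewrite !mxE /=.
  rewrite gtn_eqF ?mul0r //; have [k0|k0] := posnP k.
    by rewrite (_ : k = ord0) ?lt0n; [apply/eqP|apply: val_inj].
  exact: leq_ltn_trans (leq0n _) (inc ord0 k k0).
congr (_ * _); rewrite !(expand_det_row _ ord0) !big_ord_recl !mxE /= y0 subrr e0 eqxx.
congr (_ * _ + _).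
  rewrite /cofactor; congr (_ * \det _); apply/matrixP => i j.
  by rewrite !mxE.
rewrite !big1 // => j _; rewrite !mxE /= y0 /bump /= !add1n.
by rewrite (_ : 0 - (j.+1)%:Z = Negz j) ?eneg ?mul0r //; lia.
by rewrite (_ : 0 - (j.+1)%:Z = Negz j) ?eneg ?mul0r //; lia.
Qed.

Section OddReduce.
Variables (N : nat) (e : int -> A).
Hypothesis se : supported N e.
Let G := qcorr N e.
Let h d := (corr2 N e (d - 1))%:P.

Let h_odd d : h (- d) = - h d.
Proof. by rewrite /h -polyCN -corr2_anti //; congr ((corr2 _ _ _)%:P); ring. Qed.

(** Against row l > 0 the unit row gives the sum over b of e_(b-l) kap(b), which is q^(l-1) times
    the generating polynomial. *)
Lemma border_skew n L (k l : 'I_n) : (n + N <= L)%N ->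
  let H := bordermx e n L *m gapmx A L *m (bordermx e n L)^T in
  H k l - H l k =
  if k == 0%N :> nat then (if l == 0%N :> nat then 0 else 'X^(l.-1) * genpoly N e)
  else if l == 0%N :> nat then - ('X^(k.-1) * genpoly N e) else G (l%:Z - k%:Z).
Proof.
move=> nL H.
have kL := ltn_ord k; have lL := ltn_ord l.
have row0 : forall l : 'I_n, l != 0%N :> nat -> forall k : 'I_n, k = 0%N :> nat ->
   H k l - H l k = 'X^(l.-1) * genpoly N e.
  move=> {k kL lL} {}l l0 k k0; have L0 : (0 < L)%N by have := ltn_ord k; lia.
  rewrite /H skew_entry; transitivity (\sum_b bordermx e n L l b * kap A (b%:Z - 0%:Z)).
    apply: etrans (sum_pick_ord (Ordinal L0)
      (fun a => \sum_b bordermx e n L l b * kap A (b%:Z - a%:Z))).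
    by apply: eq_bigr => a _; rewrite mxE k0 eqxx -val_eqE eq_sym.
  have -> : \sum_b bordermx e n L l b * kap A (b%:Z - 0%:Z) =
     \sum_(b < L) (e (b%:Z - l%:Z))%:P * kap A (b%:Z - 0).
    by apply: eq_bigr => b _; rewrite mxE (negPf l0).
  rewrite (sum_shift (fun b => kap A (b%:Z - 0)) se); last by have := ltn_ord l; lia.
  rewrite /genpoly mulr_sumr; apply: eq_bigr => s _; rewrite subr0 mulrCA; congr (_ * _).
  by rewrite -exprD; case: (nat_of_ord l) l0.
have [k0|k0] := eqVneq (k : nat) 0%N; have [l0|l0] := eqVneq (l : nat) 0%N.
- by have -> : k = l; [apply: val_inj; rewrite /= k0 l0|rewrite subrr].
- exact: row0.
- by rewrite -opprB row0.
rewrite /H /G skew_entry -(@toepmx_skew _ N e k l L) //; [|lia|lia].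
apply: eq_bigr => a _; rewrite mxE (negPf k0); congr (_ * _).
by apply: eq_bigr => b _; rewrite mxE (negPf l0).
Qed.

(** 1 is the border row, and 'X is the only row of the second half that pairs with it. The leading
    'X keeps the other rows off the border. Their factor X - q makes them orthogonal to 1, since q
    is a root, and when present on both sides it produces the recurrence operator. *)
Definition oddrow w (i : 'I_(w.+1 + w.+1)) : {poly {poly A}} :=
  match split i with
  | inl i => if nat_of_ord i is i'.+1
      then 'X * (('X - q%:P) * ('X^(w - i'.+1) * K ^+ i' * ('X - 1))) else 1
  | inr j => if nat_of_ord j is j'.+1
      then 'X * (('X - q%:P) * ('X^(w - j'.+1) * K ^+ j' * ('X + 1))) else 'X * 1
  end.

Lemma size_oddrow w i : (size (@oddrow w i) <= w.+1 + w.+1)%N.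
Proof.
have aux j (u : {poly {poly A}}) : (j < w)%N -> (size u <= 2)%N ->
  (size ('X * (('X - q%:P) * ('X^(w - j.+1) * K ^+ j * u)))%R <= w.+1 + w.+1)%N.
  move=> jw su; apply: leq_trans (size_XM _) _.
  have le4 a b : (a <= 2 -> b <= w.*2 -> (a + b).-1 <= w.*2.+1)%N by lia.
  apply: (@leq_trans w.*2.+2); last by lia.
  rewrite ltnS; apply: leq_trans (size_polyMleq _ _) (le4 _ _ _ _).
  - by rewrite size_XsubC.
  - rewrite -mulrA; apply: leq_trans (size_XnM _ _) _.
    apply: leq_trans (leq_add (leqnn _) (leq_trans (size_KnM _ _) (leq_add (leqnn _) su))) _.
    by lia.
rewrite /oddrow; case: split => j; case: j => -[|j] jw /=.
- by rewrite size_poly1.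
- by apply: aux => //; exact: size_Xsub1.
- by rewrite mulr1 size_polyX; lia.
- by apply: aux => //; exact: size_Xadd1.
Qed.

Definition bentry n L (u v : {poly {poly A}}) :=
  let H := bordermx e n L *m gapmx A L *m (bordermx e n L)^T in
  \sum_(k < n) u`_k * \sum_(l < n) v`_l * (H k l - H l k).

Lemma entryXX n L u v : (n + N <= L)%N -> (size ('X * u)%R <= n)%N -> (size ('X * v)%R <= n)%N ->
  bentry n L ('X * u) ('X * v) = toep G u v.
Proof.
move=> nL su sv; rewrite -toepXX /toep (pevE _ su); apply: eq_bigr => k _.
rewrite (pevE _ sv); have [k0|k0] := eqVneq (k : nat) 0%N.
  by rewrite k0 coefXM /= !mul0r.
congr (_ * _); apply: eq_bigr => l _; rewrite border_skew // (negPf k0).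
by case: eqP => // ->; rewrite coefXM /= !mul0r.
Qed.

(** The powers q^(l-1) found in [border_skew] assemble the coefficients of [v] into its value at
    q. *)
Lemma entry1X n L v : (n.+1 + N <= L)%N -> (size ('X * v)%R <= n.+1)%N ->
  bentry n.+1 L 1 ('X * v) = v.[q] * genpoly N e.
Proof.
move=> nL sv; rewrite /bentry big_ord_recl coef1 /= mul1r [X in _ + X]big1 ?addr0 => [|k _]; last first.
  by rewrite coef1 mul0r.
have sv' : (size v <= n)%N.
  have [->|v0] := eqVneq v 0; first by rewrite size_poly0.
  by move: sv; rewrite mulrC size_mulX.
rewrite (horner_coef_wide _ sv') mulr_suml big_ord_recl coefXM mul0r add0r.
apply: eq_bigr => l _; rewrite border_skew // coefXM /=.
by rewrite mulrA.
Qed.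

Lemma entry11 n L : (n.+1 + N <= L)%N -> bentry n.+1 L 1 1 = 0.
Proof.
move=> nL; rewrite /bentry big_ord_recl [X in _ + X]big1 ?addr0 => [|k _]; last first.
  by rewrite coef1 mul0r.
rewrite coef1 mul1r big_ord_recl [X in _ + X]big1 ?addr0 => [|k _]; last first.
  by rewrite coef1 mul0r.
by rewrite subrr mulr0.
Qed.

Lemma toep_odd w i j (u v : {poly {poly A}}) : (i < w)%N -> (j < w)%N ->
  toep G (('X - q%:P) * ('X^(w - i.+1) * K ^+ i * u))
         (('X - q%:P) * ('X^(w - j.+1) * K ^+ j * v)) =
  toep (iter (i + j) (@nbsum _) h) u v.
Proof.
move=> iw jw; rewrite toepXqXq -(@toep_iter _ h (w - i.+1) (w - j.+1)); last by lia.
by apply: eq_toep => d; rewrite qcorr_rel.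
Qed.

Lemma oddrow_iso0 w (j : 'I_w.+1) L : (w.+1 + w.+1 + N <= L)%N ->
  bentry (w.+1 + w.+1) L 1 (oddrow (lshift _ j)) = 0.
Proof.
move=> nL; have := size_oddrow (lshift _ j).
rewrite /oddrow (unsplitK (inl _ _)); case: j => -[|j] jw /= sz; first exact: entry11.
by rewrite entry1X // hornerM hornerXsubC subrr !mul0r.
Qed.

Lemma oddrow_isoS w (i j : 'I_w.+1) L : (w.+1 + w.+1 + N <= L)%N ->
  (0 < i)%N -> (0 < j)%N ->
  bentry (w.+1 + w.+1) L (oddrow (lshift _ i)) (oddrow (lshift _ j)) = 0.
Proof.
move=> nL; have := size_oddrow (lshift _ i); have := size_oddrow (lshift _ j).
rewrite /oddrow !(unsplitK (inl _ _)); case: i => -[//|i] iw; case: j => -[//|j] jw /= sj si _ _.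
by rewrite entryXX // toep_odd // toep_base_anti //; exact: iter_nbsum_odd.
Qed.

Lemma oddrow_pair w (i j : 'I_w.+1) L : (w.+1 + w.+1 + N <= L)%N ->
  (0 < i)%N -> (0 < j)%N ->
  bentry (w.+1 + w.+1) L (oddrow (lshift _ i)) (oddrow (rshift _ j)) =
  - 2%:R * (iter (i.-1 + j.-1) (@nbsum _) (corr2 N e) 0)%:P.
Proof.
move=> nL; have := size_oddrow (lshift _ i); have := size_oddrow (rshift _ j).
rewrite /oddrow (unsplitK (inl _ _)) (unsplitK (inr _ _)).
case: i => -[//|i] iw; case: j => -[//|j] jw /= sj si _ _.
rewrite entryXX // toep_odd // toep_base iter_nbsum_odd //.
rewrite -[0](subrr 1) -iter_nbsum_shift -iter_nbsum_polyC -/h.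
by ring.
Qed.

Lemma oddrow_pair0 w (j : 'I_w.+1) L : (w.+1 + w.+1 + N <= L)%N ->
  bentry (w.+1 + w.+1) L 1 (oddrow (rshift _ j)) = (j == 0%N :> nat)%:R * genpoly N e.
Proof.
move=> nL; have := size_oddrow (rshift _ j).
rewrite /oddrow (unsplitK (inr _ _)); case: j => -[|j] jw /= sz.
  by rewrite entry1X // hornerC.
by rewrite entry1X // hornerM hornerXsubC subrr !mul0r.
Qed.

End OddReduce.

Lemma odd_proportional w : exists (a : {poly A}) (b : nat), forall N e,
  supported N e -> e 0 = 1 -> a * qminors0 N e (w.+1 + w.+1) = b.+1%:R *
   (genpoly N e *
    (\det (\matrix_(i < w, j < w) iter (i + j) (@nbsum _) (corr2 N e) 0))%:P).
Proof.
have [c Hc] := gap_minor_sum A w.+1.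
have [b Hb] := pairsum_isotropic w.+1 tfP.
pose C : 'M[{poly A}]_(w.+1 + w.+1) := \matrix_(i, j) (oddrow i)`_j.
exists ((-1) ^+ w * (\det C * c)), (b.+1 * 2 ^ w).-1 => N e se e0.
rewrite prednK ?muln_gt0 ?expn_gt0 //; set D := \matrix_(_, _) _.
set n := (w.+1 + w.+1)%N in C *; have nL : (n + N <= N + n)%N by rewrite addnC.
pose B := bordermx e n (N + n).
have [X defX] : {X | X = C *m (B *m gapmx A _ *m B^T) *m C^T} by eexists.
have Xskew i j : X i j - X j i = bentry e n (N + n) (oddrow i) (oddrow j).
  rewrite defX congr_skew; apply: eq_bigr => k _.
  by rewrite mxE; congr (_ * _); apply: eq_bigr => l _; rewrite mxE.
have row00 : oddrow (lshift w.+1 (ord0 : 'I_w.+1)) = 1.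
  by rewrite /oddrow (unsplitK (inl _ _)).
(* The first row of the pairing block is the generating polynomial followed by zeros, so expanding
   along it leaves a determinant of size w. *)
have XN : \det (ursubmx X - (dlsubmx X)^T) = (- 2%:R) ^+ w * (genpoly N e * (\det D)%:P).
  rewrite (expand_det_row _ ord0) big_ord_recl big1 ?addr0 => [|j _]; last first.
    by rewrite !mxE Xskew row00 (oddrow_pair0 se) // !mul0r.
  rewrite !mxE Xskew row00 (oddrow_pair0 se) //= mul1r [RHS]mulrCA; congr (_ * _).
  rewrite /cofactor expr0 mul1r -det_map_mx -detZ; congr (\det _).
  by apply/matrixP => i j; rewrite !mxE Xskew (oddrow_pair se).
have Xsym : (ulsubmx X)^T = ulsubmx X.
  have X0 j : X (lshift _ ord0) (lshift _ j) = X (lshift _ j) (lshift _ ord0).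
    by apply/eqP; rewrite -subr_eq0 Xskew row00 (oddrow_iso0 se).
  apply/matrixP => i j; rewrite !mxE.
  case: (posnP i) => [i0|i0]; first by rewrite (_ : i = ord0) ?X0 //; apply: val_inj.
  case: (posnP j) => [j0|j0]; first by rewrite (_ : j = ord0) ?X0 //; apply: val_inj.
  by apply/eqP; rewrite -subr_eq0 Xskew (oddrow_isoS se).
have := Hb X Xsym; rewrite XN defX pairsum_congr Hc.
rewrite border_minors //; last by case: se.
rewrite -!mulrA => ->; rewrite natrM natrX mulrCA -!mulrA; congr (_ * _).
by rewrite [LHS]mulrA -exprMn mulrNN mul1r.
Qed.

Lemma delta_minors0 n : qminors0 0 delta n = 1.
Proof.
rewrite -[RHS](delta_minors n) /qminors0 /qminors; apply: eq_bigl => y.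
have [inc|//] := boolP (incr y); rewrite (incr_id inc).
by rewrite /natval; case: insubP => [j _ j0|]; rewrite ?ffunE ?j0 ?eqxx.
Qed.

Lemma odd_qidentity w N e : supported N e -> e 0 = 1 ->
  qminors0 N e (w.+1 + w.+1) = genpoly N e *
    (\det (\matrix_(i < w, j < w) iter (i + j) (@nbsum _) (corr2 N e) 0))%:P.
Proof.
have [a [b Hab]] := odd_proportional w.
have := Hab _ _ delta_supp (erefl _); rewrite delta_minors0 mulr1.
have -> : genpoly 0 delta = 1.
  by rewrite /genpoly big_ord1 /delta eqxx expr0 mulr1.
rewrite det_ballot_full ?delta_det; last 2 first.
- by move=> d; exact: corr2_anti.
- exact: corr2_N1.
rewrite !mulr1 => Ea se e0; have := Hab _ _ se e0; rewrite Ea => H.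
apply/eqP; rewrite -subr_eq0; apply/eqP/(tfP (n := b)).
by rewrite -mulr_natl mulrBr H subrr.
Qed.

Theorem odd_identity w N (e : int -> A) k : supported N e -> e 0 = 1 ->
  \sum_(y : {ffun 'I_(w.+1 + w.+1) -> 'I_(N + (w.+1 + w.+1))}
        | [&& incr y, natval y 0 == 0%N & altsum y == k])
     \det (\matrix_(i, j) e ((y i)%:Z - j%:Z)) =
  e k%:Z * \det (\matrix_(i < w, j < w) iter (i + j) (@nbsum _) (corr2 N e) 0).
Proof.
move=> se e0; rewrite -(coef_genpoly _ se) -coefMC -odd_qidentity //.
rewrite /qminors0 coef_sum; under [LHS]eq_bigl do rewrite andbA.
rewrite [LHS]big_mkcondr /=; apply: eq_bigr => y _.
rewrite (_ : \matrix_(_, _) _ = map_mx polyC (\matrix_(i, j) e ((y i)%:Z - j%:Z))).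
  by rewrite det_map_mx mulrC coefCM coefXn eq_sym; case: eqP; rewrite ?mulr1 ?mulr0.
by apply/matrixP => i j; rewrite !mxE.
Qed.

End Identity.

(** * Power series: products, truncation and change of coefficients *)

Local Open Scope classical_set_scope.
Local Open Scope ring_scope.

Lemma fsum_seq (V : nmodType) (I : choiceType) (A : set I) (r : seq I) (F : I -> V) :
  uniq r -> (forall i, i \in r -> A i) -> (forall i, A i -> i \notin r -> F i = 0) ->
  \sum_(i \in A) F i = \sum_(i <- r) F i.
Proof.
move=> ur rA F0; rewrite (fsbigE r) //.
rewrite big_seq_cond [RHS]big_seq_cond; apply: eq_bigl => i.
by have [ir|//] := boolP (i \in r); rewrite /= mem_set //; exact: rA.
Qed.

Section Monomials.
Implicit Types m a b : monomial.

Lemma mset_perm (s t : seq nat) : (seq_mset s = seq_mset t) <-> perm_eq s t.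
Proof. by split=> [/eq_seq_msetP|/eq_seq_msetP]. Qed.

Lemma mset_seqD (s t : seq nat) : (seq_mset s `+` seq_mset t)%mset = seq_mset (s ++ t).
Proof. by apply/msetP => i; rewrite msetE2 !mset_seqE count_cat. Qed.

Lemma size_seq_mset (s : seq nat) : size (seq_mset s) = size s.
Proof. exact/perm_size/perm_eq_seq_mset. Qed.

Lemma mset_addP a b : perm_eq (a `+` b)%mset (a ++ b).
Proof.
have := perm_eq_seq_mset (a ++ b); rewrite -mset_seqD !seq_mset_id.
by [].
Qed.

Lemma size_msetD a b : size (a `+` b)%mset = (size a + size b)%N.
Proof. by rewrite (perm_size (mset_addP a b)) size_cat. Qed.

Lemma all_msetD (p : pred nat) a b : all p (a `+` b)%mset = all p a && all p b.
Proof. by rewrite (perm_all _ (mset_addP a b)) all_cat. Qed.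

Lemma msubKD a m : (a `<=` m)%mset -> (a `+` (m `\` a))%mset = m.
Proof. by move=> /msubsetP am; apply/msetP => i; rewrite !msetE2 subnKC. Qed.

Lemma msubDK a b : ((a `+` b) `\` a)%mset = b.
Proof. by apply/msetP => i; rewrite !msetE2 addKn. Qed.

Lemma msub_addl a b : (a `<=` a `+` b)%mset.
Proof. by apply/msubsetP => i; rewrite msetE2 leq_addr. Qed.

Definition mdivs m : seq monomial :=
  undup [seq seq_mset (mask b m) | b : (size m).-tuple bool].

Lemma mem_mdivs m a : (a \in mdivs m) = (a `<=` m)%mset.
Proof.
rewrite mem_undup; apply/mapP/msubsetP => [[b _ ->] i|sam].
  by rewrite mset_seqE -count_mem_mset leq_count_mask.
have /count_subseqP[s /subseqP[b szb ->] pas] :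
    forall x, (count_mem x a <= count_mem x m)%N by move=> x; rewrite !count_mem_mset.
exists (Tuple (introT eqP szb)); first by rewrite mem_enum.
by rewrite -[LHS]seq_mset_id; apply/eq_seq_msetP.
Qed.

Lemma mdivs_uniq m : uniq (mdivs m). Proof. exact: undup_uniq. Qed.

End Monomials.

Section FpsCoef.
Variable R : comNzRingType.
Implicit Types (f g : fps R) (m a : monomial).

Lemma fps_addE f g m : (f + g) m = f m + g m. Proof. by []. Qed.
Lemma fps_oppE f m : (- f) m = - f m. Proof. by []. Qed.
Lemma fps_0E m : (0 : fps R) m = 0. Proof. by []. Qed.
Lemma fps_1E m : (1 : fps R) m = (m == mset0)%:R. Proof. by []. Qed.

Lemma fps_sumE I r (P : pred I) (F : I -> fps R) m :
  (\sum_(i <- r | P i) F i) m = \sum_(i <- r | P i) F i m.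
Proof. by elim/big_rec2: _ => // i y1 y2 _ <-. Qed.

Lemma fps_mulnE f n m : (f *+ n) m = f m *+ n.
Proof. by elim: n => // n IH; rewrite !mulrS fps_addE IH. Qed.

Lemma fps_coefM f g m : (f * g) m = \sum_(a <- mdivs m) f a * g (m `\` a)%mset.
Proof.
rewrite -[LHS]/(fps_mul f g m) /fps_mul.
rewrite (fsum_seq (r := [seq (a, (m `\` a)%mset) | a <- mdivs m])).
- by rewrite big_map.
- by rewrite map_inj_uniq ?mdivs_uniq // => a b [].
- by move=> ab /mapP[a]; rewrite mem_mdivs => am ->; exact: msubKD.
- move=> [a b] /= abm /mapP[]; exists a; last by rewrite -abm msubDK.
  by rewrite mem_mdivs -abm msub_addl.
Qed.

Lemma xmonM a f m : (xmon R a * f) m = if (a `<=` m)%mset then f (m `\` a)%mset else 0.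
Proof.
rewrite fps_coefM; case: ifP => am.
  rewrite (bigD1_seq a) ?mdivs_uniq ?mem_mdivs //= /xmon eqxx mul1r big1 ?addr0 //.
  by move=> b /negPf ->; rewrite mul0r.
rewrite big_seq big1 // => b; rewrite mem_mdivs => bm; rewrite /xmon.
case: eqP => [ba|_]; last by rewrite mul0r.
by rewrite -ba bm in am.
Qed.

Lemma fps_torsion_free : torsion_free R -> torsion_free (fps R).
Proof.
move=> tf n f E; apply/funext => m; apply: (tf n).
by rewrite -fps_mulnE E.
Qed.

End FpsCoef.

Lemma int_torsion_free : torsion_free int.
Proof. by move=> n x /eqP; rewrite mulrn_eq0 => /eqP. Qed.

Section Truncation.
Variable R : comNzRingType.
Implicit Types (f g : fps R).

(** The substitution of 0 for every x_i with i >= N. *)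
Definition trunc N f : fps R :=
  fun m => if all (fun i => (i < N)%N) m then f m else 0.

Variable N : nat.

Lemma trunc_zmod_morphism : zmod_morphism (trunc N).
Proof.
move=> f g; apply/funext => m; rewrite fps_addE fps_oppE /trunc.
by case: ifP; rewrite ?subr0.
Qed.

Lemma trunc_monoid_morphism : monoid_morphism (trunc N).
Proof.
split.
  apply/funext => m; rewrite /trunc fps_1E; case: ifP => //.
  by case: eqP => // ->; rewrite enum_mset0.
move=> f g; apply/funext => m; rewrite fps_coefM /trunc fps_coefM.
case: ifP => mN; last first.
  rewrite big_seq big1 // => a; rewrite mem_mdivs => am.
  move: mN; rewrite -{1}(msubKD am) all_msetD.
  by case: (all _ (a : monomial)) => /= [->|_]; rewrite ?mulr0 ?mul0r.
rewrite big_seq [RHS]big_seq; apply: eq_bigr => a.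
rewrite mem_mdivs => am.
by move: mN; rewrite -{1}(msubKD am) all_msetD => /andP[-> ->].
Qed.

HB.instance Definition _ :=
  GRing.isZmodMorphism.Build (fps R) (fps R) (trunc N) trunc_zmod_morphism.
HB.instance Definition _ :=
  GRing.isMonoidMorphism.Build (fps R) (fps R) (trunc N) trunc_monoid_morphism.

End Truncation.

(** A monomial involves finitely many variables, so a large enough truncation keeps its
    coefficient. *)
Lemma fps_trunc_eq (R : comNzRingType) (f g : fps R) :
  (forall N, trunc N f = trunc N g) -> f = g.
Proof.
move=> E; apply/funext => m.
have mN : all (fun i => (i < (\max_(i <- m) i).+1)%N) m.
  by apply/allP => i im; rewrite ltnS; exact: (leq_bigmax_seq (F := id)).
have /(congr1 (fun h => h m)) := E (\max_(i <- m) i).+1.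
by rewrite /trunc mN.
Qed.

Section CoefMap.
Variable R : comNzRingType.

Definition fps_intr (f : fps int) : fps R := fun m => (f m)%:~R.

Lemma fps_intr_zmod_morphism : zmod_morphism fps_intr.
Proof. by move=> f g; apply/funext => m; rewrite /fps_intr fps_addE fps_oppE rmorphB. Qed.

Lemma fps_intr_monoid_morphism : monoid_morphism fps_intr.
Proof.
split; first by apply/funext => m; rewrite /fps_intr fps_1E rmorph_nat.
move=> f g; apply/funext => m; rewrite fps_coefM /fps_intr fps_coefM rmorph_sum.
by apply: eq_bigr => a _; rewrite rmorphM.
Qed.

HB.instance Definition _ :=
  GRing.isZmodMorphism.Build (fps int) (fps R) fps_intr fps_intr_zmod_morphism.
HB.instance Definition _ :=
  GRing.isMonoidMorphism.Build (fps int) (fps R) fps_intr fps_intr_monoid_morphism.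

End CoefMap.

Section Elementary.
Variable R : comNzRingType.
Implicit Types m : monomial.

Lemma elemE (n : nat) m : elem n%:Z m = ((size m == n) && uniq m)%:R :> R.
Proof.
rewrite /elem /lfsum /xmon.
have [/andP[/eqP sm um]|nm] := boolP (_ && _); last first.
  rewrite fsbig1 // => s /= [ss [szs]]; case: eqP => // ms; case/negP: nm.
  have pms : perm_eq m s by rewrite ms perm_eq_seq_mset.
  rewrite (perm_size pms) (perm_uniq pms) szs eqxx /=.
  exact: (sorted_uniq ltn_trans ltnn).
have pss : perm_eq (sort leq m) m by rewrite perm_sort.
rewrite (fsum_seq (r := [:: sort leq m])) //=.
- have E : seq_mset (sort leq m) = m by rewrite -[RHS]seq_mset_id; apply/mset_perm.
  by rewrite big_seq1 E eqxx.
- move=> s; rewrite inE => /eqP ->; rewrite size_sort sm; split=> //.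
  by rewrite ltn_sorted_uniq_leq sort_uniq um sort_sorted //; exact: leq_total.
- move=> s [ss _]; rewrite inE => /eqP ns; case: eqP => // ms; case: ns.
  apply: (irr_sorted_eq ltn_trans ltnn) => //.
    by rewrite ltn_sorted_uniq_leq sort_uniq um sort_sorted //; exact: leq_total.
  move=> i; rewrite mem_sort ms; apply: esym; exact/perm_mem/perm_eq_seq_mset.
Qed.

Lemma trunc_elem_supported N : supported N (fun n => trunc N (@elem R n)).
Proof.
split=> n; first by rewrite elem_neg rmorph0.
move=> Nn; apply/funext => m; rewrite /trunc; case: ifP => // mN.
rewrite elemE; case: eqP => //= sm; case: (boolP (uniq m)) => // um.
suff : (n <= N)%N by rewrite leqNgt Nn.
rewrite -sm -[N](size_iota 0); apply: uniq_leq_size => // i.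
by move/(allP mN); rewrite mem_iota.
Qed.

Lemma trunc0_elem n : trunc 0 (@elem R n) = (n == 0)%:R.
Proof.
case: n => n; last by rewrite elem_neg rmorph0.
have [->|n0] := eqVneq n 0%N; first by rewrite elem0 rmorph1.
have [_ ->] := trunc_elem_supported 0; last by rewrite lt0n.
by rewrite eqz_nat (negPf n0).
Qed.

(** A squarefree monomial contains the new variable x_N at most once. *)
Lemma trunc_elemS N n : trunc N.+1 (@elem R n) =
  trunc N (elem n) + xmon R [mset N]%mset * trunc N (elem (n - 1)).
Proof.
apply/funext => m; rewrite fps_addE xmonM /trunc.
have sub1 : ([mset N] `<=` m)%mset = (N \in m).
  by apply/msubsetP/idP => [/(_ N)|Nm i]; rewrite ?msetnxx ?mset_gt0 // msetnE;
     case: eqP => // ->; rewrite mset_gt0.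
rewrite sub1; have [Nm|Nm] := boolP (N \in m); last first.
  rewrite addr0; congr (if _ then _ else _); apply: eq_in_all => i im.
  by rewrite ltnS leq_eqVlt; case: eqP => // iN; rewrite -iN im in Nm.
have -> : all (fun i => (i < N)%N) m = false.
  by apply/negP => /allP/(_ _ Nm); rewrite ltnn.
rewrite add0r; set m' := (m `\` _)%mset.
have E : (N +` m')%mset = m by apply: msubKD; rewrite sub1.
have pm : perm_eq m (N :: m').
  by rewrite -{1}E; apply: perm_trans (mset_addP _ _) _; rewrite enum_msetn.
rewrite (perm_all _ pm) /= ltnSn /=.
case: n => [[|n]|n]; last first.
- by rewrite (_ : Negz n - 1 = Negz n.+1) ?elem_neg ?fps_0E ?if_same //; lia.
- rewrite (_ : Posz n.+1 - 1 = n) ?elemE; last by lia.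
  rewrite (perm_size pm) (perm_uniq pm) /= eqSS.
  have [Nm'|Nm'] := boolP (N \in m').
    rewrite andbF if_same; case: ifP => // /allP/(_ _ Nm'); by rewrite ltnn.
  congr (if _ then _ else _); apply: eq_in_all => i im.
  by rewrite ltnS leq_eqVlt; case: eqP => // iN; rewrite -iN im in Nm'.
- rewrite (_ : Posz 0 - 1 = Negz 0) // elem_neg fps_0E if_same elemE.
  by rewrite (perm_size pm) if_same.
Qed.

Lemma trunc_fser N r : trunc N (@fser R r) = corr N (fun n => trunc N (elem n)) r.
Proof.
apply/funext => m; rewrite /corr fps_sumE {1}/trunc; case: ifP => mN; last first.
  by rewrite big1 // => s _; rewrite -(rmorphM (trunc N)) /= /trunc mN.
rewrite /fser /lfsum.
rewrite (fsum_seq (r := [seq Posz s | s <- iota 0 N.+1])) //.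
- rewrite big_map -[iota 0 N.+1]/(index_iota 0 N.+1) big_mkord.
  by apply: eq_bigr => s _; rewrite -(rmorphM (trunc N)) /= /trunc mN.
- by rewrite map_inj_uniq ?iota_uniq // => a b [].
- move=> n _ nN; have -> : (elem n * elem (n + r)) m = trunc N (elem n * elem (n + r)) m :> R.
    by rewrite /trunc mN.
  have [e0 eN] := trunc_elem_supported N.
  rewrite rmorphM /=; case: n nN => n nN; last by rewrite e0 mul0r.
  rewrite eN ?mul0r // ltnNge; apply: contra nN => nN.
  by rewrite map_f // mem_iota.
Qed.

End Elementary.

Lemma fps_intr_elem (R : comNzRingType) n : fps_intr R (elem n) = elem n.
Proof.
case: n => n; last by rewrite !elem_neg rmorph0.
by apply/funext => m; rewrite /fps_intr !elemE rmorph_nat.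
Qed.

Lemma fps_intr_trunc (R : comNzRingType) N f :
  fps_intr R (trunc N f) = trunc N (fps_intr R f).
Proof. by apply/funext => m; rewrite /fps_intr /trunc; case: ifP. Qed.

Section MapIdentity.
Variables (A B : comNzRingType) (phi : {rmorphism A -> B}) (eA : int -> A) (eB : int -> B).
Hypothesis phie : forall n, phi (eA n) = eB n.

Lemma map_det_minor n (F : 'I_n -> 'I_n -> int) :
  phi (\det (\matrix_(i, j) eA (F i j))) = \det (\matrix_(i, j) eB (F i j)).
Proof.
by rewrite -det_map_mx; congr (\det _); apply/matrixP => i j; rewrite !mxE phie.
Qed.

Lemma map_iter_corr2 N n d : phi (iter n (@nbsum _) (corr2 N eA) d) =
  iter n (@nbsum _) (corr2 N eB) d.
Proof.
elim: n d => [|n IH] d /=; last by rewrite /nbsum rmorphD !IH.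
rewrite /corr2 /corr rmorphB !rmorph_sum; congr (_ - _);
by apply: eq_bigr => s _; rewrite rmorphM !phie.
Qed.

End MapIdentity.

Section ElemIdentities.
Variable R : comNzRingType.
Variable N : nat.
Let eR n := trunc N (@elem R n).
Let eZ n := trunc N (@elem int n).

Let eZR n : fps_intr R (eZ n) = eR n.
Proof. by rewrite fps_intr_trunc fps_intr_elem. Qed.

Let tfZ : torsion_free (fps int) := fps_torsion_free int_torsion_free.

(** [R] may have torsion, so the identity is taken over the integers and transported by [fps_intr],
    which sends e_n to e_n. *)
Lemma even_identity_elem w k :
  \sum_(y : {ffun 'I_(w.+1 + w.+1) -> 'I_(N + (w.+1 + w.+1))}
        | incr y && (altsum y == k)) \det (\matrix_(i, j) eR ((y i)%:Z - j%:Z)) =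
  \det (\matrix_(i < w.+1, j < w.+1)
     iter j (@nbsum _) (corr2 N eR) (if (i < w)%N then i : nat else w + k)%N%:Z).
Proof.
have := congr1 (fps_intr R) (even_identity tfZ w k (@trunc_elem_supported int N)).
rewrite rmorph_sum -det_map_mx => E; apply: etrans (etrans E _).
  by apply: eq_bigr => y _; rewrite (map_det_minor eZR).
by congr (\det _); apply/matrixP => i j; rewrite !mxE (map_iter_corr2 eZR).
Qed.

Lemma odd_identity_elem w k :
  \sum_(y : {ffun 'I_(w.+1 + w.+1) -> 'I_(N + (w.+1 + w.+1))}
        | [&& incr y, natval y 0 == 0%N & altsum y == k])
     \det (\matrix_(i, j) eR ((y i)%:Z - j%:Z)) =
  eR k%:Z * \det (\matrix_(i < w, j < w) iter (i + j) (@nbsum _) (corr2 N eR) 0).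
Proof.
have eZ1 : eZ 0 = 1 by rewrite /eZ elem0 rmorph1.
have := congr1 (fps_intr R) (odd_identity tfZ w k (@trunc_elem_supported int N) eZ1).
rewrite rmorph_sum rmorphM -det_map_mx => E; apply: etrans (etrans E _).
  by apply: eq_bigr => y _; rewrite (map_det_minor eZR).
apply: (congr2 *%R); first exact: eZR.
congr (\det _); apply/matrixP => i j.
by rewrite !mxE (map_iter_corr2 eZR).
Qed.

End ElemIdentities.

(** * The dual Jacobi-Trudi identity *)

Section ColumnLengths.
Implicit Types (la ka : seq nat) (c n : nat).

(** For c > 0, the length of column c. *)
Definition colen c la : nat := count (leq c) la.

Lemma geq_trans : transitive geq.
Proof. by move=> a b c /= ab bc; apply: leq_trans ab. Qed.

Lemma colenP c la r : sorted geq la -> (0 < c)%N ->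
  (c <= nth 0%N la r)%N = (r < colen c la)%N.
Proof.
move=> + c0; elim: la r => [|p la IH] r sla; first by rewrite nth_nil leqNgt c0.
have sla' := path_sorted sla; rewrite /colen /= -/(colen c la).
have [cp|pc] := leqP c p; first by case: r => [|r]; rewrite ?cp // IH.
have -> : colen c la = 0%N.
  apply/eqP; rewrite /colen eqn0Ngt -has_count; apply/hasPn => x xla.
  rewrite -ltnNge; apply: leq_ltn_trans pc.
  by move: sla; rewrite /= (path_sortedE geq_trans) => /andP[/allP/(_ _ xla)].
case: r => [|r] /=; first by rewrite leqNgt pc.
rewrite ltn0; apply/negbTE; rewrite -ltnNge; apply: leq_ltn_trans pc.
move: sla; rewrite /= (path_sortedE geq_trans) => /andP[/allP H _].
by have [rla|] := ltnP r (size la); [exact/H/mem_nth|move/(nth_default 0%N) ->].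
Qed.

Lemma sum_colen n la : all (leq^~ n) la ->
  (\sum_(i < n) colen (n - i) la = sumn la)%N.
Proof.
elim: la => [_|p la IH /= /andP[pn lan]]; first by rewrite big1.
rewrite /colen /= big_split /= -/(colen _ _) IH //; congr (_ + _)%N.
rewrite -(big_mkord xpredT (fun i => (n - i <= p)%N : nat)) (big_cat_nat (n := (n - p)%N)) //=; last by lia.
rewrite big_nat_cond big1 ?add0n => [|i /andP[/andP[_ ip] _]]; last by lia.
rewrite (eq_big_nat _ _ (F2 := fun=> 1%N)) => [|i /andP[i1 i2]]; last by lia.
by rewrite sum_nat_const_nat; lia.
Qed.

Lemma eq_colen n la ka : sorted geq la -> sorted geq ka ->
  all (leq^~ n) la -> all (leq^~ n) ka -> size la = size ka ->
  (forall i, (i < n)%N -> colen (n - i) la = colen (n - i) ka) -> la = ka.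
Proof.
move=> sla ska lan kan sz E; apply: (@eq_from_nth _ 0%N) => // r rla.
have aux l1 l2 : sorted geq l1 -> sorted geq l2 -> all (leq^~ n) l1 ->
    (r < size l1)%N -> (forall i, (i < n)%N -> colen (n - i) l1 = colen (n - i) l2) ->
    (nth 0%N l1 r <= nth 0%N l2 r)%N.
  move=> s1 s2 /allP ln r1 E'; have [->//|c0] := posnP (nth 0%N l1 r).
  rewrite colenP //; have cn : (nth 0%N l1 r <= n)%N by apply/ln/mem_nth.
  rewrite -(subKn cn) -E'; last by lia.
  by rewrite subKn // -colenP.
apply/eqP; rewrite eqn_leq !aux // -?sz // => i ?; exact/esym/E.
Qed.

(** The boxes of [la] outside [ka] form a horizontal strip. Equal lengths mean that rows emptied by
    the removal stay as zero parts. *)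
Definition interlace la ka : Prop := size ka = size la /\
  forall r, (r < size la)%N -> (nth 0 la r.+1 <= nth 0 ka r <= nth 0 la r)%N.

Fixpoint interl la : seq (seq nat) :=
  if la is p :: l then
    [seq k :: ks | k <- iota (head 0%N l) (p.+1 - head 0%N l), ks <- interl l]
  else [:: [::]].

Lemma mem_interl la ka : reflect (interlace la ka) (ka \in interl la).
Proof.
apply: (iffP idP).
  elim: la ka => [|p la IH] ka /=; first by rewrite inE => /eqP ->; split.
  case/allpairsP => -[k ks] /= [kk /IH[sz H] ->]; split; first by rewrite /= sz.
  case=> [|r] /= rs; last exact: H.
  by move: kk; rewrite mem_iota nth0; lia.
elim: la ka => [|p la IH] [|k ka] [] //= [sz] H.
apply/allpairsP; exists (k, ka) => /=; split=> //.
  by have := H 0%N erefl; rewrite mem_iota /= nth0; lia.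
by apply: IH; split=> // r rs; apply: (H r.+1).
Qed.

Lemma interl_uniq la : uniq (interl la).
Proof.
elim: la => //= p la IH; apply: allpairs_uniq => //; first exact: iota_uniq.
by move=> [a b] [c d] _ _ /= [-> ->].
Qed.

Lemma interlace_sorted la ka : interlace la ka -> sorted geq ka.
Proof.
move=> [sz H]; apply/(sortedP 0%N) => i ik /=; rewrite sz in ik.
have /andP[_ h1] := H i.+1 ik; have /andP[h2 _] := H i (ltnW ik).
exact: leq_trans h1 h2.
Qed.

Lemma interlace_le n la ka : interlace la ka -> all (leq^~ n) la -> all (leq^~ n) ka.
Proof.
move=> [sz H] /(all_nthP 0%N) lan; apply/(all_nthP 0%N) => i; rewrite sz => ila.
by have /andP[_ h] := H i ila; apply: leq_trans h (lan _ ila).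
Qed.

Lemma interlace_sumn la ka : interlace la ka -> (sumn ka <= sumn la)%N.
Proof.
elim: la ka => [|p la IH] [|k ka] [] //= [sz] H.
apply: leq_add; first by have /andP[] := H 0%N erefl.
by apply: IH; split=> // r rs; apply: (H r.+1).
Qed.

Lemma interlace_colen la ka c : sorted geq la -> interlace la ka -> (0 < c)%N ->
  (colen c ka <= colen c la <= (colen c ka).+1)%N.
Proof.
move=> sla il c0; have ska := interlace_sorted il; have [sz H] := il.
have out (l : seq nat) r : (size l <= r)%N -> (c <= nth 0 l r)%N = false.
  by move=> h; rewrite nth_default // leqNgt c0.
apply/andP; split.
  case E : (colen c ka) => [//|r]; rewrite -colenP //.
  have : (c <= nth 0 ka r)%N by rewrite colenP // E.
  have [rl|rl] := ltnP r (size la); last by rewrite out ?sz.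
  by have /andP[_ h] := H r rl => h'; apply: leq_trans h' h.
case E : (colen c la) => [//|[//|r]]; rewrite ltnS -colenP //.
have : (c <= nth 0 la r.+1)%N by rewrite colenP // E.
have [rl|rl] := ltnP r (size la); last by rewrite out // ltnW.
by have /andP[h _] := H r rl => h'; apply: leq_trans h' h.
Qed.

Lemma interlaceP n la ka : sorted geq la -> sorted geq ka -> size ka = size la ->
  all (leq^~ n) la -> all (leq^~ n) ka ->
  (forall i, (i < n)%N ->
     (colen (n - i) ka <= colen (n - i) la <= (colen (n - i) ka).+1)%N) ->
  interlace la ka.
Proof.
move=> sla ska sz /allP lan /allP kan H; split=> // r rla; apply/andP; split.
  have [->//|c0] := posnP (nth 0%N la r.+1).
  have cn : (nth 0%N la r.+1 <= n)%N.
    have [rs|rs] := ltnP r.+1 (size la); first exact/lan/mem_nth.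
    by rewrite nth_default.
  rewrite colenP // -ltnS -(subKn cn); have /andP[_] := H (n - nth 0 la r.+1)%N ltac:(lia).
  by apply: leq_trans; rewrite subKn // -colenP.
have [->//|c0] := posnP (nth 0%N ka r).
have cn : (nth 0%N ka r <= n)%N by apply/kan/mem_nth; rewrite sz.
rewrite colenP // -(subKn cn); have /andP[+ _] := H (n - nth 0 ka r)%N ltac:(lia).
by apply: leq_trans; rewrite subKn // -colenP.
Qed.

(** The shape whose column n - i has z_i - i boxes: row r counts the columns longer than r. Its
    length is prescribed, so zero parts may occur. *)
Definition part_of n (z : nat -> nat) l : seq nat :=
  mkseq (fun r => count (fun i => (r + i < z i)%N) (iota 0 n)) l.

Lemma size_part_of n z l : size (part_of n z l) = l.
Proof. exact: size_mkseq. Qed.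

Lemma part_of_le n z l : all (leq^~ n) (part_of n z l).
Proof.
apply/allP => x /mapP[r _ ->].
by rewrite -[X in (_ <= X)%N](size_iota 0) count_size.
Qed.

Lemma part_of_sorted n z l : sorted geq (part_of n z l).
Proof.
apply/(sortedP 0%N) => r; rewrite size_part_of => rl.
rewrite !nth_mkseq //; last exact: ltnW.
by apply: sub_count => i /=; lia.
Qed.

Lemma count_upset (P : pred nat) n i : (i < n)%N ->
  (forall j k, (j <= k < n)%N -> P j -> P k) ->
  (n - i <= count P (iota 0 n))%N = P i.
Proof.
move=> ilt up; case: (boolP (P i)) => [Pi|nPi].
  rewrite -{2}(subnKC (ltnW ilt)) iotaD count_cat.
  apply: leq_trans (leq_addl _ _); rewrite add0n.
  have /eqP -> : count P (iota i (n - i)) == size (iota i (n - i)).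
    rewrite -all_count; apply/allP => k; rewrite mem_iota => ki.
    by apply: (up i k) => //; lia.
  by rewrite size_iota.
apply/negbTE; rewrite -ltnNge -{1}(subnKC ilt) iotaD count_cat.
have /eqP -> : count P (iota 0 i.+1) == 0%N.
  rewrite eqn0Ngt -has_count; apply/hasPn => k; rewrite mem_iota => ki.
  by apply: contra nPi; apply: up; lia.
rewrite add0n; apply: leq_ltn_trans (count_size _ _) _.
by rewrite size_iota; lia.
Qed.

Lemma count_ltn_iota l d : (d <= l)%N -> count (fun r => (r < d)%N) (iota 0 l) = d.
Proof.
move=> dl; rewrite -(subnKC dl) iotaD count_cat.
have /eqP -> : count (fun r => (r < d)%N) (iota 0 d) == size (iota 0 d).
  by rewrite -all_count; apply/allP => k; rewrite mem_iota.
have /eqP -> : count (fun r => (r < d)%N) (iota (0 + d) (l - d)) == 0%N.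
  by rewrite eqn0Ngt -has_count; apply/hasPn => k; rewrite mem_iota; lia.
by rewrite size_iota addn0.
Qed.

Lemma part_of_colen n z l i : (i < n)%N ->
  (forall i j, (i < j < n)%N -> (z i < z j)%N) -> (i <= z i <= l + i)%N ->
  colen (n - i) (part_of n z l) = (z i - i)%N.
Proof.
move=> ilt inc /andP[zi1 zi2].
have mono j d : (j + d < n)%N -> (z j + d <= z (j + d))%N.
  elim: d => [|d IH] jd; first by rewrite !addn0.
  rewrite !addnS; apply: leq_ltn_trans (IH _) (inc _ _ _); lia.
have E r : (n - i <= count (fun i => (r + i < z i)%N) (iota 0 n))%N = (r < z i - i)%N.
  rewrite count_upset // => [|j k /andP[jk kn] jP]; first by lia.
  have := mono j (k - j)%N; rewrite subnKC // => /(_ kn); lia.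
rewrite /colen count_map (eq_count (a2 := fun r => (r < z i - i)%N)) //.
by rewrite count_ltn_iota //; lia.
Qed.

End ColumnLengths.

(** * Tableaux and the branching rule *)

Section Tableaux.
Implicit Types (la ka r s : seq nat) (T : seq (seq nat)).

Lemma colstrictP r s :
  reflect (forall j, (j < size s)%N -> (nth 0 r j < nth 0 s j)%N) (colstrict r s).
Proof.
apply: (iffP allP) => H j; first by move=> js; apply: H; rewrite mem_iota.
by rewrite mem_iota => /andP[_]; exact: H.
Qed.

Lemma ssytP la T : reflect
  [/\ shape T = la, forall i, (i < size T)%N -> sorted leq (nth [::] T i) &
      forall i, (i.+1 < size T)%N -> colstrict (nth [::] T i) (nth [::] T i.+1)]
  (ssyt la T).
Proof.
apply: (iffP and3P) => [[/eqP sh /all_nthP rows /sortedP cols]|[sh rows cols]].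
  by split=> // i; [exact: rows|exact: cols].
by split; [exact/eqP|exact/(all_nthP [::])|exact/(sortedP [::])].
Qed.

Lemma row_split N r : sorted leq r -> all (fun x => (x < N.+1)%N) r ->
  let r' := [seq x <- r | (x < N)%N] in r = r' ++ nseq (size r - size r') N.
Proof.
elim: r => //= x r IH srt /andP[xN rN].
have := IH (path_sorted srt) rN => {}IH.
have [xlt|xge] := ltnP x N; first by rewrite /= subSS -IH.
have {xN xge} xN : x = N by apply/eqP; rewrite eqn_leq xge -ltnS xN.
have rn : all (pred1 N) r.
  apply/allP => y yr /=; rewrite eqn_leq -ltnS (allP rN) //=.
  by move: srt; rewrite (path_sortedE leq_trans) xN => /andP[/allP/(_ _ yr)].
have -> : [seq y <- r | (y < N)%N] = [::].
  apply/eqP; rewrite -[_ == _]negbK -has_filter; apply/hasPn => y yr.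
  by rewrite (eqP (allP rn _ yr)) ltnn.
by rewrite subn0 /= xN; congr cons; exact/all_pred1P.
Qed.

Lemma sorted_ext N r k : sorted leq r -> all (fun x => (x < N)%N) r ->
  sorted leq (r ++ nseq k N).
Proof.
move=> sr rN; rewrite (sorted_pairwise leq_trans) pairwise_cat.
rewrite -!(sorted_pairwise leq_trans) sr /=; apply/andP; split.
  by apply/allrelP => x y xr /nseqP[-> _]; apply: ltnW; exact: (allP rN).
by elim: k => // -[|k] //= ->; rewrite leqnn.
Qed.

(** Fills the strip between the shape of [T] and [la] with the letter N. *)
Fixpoint ext N la T : seq (seq nat) :=
  match la, T with
  | p :: la', r :: T' => (r ++ nseq (p - size r) N) :: ext N la' T'
  | _, _ => [::]
  end.

Definition restrict N T := [seq [seq x <- r | (x < N)%N] | r <- T].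

Lemma size_ext N la T : size T = size la -> size (ext N la T) = size la.
Proof. by elim: la T => [|p la IH] [|r T] //= [/IH ->]. Qed.

Lemma nth_ext N la T i : size T = size la -> (i < size la)%N ->
  nth [::] (ext N la T) i =
  nth [::] T i ++ nseq (nth 0%N la i - size (nth [::] T i)) N.
Proof.
elim: la T i => [|p la IH] [|r T] [|i] //= [sz] il; exact: IH.
Qed.

Lemma nth_shape T i : nth 0%N (shape T) i = size (nth [::] T i).
Proof.
have [iT|iT] := ltnP i (size T); first by rewrite (nth_map [::]).
by rewrite !nth_default // size_map.
Qed.

Lemma restrict_ext N la T : size T = size la -> all (all (fun x => (x < N)%N)) T ->
  restrict N (ext N la T) = T.
Proof.
elim: la T => [|p la IH] [|r T] //= [sz] /andP[rN TN]; rewrite IH //.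
congr (_ :: _); rewrite filter_cat (all_filterP rN).
by rewrite (@eq_in_filter _ _ pred0) ?filter_pred0 ?cats0 // => x /nseqP[-> _]; rewrite ltnn.
Qed.

(** The tableaux with entries below N, listed by stripping off the largest letter. Without letters
    only a shape without boxes remains; its empty rows are still listed. *)
Fixpoint tabs N la : seq (seq (seq nat)) :=
  if N is N'.+1 then [seq ext N' la T | ka <- interl la, T <- tabs N' ka]
  else if all (pred1 0%N) la then [:: nseq (size la) [::]] else [::].

Lemma nth_lt0 N T i : all (all (fun x => (x < N)%N)) T ->
  all (fun x => (x < N)%N) (nth [::] T i).
Proof.
move=> TN; have [iT|iT] := ltnP i (size T); last by rewrite nth_default.
exact: (allP TN) (mem_nth _ iT).
Qed.

Lemma ssyt_ext N la ka T : interlace la ka -> ssyt ka T ->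
  all (all (fun x => (x < N)%N)) T ->
  ssyt la (ext N la T) && all (all (fun x => (x < N.+1)%N)) (ext N la T).
Proof.
move=> [sz il] /ssytP[sh rows cols] TN.
have szT : size T = size la by rewrite -sz -sh size_map.
have szi i : size (nth [::] T i) = nth 0%N ka i by rewrite -sh nth_shape.
have szE i : (i < size la)%N -> size (nth [::] (ext N la T) i) = nth 0%N la i.
  move=> il'; rewrite nth_ext // size_cat size_nseq szi subnKC //.
  by have /andP[] := il i il'.
apply/andP; split; last first.
  apply/(all_nthP [::]) => i; rewrite size_ext // => ila; rewrite nth_ext // all_cat.
  rewrite all_nseq ltnSn orbT andbT; apply: sub_all (nth_lt0 i TN) => x xN.
  exact: ltnW.
apply/ssytP; rewrite size_ext //; split.
- apply: (@eq_from_nth _ 0%N); rewrite size_map size_ext // => i ila.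
  by rewrite nth_shape szE.
- by move=> i ila; rewrite nth_ext // sorted_ext ?rows ?szT //; exact: nth_lt0.
- move=> i ila; apply/colstrictP => j; rewrite szE // => jl.
  have /andP[h _] := il i (ltnW ila); have jk := leq_trans jl h.
  rewrite !nth_ext ?(ltnW ila) // nth_cat szi jk nth_cat szi.
  have rN : (nth 0 (nth [::] T i) j < N)%N.
    by apply: (allP (nth_lt0 i TN)); rewrite mem_nth // szi.
  have [js|js] := ltnP j (nth 0%N ka i.+1); last first.
    by rewrite nth_nseq ifT //; lia.
  have := cols i; rewrite szT => /(_ ila) /colstrictP; apply.
  by rewrite szi.
Qed.

(** The letters N form a tail of each row, and column strictness allows one per column, so they fill
    a horizontal strip. *)
Lemma ssyt_restrict N la T : sorted geq la -> ssyt la T ->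
  all (all (fun x => (x < N.+1)%N)) T ->
  let T' := restrict N T in
  [/\ interlace la (shape T'), ssyt (shape T') T',
      all (all (fun x => (x < N)%N)) T' & T = ext N la T'].
Proof.
move=> sla /ssytP[sh rows cols] TN T'.
have szT : size T = size la by rewrite -sh size_map.
have szT' : size T' = size la by rewrite size_map.
have nT' i : nth [::] T' i = [seq x <- nth [::] T i | (x < N)%N].
  have [iT|iT] := ltnP i (size T); first by rewrite (nth_map [::]).
  by rewrite !nth_default // size_map.
have rsp i : (i < size la)%N ->
   nth [::] T i = nth [::] T' i ++ nseq (nth 0%N la i - size (nth [::] T' i)) N.
  move=> ila; rewrite nT' {1}(@row_split N (nth [::] T i)); last exact: nth_lt0.
    by rewrite -nth_shape sh.
  by apply: rows; rewrite szT.
have le i : (size (nth [::] T' i) <= nth 0 la i)%N.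
  by rewrite nT' -sh nth_shape size_filter count_size.
have hs i : (i < size la)%N -> (nth 0 la i.+1 <= size (nth [::] T' i))%N.
  move=> ila; have [ila1|] := ltnP i.+1 (size la); last by move/(nth_default 0%N) ->.
  rewrite leqNgt; apply/negP => lt.
  have := cols i; rewrite szT => /(_ ila1) /colstrictP /(_ (size (nth [::] T' i))).
  rewrite -[size (nth _ T i.+1)]nth_shape sh => /(_ lt).
  rewrite {1}rsp // nth_cat ltnn subnn nth_nseq.
  have dec : (nth 0 la i.+1 <= nth 0 la i)%N by exact: (sortedP 0%N sla).
  rewrite subn_gt0 (leq_trans lt dec).
  have /allP := nth_lt0 i.+1 TN => /(_ (nth 0%N (nth [::] T i.+1) (size (nth [::] T' i)))).
  rewrite mem_nth => [/(_ isT)|]; first by lia.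
  by rewrite -[X in (_ < X)%N]nth_shape sh.
have T'N : all (all (fun x => (x < N)%N)) T'.
  by apply/allP => r /mapP[r0 _ ->]; exact: filter_all.
split=> //.
- split; first by rewrite size_map.
  by move=> i ila; rewrite nth_shape hs // le.
- apply/ssytP; split=> // i; rewrite szT' => ila.
    by rewrite nT' sorted_filter ?rows ?szT //; exact: leq_trans.
  apply/colstrictP => j js.
  have jr : (j < size (nth [::] T' i))%N.
    by apply: leq_trans (hs i (ltnW ila)); apply: leq_trans js (le _).
  have := cols i; rewrite szT => /(_ ila) /colstrictP /(_ j).
  rewrite -nth_shape sh => /(_ (leq_trans js (le _))).
  by rewrite (rsp i (ltnW ila)) (rsp i.+1 ila) !nth_cat jr js.
- apply: (@eq_from_nth _ [::]); rewrite ?size_ext // szT // => i ila.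
  by rewrite nth_ext // -rsp.
Qed.

Lemma mem_tabs N la T : sorted geq la ->
  (T \in tabs N la) = ssyt la T && all (all (fun x => (x < N)%N)) T.
Proof.
elim: N la T => [|N IH] la T sla.
  apply/idP/andP => [/=|[/ssytP[sh rows cols] TN]].
    case: ifP => // la0; rewrite inE => /eqP ->; split.
      apply/ssytP; rewrite size_nseq; split.
      - apply: (@eq_from_nth _ 0%N); rewrite size_map size_nseq // => i il.
        by rewrite nth_shape nth_nseq il (eqP (all_nthP 0%N la0 _ il)).
      - by move=> i il; rewrite nth_nseq il.
      - by move=> i il; rewrite !nth_nseq; apply/colstrictP => j; rewrite il.
    by rewrite all_nseq orbT.
  have T0 : all (pred1 [::]) T.
    by apply: sub_all TN => -[|x r] //=.
  have -> : T = nseq (size la) [::].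
    by rewrite -sh size_map; exact/all_pred1P.
  rewrite /= ifT ?inE //; rewrite -sh all_map.
  by apply: sub_all T0 => r /eqP ->.
apply/allpairsPdep/andP => [[ka [T' [/mem_interl il]]]|[ss TN]].
  rewrite IH; last exact: interlace_sorted il.
  by case/andP=> ss TN ->; apply/andP; exact: ssyt_ext il ss TN.
have [il ss' TN' E] := ssyt_restrict sla ss TN.
exists (shape (restrict N T)), (restrict N T); split=> //; first exact/mem_interl.
by rewrite IH ?ss' //; exact: interlace_sorted il.
Qed.

Lemma tabs_uniq N la : sorted geq la -> uniq (tabs N la).
Proof.
elim: N la => [|N IH] la sla /=; first by case: ifP.
apply: allpairs_uniq_dep; first exact: interl_uniq.
  by move=> ka /mem_interl il; exact/IH/interlace_sorted/il.
move=> p1 p2 /allpairsPdep[ka1 [T1 [/mem_interl il1 T1i ->]]].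
move=> /allpairsPdep[ka2 [T2 [/mem_interl il2 T2i ->]]] /= E.
have aux ka T : interlace la ka -> T \in tabs N ka ->
    shape T = ka /\ restrict N (ext N la T) = T.
  move=> il; rewrite mem_tabs; last exact: interlace_sorted il.
  case/andP=> /ssytP[sh _ _] TN; split=> //; rewrite restrict_ext //.
  by case: il => <- _; rewrite -sh size_map.
have [s1 r1] := aux _ _ il1 T1i; have [s2 r2] := aux _ _ il2 T2i.
have ET : T1 = T2 by rewrite -r1 E r2.
have Ek : ka1 = ka2 by rewrite -s1 -s2 ET.
by rewrite Ek ET.
Qed.

Lemma flatten_ext N la ka T : interlace la ka -> shape T = ka ->
  perm_eq (flatten (ext N la T)) (flatten T ++ nseq (sumn la - sumn ka) N).
Proof.
elim: la ka T => [|p la IH] ka T il sh.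
  by have [sz _] := il; case: T sh sz => [<-|? ? <-].
have [sz H] := il; case: ka il sh sz H => [//|k ka] il sh [sz] H.
case: T sh => [//|r T] /= [sr sh].
have il' : interlace la ka by split=> // i il'; exact: (H i.+1).
have kp : (k <= p)%N by have /andP[] := H 0%N erefl.
have le := interlace_sumn il'.
rewrite sr (_ : (p + sumn la - (k + sumn ka) = (p - k) + (sumn la - sumn ka))%N); last by lia.
rewrite nseqD -!catA perm_cat2l.
apply: perm_trans (_ : perm_eq (nseq (p - k) N ++ (flatten T ++ nseq (sumn la - sumn ka) N)) _).
  by rewrite perm_cat2l; exact: IH.
by rewrite perm_catCA.
Qed.

End Tableaux.

(** By multilinearity each row independently picks one of the two terms; the boolean vector records
    the choice. *)
Lemma det_branch (A : comNzRingType) (x : A) (e1 e2 : int -> A) n (Y : 'I_n -> int) :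
  (forall k, e2 k = e1 k + x * e1 (k - 1)) ->
  \det (\matrix_(i, j) e2 (Y i - j%:Z)) =
  \sum_(e : {ffun 'I_n -> bool}) x ^+ (\sum_i e i)%N *
     \det (\matrix_(i, j) e1 (Y i - (e i : nat)%:Z - j%:Z)).
Proof.
move=> H; rewrite /determinant.
transitivity (\sum_(s : 'S_n) \sum_(e : {ffun 'I_n -> bool})
   (-1) ^+ s * \prod_i (x ^+ e i * e1 (Y i - (e i : nat)%:Z - (s i)%:Z))).
  apply: eq_bigr => s _; rewrite -mulr_sumr; congr (_ * _).
  rewrite -(bigA_distr_bigA (fun i (b : bool) => x ^+ b *
     e1 (Y i - (b : nat)%:Z - (s i)%:Z))).
  apply: eq_bigr => i _; rewrite mxE H big_bool /= expr0 expr1 mul1r subr0 addrC.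
  by congr (_ * e1 _ + _); ring.
rewrite exchange_big; apply: eq_bigr => e _; rewrite mulr_sumr; apply: eq_bigr => s _.
rewrite big_split /= -expr_sum mulrCA; congr (_ * (_ * _)).
by apply: eq_bigr => i _; rewrite mxE.
Qed.

Section JacobiTrudi.
Variable R : comNzRingType.

Definition tabsum N la : fps R :=
  \sum_(T <- tabs N la) xmon R (seq_mset (flatten T)).

Lemma all_flatten_mset (N : nat) (T : seq (seq nat)) :
  all (fun i => (i < N)%N) (seq_mset (flatten T)) = all (all (fun x => (x < N)%N)) T.
Proof.
rewrite (perm_all _ (perm_eq_seq_mset _)).
by elim: T => //= r T IH; rewrite all_cat IH.
Qed.

Lemma trunc_schur N la : sorted geq la -> trunc N (schur la) = tabsum N la.
Proof.
move=> sla; apply/funext => m; rewrite /tabsum fps_sumE /trunc; case: ifP => mN.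
  rewrite /schur /lfsum (fsum_seq (r := tabs N la)) ?tabs_uniq // => T.
    by rewrite mem_tabs // => /andP[].
  rewrite mem_tabs // /= => ->; rewrite /= /xmon => TN.
  by case: eqP => // mT; move: mN; rewrite mT all_flatten_mset (negPf TN).
rewrite big_seq big1 // => T; rewrite mem_tabs // => /andP[_ TN].
by rewrite /xmon; case: eqP => // mT; move: mN; rewrite mT all_flatten_mset TN.
Qed.

Lemma xmon_msetD a b : xmon R (a `+` b)%mset = xmon R a * xmon R b.
Proof.
apply/funext => m; rewrite xmonM /xmon; case: ifP => am.
  congr (nat_of_bool _)%:R; apply/eqP/eqP => [->|<-]; first by rewrite msubDK.
  by rewrite msubKD.
by case: eqP => // mE; move: am; rewrite mE msub_addl.
Qed.

Lemma xmon_nseq N k : xmon R (seq_mset (nseq k N)) = xmon R [mset N]%mset ^+ k.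
Proof.
elim: k => [|k IH].
  by rewrite expr0; congr (xmon R _); apply/msetP => i; rewrite mset_seqE mset0E.
rewrite exprS -IH -xmon_msetD; congr (xmon R _); apply/msetP => i.
by rewrite mset1DE !mset_seqE /= eq_sym.
Qed.

Lemma tabsumS N la : sorted geq la -> tabsum N.+1 la =
  \sum_(ka <- interl la) xmon R [mset N]%mset ^+ (sumn la - sumn ka) * tabsum N ka.
Proof.
move=> sla; rewrite /tabsum /= big_allpairs_dep /=.
apply: eq_big_seq => ka /mem_interl il; apply: etrans (esym (mulr_sumr _ _ _ _)).
apply: eq_big_seq => T; rewrite mem_tabs; last exact: interlace_sorted il.
case/andP=> /ssytP[sh _ _] _.
rewrite -xmon_nseq -xmon_msetD mset_seqD; congr (xmon R _).
apply/mset_perm; apply: perm_trans (flatten_ext N il sh) _.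
by rewrite perm_catC.
Qed.

Definition jtdet N n (Y : 'I_n -> int) : fps R :=
  \det (\matrix_(i, j) trunc N (elem (Y i - j%:Z))).

Lemma jtdetS N n (Y : 'I_n -> int) : jtdet N.+1 Y =
  \sum_(e : {ffun 'I_n -> bool}) xmon R [mset N]%mset ^+ (\sum_i e i)%N *
     jtdet N (fun i => Y i - (e i : nat)%:Z).
Proof.
exact: (@det_branch _ (xmon R [mset N]%mset) (fun k => trunc N (elem k))
  (fun k => trunc N.+1 (elem k)) n Y (fun k => trunc_elemS R N k)).
Qed.

Lemma jtdet_eq0 N n (Y : 'I_n -> int) (i j : 'I_n) :
  i != j -> Y i = Y j -> jtdet N Y = 0.
Proof.
by move=> ij E; apply: (determinant_alternate ij) => k; rewrite !mxE E.
Qed.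

Lemma jtdet_neg N n (Y : 'I_n -> int) (i : 'I_n) : Y i < 0 -> jtdet N Y = 0.
Proof.
move=> Yi; rewrite /jtdet (expand_det_row _ i) big1 // => j _.
rewrite mxE (_ : Y i - j%:Z = Negz (absz (Y i - j%:Z)).-1) ?elem_neg ?rmorph0 ?mul0r //.
by lia.
Qed.

(* The [i]-th smallest column length, shifted by [i] to make [ypos n la] strictly
   increasing. *)
Definition ypos n la (i : nat) : nat := (i + colen (n - i) la)%N.

Lemma ypos_incr n la i j : (i < j)%N -> (ypos n la i < ypos n la j)%N.
Proof.
move=> ij; rewrite /ypos -addSn leq_add // /colen; apply: sub_count => p /=.
by lia.
Qed.

Lemma all_head n la : sorted geq la -> (head 0%N la <= n)%N -> all (leq^~ n) la.
Proof.
case: la => //= p la; rewrite (path_sortedE geq_trans) => /andP[/allP H _] pn.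
by rewrite pn; apply/allP => x /H /= xp; apply: leq_trans xp pn.
Qed.

(** Induction on the number of variables. A strip corresponds to the boolean vector of the columns
    that lose a box. Any other vector yields a negative position or two equal positions, hence a
    zero determinant. *)
Lemma tabsum_jtdet N n la : sorted geq la -> all (leq^~ n) la ->
  tabsum N la = jtdet N (fun i : 'I_n => (ypos n la i)%:Z).
Proof.
elim: N la => [|N IH] la sla lan.
  rewrite /tabsum /=; case: ifP => la0.
    rewrite big_seq1 /jtdet (_ : \matrix_(_, _) _ = 1%:M) ?det1.
      congr (xmon R _); apply/msetP => i; rewrite mset_seqE mset0E.
      by elim: (size la).
    apply/matrixP => i j; rewrite !mxE trunc0_elem; congr (nat_of_bool _)%:R.
    rewrite /ypos (_ : colen _ la = 0%N) ?addn0 ?subr_eq0 //.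
    apply/eqP; rewrite /colen eqn0Ngt -has_count; apply/hasPn => x xla.
    by rewrite (eqP (allP la0 _ xla)) -ltnNge subn_gt0.
  rewrite big_nil; case/allPn: (negbT la0) => p pla /= p0.
  case: n lan => [|n] lan; first by have := allP lan _ pla; rewrite leqn0 (negPf p0).
  (* Without variables e_k = 0 for k nonzero. The last position exceeds every column index, so the
     last row is zero. *)
  rewrite /jtdet (expand_det_row _ ord_max) big1 // => j _; rewrite mxE trunc0_elem.
  rewrite /ypos /= subSnn.
  have c1 : (0 < colen 1 la)%N.
    by rewrite /colen -has_count; apply/hasP; exists p => //; rewrite lt0n.
  rewrite (_ : (_ == 0) = false) ?mul0r //; have := ltn_ord j; lia.
rewrite tabsumS // jtdetS.
pose eps (ka : seq nat) : {ffun 'I_n -> bool} :=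
  [ffun i : 'I_n => (colen (n - i) ka < colen (n - i) la)%N].
have epsE ka (i : 'I_n) : interlace la ka ->
    colen (n - i) la = (colen (n - i) ka + eps ka i)%N.
  move=> il; rewrite ffunE; have := interlace_colen sla il (_ : 0 < n - i)%N.
  by rewrite subn_gt0 => /(_ (ltn_ord i)); case: ltnP; lia.
pose F (e : {ffun 'I_n -> bool}) := xmon R [mset N]%mset ^+ (\sum_i e i)%N *
     jtdet N (fun i => (ypos n la i)%:Z - (e i : nat)%:Z).
transitivity (\sum_(e <- [seq eps ka | ka <- interl la]) F e).
  rewrite big_map big_seq [RHS]big_seq; apply: eq_bigr => ka /mem_interl il.
  have ska := interlace_sorted il; have kan := interlace_le il lan.
  rewrite IH // /F; congr (_ ^+ _ * _).
    rewrite -(sum_colen lan) -(sum_colen kan).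
    rewrite (eq_bigr _ (fun i _ => epsE ka i il)).
    by rewrite big_split /= addKn.
  congr (\det _); apply/matrixP => i j; rewrite !mxE; congr (trunc N (elem (_ - _))).
  by rewrite /ypos (epsE ka i il); lia.
have ur : uniq [seq eps ka | ka <- interl la].
  rewrite map_inj_in_uniq ?interl_uniq // => k1 k2 /mem_interl i1 /mem_interl i2 E.
  apply: (@eq_colen n _ _ (interlace_sorted i1) (interlace_sorted i2)
    (interlace_le i1 lan) (interlace_le i2 lan)).
    by have [-> _] := i1; have [-> _] := i2.
  move=> i ilt; have := epsE k1 (Ordinal ilt) i1; rewrite (epsE k2 (Ordinal ilt) i2) E /=.
  by move/eqP; rewrite eqn_add2r => /eqP.
rewrite big_uniq //= -/F [RHS](bigID (mem [seq eps ka | ka <- interl la])) /=.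
rewrite [X in _ = _ + X]big1 ?addr0 // => e ne; rewrite /F.
suff -> : jtdet N (fun i : 'I_n => (ypos n la i)%:Z - (e i : nat)%:Z) = 0 by rewrite mulr0.
have [[i Hi]|pos] := pselect (exists i : 'I_n, (ypos n la i)%:Z - (e i : nat)%:Z < 0).
  exact: jtdet_neg Hi.
have [[i [j [ij E]]]|inj] := pselect (exists i j : 'I_n, i != j /\
    (ypos n la i)%:Z - (e i : nat)%:Z = (ypos n la j)%:Z - (e j : nat)%:Z).
  exact: jtdet_eq0 ij E.
case/negP: ne.
(* Lowering increasing positions by at most one, without collision or negative value, leaves them
   increasing; they encode a shape that interlaces [la]. *)
pose z (i : nat) := (ypos n la i - (if insub i is Some j then e j else false))%N.
have zE (i : 'I_n) : z i = (ypos n la i - e i)%N by rewrite /z valK.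
have zpos (i : 'I_n) : (e i <= ypos n la i)%N.
  by rewrite leqNgt; apply/negP => lt; apply: pos; exists i; lia.
have zinc i j : (i < j < n)%N -> (z i < z j)%N.
  move=> /andP[ij jn]; have iln := ltn_trans ij jn.
  pose i' := Ordinal iln; pose j' := Ordinal jn.
  rewrite -[i]/(i' : nat) -[j]/(j' : nat) !zE.
  have lt := @ypos_incr n la i' j' ij.
  have h1 := zpos i'; have h2 := zpos j'.
  have ne : (ypos n la i' - e i' != ypos n la j' - e j')%N.
    apply/negP => /eqP E; apply: inj; exists i', j'; split; last by lia.
    by rewrite -val_eqE /= ltn_eqF.
  by move: ne lt h1 h2; case: (e i'); case: (e j'); lia.
have zlo i : (i < n)%N -> (i <= z i)%N.
  elim: i => // i IHi iln; apply: leq_ltn_trans (IHi (ltnW iln)) (zinc _ _ _).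
  by rewrite ltnSn.
pose ka := part_of n z (size la).
have colk (i : 'I_n) : colen (n - i) ka = (z i - i)%N.
  apply: part_of_colen => //; rewrite zlo //= zE /ypos.
  have : (colen (n - i) la <= size la)%N by exact: count_size.
  lia.
have rel (i : 'I_n) : colen (n - i) la = (colen (n - i) ka + e i)%N.
  have := zlo i (ltn_ord i); rewrite colk zE; have := zpos i.
  rewrite /ypos; lia.
have il : interlace la ka.
  apply: (@interlaceP n) => //.
  - exact: part_of_sorted.
  - exact: size_part_of.
  - exact: part_of_le.
  - move=> i ilt; rewrite (rel (Ordinal ilt)) /=; case: (e _); lia.
apply/mapP; exists ka; first exact/mem_interl.
apply/ffunP => i; rewrite ffunE rel; case: (e i); lia.
Qed.

Theorem schur_det n la : sorted geq la -> (head 0%N la <= n)%N ->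
  schur la = \det (\matrix_(i < n, j < n) elem ((ypos n la i)%:Z - j%:Z)) :> fps R.
Proof.
move=> sla lan; apply: fps_trunc_eq => N.
rewrite trunc_schur // (@tabsum_jtdet N n) //; last exact: all_head.
rewrite /jtdet -det_map_mx; congr (\det _); apply/matrixP => i j.
by rewrite !mxE.
Qed.

End JacobiTrudi.


(** * Schur expansions of symmetric power series *)

Section SymmetricRing.
Variable R : comNzRingType.
Implicit Types f g : fps R.

Definition mact (s : nat -> nat) (m : monomial) : monomial := seq_mset (map s m).

Lemma mact_seq s (l : seq nat) : mact s (seq_mset l) = seq_mset (map s l).
Proof. by apply/mset_perm/perm_map; exact: perm_eq_seq_mset. Qed.

Lemma mactD s (a b : monomial) : mact s (a `+` b)%mset = (mact s a `+` mact s b)%mset.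
Proof.
rewrite /mact mset_seqD -map_cat; apply/mset_perm/perm_map; exact: mset_addP.
Qed.

Lemma mactK s s' : cancel s s' -> cancel (mact s) (mact s').
Proof.
by move=> K m; rewrite {2}/mact mact_seq (mapK K) seq_mset_id.
Qed.

Lemma symmetricE f : symmetric_fps f <-> (forall s m, bijective s -> f (mact s m) = f m).
Proof.
split=> [H s m bs|H s bs l]; last by rewrite -mact_seq H.
by rewrite /mact H // seq_mset_id.
Qed.

Lemma symmetric0 : symmetric_fps (0 : fps R). Proof. by []. Qed.

Lemma symmetric1 : symmetric_fps (1 : fps R).
Proof.
move=> s _ l; rewrite !fps_1E; congr (nat_of_bool _)%:R.
have E (t : seq nat) : (seq_mset t == mset0) = (t == [::]).
  apply/eqP/eqP => [E|->]; last by apply/msetP => i; rewrite mset_seqE mset0E.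
  by apply: size0nil; rewrite -size_seq_mset E enum_mset0.
by rewrite !E; case: l.
Qed.

Lemma symmetricD f g : symmetric_fps f -> symmetric_fps g -> symmetric_fps (f + g).
Proof. by move=> sf sg s bs l; rewrite !fps_addE sf // sg. Qed.

Lemma symmetricN f : symmetric_fps f -> symmetric_fps (- f).
Proof. by move=> sf s bs l; rewrite !fps_oppE sf. Qed.

Lemma symmetricM f g : symmetric_fps f -> symmetric_fps g -> symmetric_fps (f * g).
Proof.
move=> /symmetricE sf /symmetricE sg; apply/symmetricE => s m [s' sK s'K].
have bs : bijective s by exists s'.
rewrite -[LHS]/(fps_mul f g _) -[RHS]/(fps_mul f g _) /fps_mul.
rewrite (reindex_fsbig (fun ab => (mact s ab.1, mact s ab.2)) (antidiag m)).
  by apply: eq_fsbigr => -[a b] _ /=; rewrite sf // sg.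
split.
- by move=> [a b]; rewrite /antidiag /= => <-; rewrite mactD.
- move=> [a b] [c d] _ _ /= [/(can_inj (mactK sK)) -> /(can_inj (mactK sK)) ->] //.
- move=> [a b] /= E; exists (mact s' a, mact s' b); last by rewrite /= !(mactK s'K).
  by rewrite /antidiag /= -mactD E (mactK sK).
Qed.

Lemma symmetric_sum I r (P : pred I) (F : I -> fps R) :
  (forall i, P i -> symmetric_fps (F i)) -> symmetric_fps (\sum_(i <- r | P i) F i).
Proof.
by move=> H; apply: (big_ind (@symmetric_fps R)) => //; exact: symmetricD.
Qed.

Lemma symmetric_det n (M : 'M[fps R]_n) :
  (forall i j, symmetric_fps (M i j)) -> symmetric_fps (\det M).
Proof.
move=> H; apply: symmetric_sum => s _; apply: symmetricM; last first.
  by apply: (big_ind (@symmetric_fps R)) => //; [exact: symmetric1|exact: symmetricM].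
by rewrite -signr_odd; case: odd; [apply/symmetricN|]; exact: symmetric1.
Qed.

Lemma symmetric_lfsum (I : choiceType) (A : set I) (F : I -> fps R) :
  (forall i, A i -> symmetric_fps (F i)) -> symmetric_fps (lfsum A F).
Proof.
by move=> H s bs l; apply: eq_fsbigr => i /set_mem Ai; exact: H.
Qed.

Lemma symmetric_elem n : symmetric_fps (@elem R n).
Proof.
case: n => n; last by rewrite elem_neg.
move=> s bs l; rewrite !elemE !size_seq_mset size_map.
rewrite !(perm_uniq (perm_eq_seq_mset _)) map_inj_uniq //; exact: bij_inj.
Qed.

Lemma symmetric_schur la : intpart la -> symmetric_fps (@schur R la).
Proof.
move=> /andP[sla _]; rewrite (schur_det R sla (leqnn _)); apply: symmetric_det => i j.
by rewrite mxE; exact: symmetric_elem.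
Qed.

End SymmetricRing.

(** Composing with the transposition of [x] and the current image of the next index prescribes one
    more value. *)
Lemma bijective_extension (u : seq nat) : uniq u ->
  exists2 s : nat -> nat, bijective s & map s (iota 0 (size u)) = u.
Proof.
elim/last_ind: u => [|u x IH]; first by exists id => //; exists id.
rewrite rcons_uniq => /andP[xu /IH[s bs E]].
pose t y := if y == s (size u) then x else if y == x then s (size u) else y.
have tK : cancel t t by move=> y; rewrite /t; do !case: eqP => //; congruence.
exists (t \o s); first by apply: bij_comp => //; exists t.
rewrite size_rcons -addn1 iotaD map_cat add0n -cats1; congr (_ ++ _); last first.
  by rewrite /= /t eqxx.
rewrite map_comp E map_id_in // => y yu; rewrite /t; case: eqP => [ys|_].
  move: yu; rewrite -E => /mapP[i]; rewrite mem_iota => ilt.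
  by rewrite ys => /(bij_inj bs) ui; rewrite ui ltnn andbF in ilt.
by case: eqP => // yx; rewrite -yx yu in xu.
Qed.

(** * Contents of tableaux and Kostka triangularity *)

Section Content.
Implicit Types (la mu : seq nat) (T : seq (seq nat)).

Fixpoint stdrows i la : seq (seq nat) :=
  if la is p :: l then nseq p i :: stdrows i.+1 l else [::].

Definition content_mon mu : monomial := seq_mset (flatten (stdrows 0 mu)).

Lemma count_stdrows i j mu : count_mem i (flatten (stdrows j mu)) =
  if (j <= i)%N then nth 0%N mu (i - j) else 0%N.
Proof.
elim: mu j => [|p mu IH] j /=; first by rewrite nth_nil if_same.
rewrite count_cat IH count_nseq /=; case: (ltngtP j i) => ij.
- by rewrite -(subnSK ij).
- by [].
- by rewrite ij subnn /= mul1n addn0.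
Qed.

Lemma content_monE mu i : content_mon mu i = nth 0%N mu i.
Proof. by rewrite mset_seqE count_stdrows subn0. Qed.

Lemma size_content_mon mu : size (content_mon mu) = sumn mu.
Proof.
rewrite size_seq_mset size_flatten; congr sumn.
by elim: mu 0%N => //= p mu IH i; rewrite size_nseq IH.
Qed.

Lemma intpart_nth_gt0 la i : intpart la -> (0 < nth 0 la i)%N = (i < size la)%N.
Proof.
move=> /andP[_ /(all_nthP 0%N) H]; case: (ltnP i) => il; first exact: H.
by rewrite nth_default.
Qed.

Lemma eq_intpart la mu : intpart la -> intpart mu ->
  (forall i, nth 0%N la i = nth 0%N mu i) -> la = mu.
Proof.
move=> pla pmu E.
have sz i : (i < size la)%N = (i < size mu)%N by rewrite -!intpart_nth_gt0 // E.
apply: (@eq_from_nth _ 0%N) => //; apply/eqP; rewrite eqn_leq.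
by rewrite leqNgt sz ltnn /= leqNgt -sz ltnn.
Qed.

Lemma content_mon_inj la mu : intpart la -> intpart mu ->
  content_mon la = content_mon mu -> la = mu.
Proof.
by move=> pla pmu /msetP E; apply: eq_intpart => // i; have := E i; rewrite !content_monE.
Qed.

Lemma monomial_content (m : monomial) : exists2 mu, intpart mu &
  exists2 s : nat -> nat, bijective s & m = mact s (content_mon mu).
Proof.
pose r i j := (m i >= m j)%N.
have r_total : total r by move=> i j; exact: leq_total.
pose u := sort r (undup m).
have [s bs E] := bijective_extension (etrans (sort_uniq r (undup m)) (undup_uniq m)).
exists [seq m i | i : nat <- u].
  apply/andP; split.
    by rewrite sorted_map; exact: sort_sorted.
  apply/allP => p /mapP[i iu ->] /=; rewrite mset_gt0.
  by move: iu; rewrite mem_sort mem_undup.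
exists s => //; rewrite -/u in E.
have [s' sK s'K] := bs.
have cE i : count_mem i (map s (content_mon [seq m i | i : nat <- u])) =
    count_mem (s' i) (content_mon [seq m i | i : nat <- u]).
  rewrite count_map; apply: eq_count => j /=.
  by rewrite -{1}[i]s'K (inj_eq (can_inj sK)).
apply/msetP => i; rewrite mset_seqE cE count_mem_mset content_monE.
have [iu|iu] := ltnP (s' i) (size u); last first.
  rewrite nth_default ?size_map //; apply/eqP; rewrite -leqn0 leqNgt mset_gt0.
  apply: contraTN iu => im; rewrite -ltnNge.
  have : i \in u by rewrite mem_sort mem_undup.
  by rewrite -{1}E => /mapP[j]; rewrite mem_iota => /andP[_ jl] ->; rewrite sK.
rewrite (nth_map 0%N) // -[in nth _ u _]E (nth_map 0%N) ?size_iota // nth_iota //.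
by rewrite s'K.
Qed.

(* Row [i] of a semistandard tableau has entries at least [i], so the sum of the
   entries bounds [nstat] of the shape; this makes the Kostka matrix triangular. *)
Fixpoint nstat i la : nat := if la is p :: l then (i * p + nstat i.+1 l)%N else 0%N.

Fixpoint lowrows i T : bool :=
  if T is r :: T' then all (leq i) r && lowrows i.+1 T' else true.

Lemma sumn_stdrows i la : sumn (flatten (stdrows i la)) = nstat i la.
Proof. by elim: la i => //= p la IH i; rewrite sumn_cat sumn_nseq IH. Qed.

Lemma sumn_lowrow i r : all (leq i) r -> (i * size r <= sumn r)%N.
Proof. by elim: r => [|x r IH] /=; [rewrite muln0|case/andP=> ix /IH; lia]. Qed.

Lemma sumn_lowrow_eq i r : all (leq i) r -> sumn r = (i * size r)%N -> r = nseq (size r) i.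
Proof.
elim: r => //= x r IH /andP[ix ir] E; have := sumn_lowrow ir => le.
have xi : x = i by lia.
by rewrite xi -IH //; lia.
Qed.

Lemma sumn_lowrows i T : lowrows i T -> (nstat i (shape T) <= sumn (flatten T))%N.
Proof.
elim: T i => //= r T IH i /andP[/sumn_lowrow le /IH le'].
by rewrite sumn_cat leq_add.
Qed.

Lemma sumn_lowrows_eq i T : lowrows i T ->
  sumn (flatten T) = nstat i (shape T) -> T = stdrows i (shape T).
Proof.
elim: T i => //= r T IH i /andP[lr lT]; rewrite sumn_cat => E.
have le1 := sumn_lowrow lr; have le2 := sumn_lowrows lT.
by rewrite -IH // -?sumn_lowrow_eq //; lia.
Qed.

Lemma lowrows_ssyt la T : sorted geq la -> ssyt la T -> lowrows 0 T.
Proof.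
move=> sla /and3P[/eqP sh _ cs]; rewrite -sh in sla => {la sh}.
have : all (leq 0) (head [::] T) by apply/allP.
elim: T 0%N sla cs => //= r T IH i sla cs ir; rewrite ir /=.
case: T IH sla cs => // r' T IH /= /andP[sz sla] /andP[/colstrictP cr cs].
apply: IH => //=; apply/(all_nthP 0%N) => j jr'.
apply: leq_ltn_trans (cr j jr'); apply: (all_nthP 0%N ir).
exact: leq_trans jr' sz.
Qed.

Lemma ssyt_stdrows la : sorted geq la -> ssyt la (stdrows 0 la).
Proof.
move=> sla; apply/and3P; split.
- by apply/eqP; elim: la 0%N {sla} => //= p la IH i; rewrite size_nseq IH.
- elim: la 0%N {sla} => //= p la IH i; rewrite IH andbT.
  by elim: p => // -[|p] //= ->; rewrite leqnn.
- elim: la 0%N sla => //= p la IH i sla; have := IH i.+1 (path_sorted sla).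
  case: la sla {IH} => //= p' la /andP[pp _] ->; rewrite andbT.
  apply/colstrictP => j; rewrite size_nseq => jp'.
  by rewrite !nth_nseq jp' (leq_trans jp' pp).
Qed.

End Content.

Section Kostka.
Variable R : comNzRingType.
Implicit Types la mu : seq nat.

Lemma schur_size la (m : monomial) : size m != sumn la -> @schur R la m = 0.
Proof.
move=> sz; apply: fsbig1 => T /and3P[/eqP sh _ _]; rewrite /xmon.
case: eqP => // mT; case/negP: sz; rewrite mT size_seq_mset size_flatten.
by rewrite sh.
Qed.

(** The sum of the entries is [nstat 0 mu], so the lower bound [nstat 0 la] is attained and row i is
    constantly i. *)
Lemma ssyt_content la mu T : intpart la -> ssyt la T ->
  content_mon mu = seq_mset (flatten T) -> (nstat 0 mu <= nstat 0 la)%N ->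
  T = stdrows 0 la.
Proof.
move=> /andP[sla _] sT E le; have [/eqP sh _ _] := and3P sT.
have lT := lowrows_ssyt sla sT; rewrite -sh; apply: sumn_lowrows_eq => //.
apply/eqP; rewrite eqn_leq sumn_lowrows // andbT sh.
apply: leq_trans le; rewrite -sumn_stdrows.
by rewrite (perm_sumn (proj1 (mset_perm _ _) E)).
Qed.

Lemma kostka_diag la : intpart la -> @schur R la (content_mon la) = 1.
Proof.
move=> pla; have [sla _] := andP pla.
rewrite /schur /lfsum (fsum_seq (r := [:: stdrows 0 la])) //.
- by rewrite big_seq1 /xmon eqxx.
- by move=> T; rewrite inE => /eqP ->; exact: ssyt_stdrows.
- move=> T sT; rewrite inE => nT; rewrite /xmon; case: eqP => // E.
  by case/negP: nT; apply/eqP; exact: ssyt_content E _.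
Qed.

Lemma kostka_triangular la mu : intpart la -> intpart mu -> la != mu ->
  (nstat 0 mu <= nstat 0 la)%N -> @schur R la (content_mon mu) = 0.
Proof.
move=> pla pmu nlm le; apply: fsbig1 => T sT; rewrite /xmon; case: eqP => // E.
have ET := ssyt_content pla sT E le; case/negP: nlm.
by apply/eqP/content_mon_inj => //; rewrite E ET.
Qed.

End Kostka.

(** Solved by increasing rank: correcting the coefficients of rank k leaves the equations of smaller
    rank intact. *)
Lemma unitriangular_solve (R : pzRingType) (I : eqType) (P : seq I) (rk : I -> nat)
    (K : I -> I -> R) (b : I -> R) : uniq P ->
  (forall i, i \in P -> K i i = 1) ->
  {in P &, forall i j, i != j -> (rk j <= rk i)%N -> K i j = 0} ->
  exists c : I -> R, forall j, j \in P -> \sum_(i <- P) c i * K i j = b j.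
Proof.
move=> uP K1 K0.
suff [c Hc] : exists c : I -> R, forall j, j \in P ->
    (rk j < (\max_(i <- P) rk i).+1)%N -> \sum_(i <- P) c i * K i j = b j.
  by exists c => j jP; apply: Hc => //; rewrite ltnS; exact: leq_bigmax_seq.
elim: _.+1 => [|k [c Hc]]; first by exists (fun=> 0).
exists (fun i => c i + if rk i == k then b i - \sum_(l <- P) c l * K l i else 0).
move=> j jP jk; under eq_bigr do rewrite mulrDl.
rewrite big_split /=; have [rj|rj] := eqVneq (rk j) k.
  rewrite [X in _ + X](bigD1_seq j) //= rj eqxx K1 // mulr1 addrA [X in X + _]addrC subrK.
  rewrite big_seq_cond big1 ?addr0 // => i /andP[iP ij].
  case: eqP => ik; last by rewrite mul0r.
  by rewrite K0 ?mulr0 // rj ik.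
rewrite [X in _ + X]big_seq [X in _ + X]big1 ?addr0 => [|i iP].
  by apply: Hc => //; rewrite ltn_neqAle rj.
case: eqP => ik; last by rewrite mul0r.
have ij : i != j by apply: contraNneq rj => <-; rewrite ik.
by rewrite K0 ?mulr0 // ik -ltnS.
Qed.

Lemma unitriangular_inj (R : pzRingType) (I : eqType) (P : seq I) (rk : I -> nat)
    (K : I -> I -> R) (c : I -> R) : uniq P ->
  (forall i, i \in P -> K i i = 1) ->
  {in P &, forall i j, i != j -> (rk j <= rk i)%N -> K i j = 0} ->
  (forall j, j \in P -> \sum_(i <- P) c i * K i j = 0) ->
  forall j, j \in P -> c j = 0.
Proof.
move=> uP K1 K0 H j; elim/ltn_ind: (rk j) {-2}j (erefl (rk j)) => k IH {}j rj jP.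
have := H j jP; rewrite (bigD1_seq j) //= K1 // mulr1 big_seq_cond big1 ?addr0 //.
move=> i /andP[iP ij]; have [le|lt] := leqP (rk j) (rk i); first by rewrite K0 ?mulr0.
by rewrite (IH (rk i)) ?mul0r // -rj.
Qed.

Section SchurSeries.
Variable R : comNzRingType.
Implicit Types (f g : fps R) (la mu : seq nat) (c : seq nat -> R).

Fixpoint poslists n d : seq (seq nat) :=
  if n is n'.+1 then [::] :: [seq p :: l | p <- iota 1 d, l <- poslists n' d]
  else [:: [::]].

Lemma mem_poslists n d la : (size la <= n)%N -> all (fun p => (0 < p <= d)%N) la ->
  la \in poslists n d.
Proof.
elim: n la => [|n IH] [|p la] //= sz /andP[pd lad]; rewrite inE /=.
by apply/allpairsP; exists (p, la); rewrite mem_iota IH //; split=> //=; lia.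
Qed.

Definition parts d : seq (seq nat) :=
  undup [seq la <- poslists d d | intpart la && (sumn la == d)].

Lemma mem_parts d la : (la \in parts d) = intpart la && (sumn la == d).
Proof.
rewrite mem_undup mem_filter; case: (boolP (intpart la && _)) => //= /andP[/andP[_ pos] /eqP sd].
have H l : all (ltn 0) l -> (size l <= sumn l)%N /\ all (fun p => 0 < p <= sumn l)%N l.
  elim: l => //= p l IH /andP[p0 /IH[sz H]]; split; first by lia.
  rewrite p0 leq_addr /=; apply: sub_all H => x /=; lia.
by have [sz al] := H _ pos; apply: mem_poslists; rewrite -sd.
Qed.

Lemma parts_uniq d : uniq (parts d). Proof. exact: undup_uniq. Qed.

Definition schur_series c : fps R :=
  lfsum [set la | intpart la] (fun la m => c la * schur la m).

Lemma schur_seriesE c (m : monomial) :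
  schur_series c m = \sum_(la <- parts (size m)) c la * schur la m.
Proof.
apply: fsum_seq; first exact: parts_uniq.
  by move=> la; rewrite mem_parts => /andP[].
move=> la /= pla; rewrite mem_parts pla /= => sz.
by rewrite schur_size ?mulr0 // eq_sym.
Qed.

Lemma symmetric_schur_series c : symmetric_fps (schur_series c).
Proof.
apply: symmetric_lfsum => la pla s bs l.
by rewrite (symmetric_schur R pla).
Qed.

Lemma schur_series_coef0 c d : (forall m : monomial, size m = d -> schur_series c m = 0) ->
  forall la, intpart la -> sumn la = d -> c la = 0.
Proof.
move=> H la pla sla.
apply: (@unitriangular_inj R _ (parts d) (nstat 0) (fun la mu => schur la (content_mon mu))).
- exact: parts_uniq.
- by move=> mu; rewrite mem_parts => /andP[pmu _]; exact: kostka_diag.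
- move=> ka mu; rewrite !mem_parts => /andP[pka _] /andP[pmu _].
  exact: kostka_triangular.
- move=> mu; rewrite mem_parts => /andP[pmu /eqP smu].
  have := H (content_mon mu); rewrite size_content_mon => /(_ smu).
  by rewrite schur_seriesE size_content_mon smu.
- by rewrite mem_parts pla sla eqxx.
Qed.

Lemma schur_series_inj c1 c2 : (forall la, ~~ intpart la -> c1 la = 0) ->
  (forall la, ~~ intpart la -> c2 la = 0) -> schur_series c1 = schur_series c2 -> c1 = c2.
Proof.
move=> s1 s2 E; apply/funext => la; case: (boolP (intpart la)) => pla; last by rewrite s1 ?s2.
apply/eqP; rewrite -subr_eq0; apply/eqP.
apply: (@schur_series_coef0 (fun la => c1 la - c2 la) (sumn la)) => // m _.
rewrite schur_seriesE; under eq_bigr do rewrite mulrBl.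
by rewrite sumrB -!schur_seriesE E subrr.
Qed.

Lemma schur_expansion f : symmetric_fps f ->
  exists c, (forall la, ~~ intpart la -> c la = 0) /\ f = schur_series c.
Proof.
move=> sf.
have H d : exists c, forall mu, mu \in parts d ->
    \sum_(la <- parts d) c la * schur la (content_mon mu) = f (content_mon mu).
  apply: (@unitriangular_solve R _ (parts d) (nstat 0)).
  - exact: parts_uniq.
  - by move=> mu; rewrite mem_parts => /andP[pmu _]; exact: kostka_diag.
  - move=> ka mu; rewrite !mem_parts => /andP[pka _] /andP[pmu _].
    exact: kostka_triangular.
have [C HC] := choice H.
exists (fun la => if intpart la then C (sumn la) la else 0); split.
  by move=> la /negPf ->.
apply/funext => m; have [mu pmu [s bs ->]] := monomial_content m.
rewrite (proj1 (symmetricE f) sf) // (proj1 (symmetricE _) (symmetric_schur_series _)) //.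
rewrite schur_seriesE -(HC (sumn mu)) ?mem_parts ?pmu ?eqxx // size_content_mon.
apply: eq_big_seq => la; rewrite mem_parts => /andP[-> /eqP ->] //.
Qed.

(** Uniqueness of the expansion identifies the value chosen by [xget]. *)
Lemma schur_coef_series c : (forall la, ~~ intpart la -> c la = 0) ->
  schur_coef (schur_series c) = c.
Proof.
move=> sc; apply: xget_unique; first by split.
by move=> c' [sc' E]; apply: schur_series_inj => //; rewrite E.
Qed.

Lemma schur_coefP f : symmetric_fps f ->
  (forall la, ~~ intpart la -> schur_coef f la = 0) /\ f = schur_series (schur_coef f).
Proof.
by move=> /schur_expansion[c [sc ->]]; rewrite schur_coef_series.
Qed.

Lemma schur_coefD f g : symmetric_fps f -> symmetric_fps g ->
  schur_coef (f + g) = fun la => schur_coef f la + schur_coef g la.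
Proof.
move=> /schur_coefP[sf Ef] /schur_coefP[sg Eg].
have -> : f + g = schur_series (fun la => schur_coef f la + schur_coef g la).
  apply/funext => m; rewrite fps_addE {1}Ef {1}Eg !schur_seriesE -big_split.
  by apply: eq_bigr => la _; rewrite mulrDl.
by apply: schur_coef_series => la pla; rewrite sf // sg // addr0.
Qed.

Lemma schur_coefN f : symmetric_fps f ->
  schur_coef (- f) = fun la => - schur_coef f la.
Proof.
move=> /schur_coefP[sf Ef].
have -> : - f = schur_series (fun la => - schur_coef f la).
  apply/funext => m; rewrite fps_oppE {1}Ef !schur_seriesE -sumrN.
  by apply: eq_bigr => la _; rewrite mulNr.
by apply: schur_coef_series => la pla; rewrite sf // oppr0.
Qed.

Lemma schur_coef_schur la : intpart la ->
  schur_coef (@schur R la) = fun mu => (mu == la)%:R.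
Proof.
move=> pla; have supp mu : ~~ intpart mu -> (mu == la)%:R = 0 :> R.
  by case: eqP => // ->; rewrite pla.
rewrite -[RHS]schur_coef_series //; congr schur_coef; apply/funext => m.
rewrite schur_seriesE.
have [sz|sz] := eqVneq (size m) (sumn la).
  rewrite (bigD1_seq la) ?parts_uniq ?mem_parts ?pla ?sz //= eqxx mul1r big1 ?addr0 //.
  by move=> mu /negPf ->; rewrite mul0r.
rewrite schur_size // big_seq big1 // => mu; rewrite mem_parts => /andP[_ /eqP smu].
case: eqP => [E|]; last by rewrite mul0r.
by rewrite -smu E eqxx in sz.
Qed.

Lemma bounded_schur la : bounded_degree (@schur R la).
Proof.
by exists (sumn la) => m lt; rewrite schur_size // neq_ltn lt orbT.
Qed.

Lemma schur_coef_bounded g D : symmetric_fps g ->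
  (forall m : monomial, (D < size m)%N -> g m = 0) ->
  forall la, (D < sumn la)%N -> schur_coef g la = 0.
Proof.
move=> /schur_coefP[sg Eg] gD la lt; case: (boolP (intpart la)) => pla; last exact: sg.
apply: (@schur_series_coef0 _ (sumn la)) => // m sm.
by rewrite -Eg gD // sm.
Qed.

Lemma hallE f g D : (forall la, (D < sumn la)%N -> schur_coef g la = 0) ->
  hall f g = \sum_(d < D.+1) \sum_(la <- parts d) schur_coef f la * schur_coef g la.
Proof.
move=> gD; rewrite /hall.
rewrite (fsum_seq (r := [seq la | d <- iota 0 D.+1, la <- parts d])).
- by rewrite big_allpairs_dep -[iota 0 D.+1]/(index_iota 0 D.+1) big_mkord.
- apply: allpairs_uniq_dep; first exact: iota_uniq.
    by move=> d _; exact: parts_uniq.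
  move=> x y /allpairsPdep[d1 [l1 [_ + ->]]] /allpairsPdep[d2 [l2 [_ + ->]]] /= E.
  by rewrite !mem_parts -E => /andP[_ /eqP <-] /andP[_ /eqP <-].
- by move=> la /allpairsPdep[d [l [_ + ->]]]; rewrite mem_parts => /andP[].
- move=> la pla nla; rewrite gD ?mulr0 // ltnNge; apply: contra nla => le.
  apply/allpairsPdep; exists (sumn la), la; rewrite mem_iota mem_parts pla eqxx.
  by split.
Qed.

Lemma hall_schur f la : intpart la -> hall f (schur la) = schur_coef f la.
Proof.
move=> pla; rewrite (@hallE _ _ (sumn la)); last first.
  by rewrite schur_coef_schur // => mu; case: eqP => // ->; rewrite ltnn.
rewrite schur_coef_schur // (bigD1 ord_max) //= [X in _ + X]big1 ?addr0.
  rewrite (bigD1_seq la) ?parts_uniq ?mem_parts ?pla ?eqxx //= mulr1 big1 ?addr0 //.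
  by move=> mu /negPf ->; rewrite mulr0.
move=> d nd; rewrite big_seq big1 // => mu; rewrite mem_parts => /andP[_ /eqP smu].
case: eqP => [E|]; last by rewrite mulr0.
by case/negP: nd; rewrite -val_eqE /= -smu E.
Qed.

End SchurSeries.

(** Exchanging the sums in the cofactor expansions turns raising one row at a time into raising one
    column at a time. A raised column j > 0 equals column j - 1, so only column 0 contributes, and
    row 0, where Y = 0, isolates e_1. *)
Lemma jt_pieri (A : comNzRingType) (e : int -> A) n (Y : 'I_n.+1 -> int) :
  e 0 = 1 -> (forall m, e (Negz m) = 0) -> Y ord0 = 0 ->
  \sum_i \det (\matrix_(k, j) e (Y k + (k == i)%:R - j%:Z)) =
  e 1 * \det (\matrix_(k, j) e (Y k - j%:Z)).
Proof.
move=> e0 eneg Y0; set M := (X in e 1 * \det X).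
transitivity (\sum_(i < n.+1) \sum_(j < n.+1) e (Y i + 1 - j%:Z) * cofactor M i j).
  apply: eq_bigr => i _; rewrite (expand_det_row _ i); apply: eq_bigr => j _.
  rewrite !mxE eqxx; congr (_ * (_ * \det _)); apply/matrixP => a b; rewrite !mxE.
  by rewrite eq_sym (negPf (neq_lift i a)) addr0.
rewrite exchange_big /=.
pose Nm (j : 'I_n.+1) : 'M[A]_n.+1 := \matrix_(k, l) if l == j then e (Y k + 1 - j%:Z) else M k l.
transitivity (\sum_j \det (Nm j)).
  apply: eq_bigr => j _; rewrite (expand_det_col _ j); apply: eq_bigr => i _.
  rewrite !mxE eqxx; congr (_ * (_ * \det _)); apply/matrixP => a b; rewrite !mxE.
  by rewrite eq_sym (negPf (neq_lift j b)).
rewrite big_ord_recl [X in _ + X]big1 ?addr0 => [|j _]; last first.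
  pose j' : 'I_n.+1 := widen_ord (leqnSn n) j.
  rewrite -det_tr; apply: (@determinant_alternate _ _ _ j' (lift ord0 j)).
    by rewrite -val_eqE /= /bump /= add1n ltn_eqF.
  move=> k; rewrite !mxE eqxx -val_eqE /= /bump /= add1n ltn_eqF //.
  by congr e; lia.
have row0 (B : 'M[A]_n.+1) : (forall j, j != ord0 -> B ord0 j = 0) ->
    \det B = B ord0 ord0 * cofactor B ord0 ord0.
  move=> B0; rewrite (expand_det_row _ ord0) (bigD1 ord0) //= big1 ?addr0 // => j j0.
  by rewrite B0 // mul0r.
have eN (j : 'I_n.+1) : j != ord0 -> e (Y ord0 - j%:Z) = 0.
  rewrite -val_eqE /= Y0 sub0r; case: (nat_of_ord j) => // m _.
  by rewrite -NegzE eneg.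
rewrite (row0 M) => [|j j0]; last by rewrite mxE eN.
rewrite (row0 (Nm ord0)) => [|j j0]; last by rewrite mxE (negPf j0) mxE eN.
rewrite !mxE eqxx Y0 add0r !subr0 e0 mul1r; congr (_ * (_ * \det _)).
by apply/matrixP => a b; rewrite !mxE.
Qed.

(** * The adjoint of multiplication by [p_1] *)

Section Cover.
Implicit Types la mu : seq nat.

Definition covers mu la : bool := has (fun r => la == incr_nth mu r) (iota 0 (size mu).+1).

Lemma coversP mu la :
  reflect (exists2 r, (r <= size mu)%N & la = incr_nth mu r) (covers mu la).
Proof.
apply: (iffP hasP) => [[r]|[r rs ->]]; first by rewrite mem_iota => rs /eqP ->; exists r.
by exists r; rewrite ?mem_iota.
Qed.

Lemma covers_sumn mu la : covers mu la -> sumn la = (sumn mu).+1.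
Proof.
move=> /coversP[r _ ->]; elim: mu r => [|p mu IH] [|r] //=; last by rewrite IH addnS.
by elim: r => //= r; rewrite /ncons => ->.
Qed.

(** A box at the bottom of column n+1-i, which [ypos n.+1] places at index i. *)
Definition add_col n mu (i : nat) : seq nat := incr_nth mu (colen (n.+1 - i) mu).

(** Column 1, for i = n, always accepts a box; any other column must be shorter than its left
    neighbour. *)
Definition addable n mu (i : nat) : bool :=
  (i == n) || (colen (n.+1 - i) mu < colen (n - i) mu)%N.

Lemma intpart_sorted la : intpart la -> sorted geq la. Proof. by case/andP. Qed.

Lemma intpart_geq la i j : intpart la -> (i <= j)%N -> (nth 0 la j <= nth 0 la i)%N.
Proof.
move=> /andP[sla _] ij; have [jl|jl] := ltnP j (size la); last by rewrite nth_default.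
by apply: (sorted_leq_nth geq_trans leqnn 0%N sla) => //; apply: leq_ltn_trans jl.
Qed.

Lemma intpart_incr_nth mu r : intpart mu -> (r <= size mu)%N ->
  ((0 < r)%N -> (nth 0 mu r < nth 0 mu r.-1)%N) -> intpart (incr_nth mu r).
Proof.
move=> pmu rs H; apply/andP; split.
  apply/(sortedP 0%N) => j _ /=; rewrite !nth_incr_nth.
  have := intpart_geq pmu (leqnSn j); case: (eqVneq r j.+1) H => [->|_] H /=.
    by have := H isT => /=; case: (_ == j); lia.
  by case: (r == j); lia.
apply/(all_nthP 0%N) => j; rewrite size_incr_nth nth_incr_nth => jl /=.
have := intpart_nth_gt0 j pmu; case: eqP => //= rj ->.
by move: jl; case: (ltnP r) => //; lia.
Qed.

Section AddCol.
Variables (n : nat) (mu : seq nat).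
Hypotheses (pmu : intpart mu) (mun : (part1 mu <= n)%N).
Variable i : nat.
Hypotheses (iln : (i <= n)%N) (gi : addable n mu i).

Let c := (n.+1 - i)%N.
Let r := colen c mu.
Let smu := intpart_sorted pmu.
Let c0 : (0 < c)%N. Proof. by rewrite subn_gt0. Qed.

Let mur : nth 0%N mu r = c.-1.
Proof.
have lt : (nth 0 mu r < c)%N by rewrite ltnNge colenP // ltnn.
have ge : (c.-1 <= nth 0 mu r)%N.
  have [->//|c1] := posnP c.-1; rewrite colenP //; move: gi; rewrite /addable -/c -/r.
  by have -> : (n - i = c.-1)%N; [rewrite /c; lia|case: eqP => // E; move: c1; rewrite /c E; lia].
by lia.
Qed.

Let rs : (r <= size mu)%N. Proof. exact: count_size. Qed.

Lemma add_col_intpart : intpart (add_col n mu i).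
Proof.
apply: intpart_incr_nth => // r0; rewrite -/c -/r mur.
by apply: leq_trans (_ : c <= _)%N; [lia|rewrite colenP // prednK].
Qed.

Lemma add_col_colen c' : (0 < c')%N ->
  colen c' (add_col n mu i) = (colen c' mu + (c' == c))%N.
Proof.
move=> c'0.
have E r' : (r' < colen c' (add_col n mu i))%N = (r' < colen c' mu + (c' == c))%N.
  rewrite -colenP //; last exact/intpart_sorted/add_col_intpart.
  rewrite nth_incr_nth -/c -/r; case: (eqVneq r r') => [<-|nr] /=.
    rewrite mur add1n prednK //; case: (ltngtP c' c) => cc /=.
    - by rewrite addn0 -colenP // mur; lia.
    - by rewrite addn0 -colenP // mur; lia.
    - by rewrite cc -/r addn1 ltnSn.
  rewrite add0n colenP //; case: (eqVneq c' c) => [->|_]; last by rewrite addn0.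
  by rewrite -/r; lia.
by apply/eqP; rewrite eqn_leq leqNgt E ltnn /= leqNgt -E ltnn.
Qed.

Lemma add_col_part1 : (part1 (add_col n mu i) <= n.+1)%N.
Proof.
rewrite /part1 -nth0 nth_incr_nth nth0 -/(part1 mu).
by apply: leq_trans (leq_add (leq_b1 _) mun) _.
Qed.

Lemma add_col_ypos (k : nat) : (k <= n)%N ->
  ypos n.+1 (add_col n mu i) k = (ypos n.+1 mu k + (k == i))%N.
Proof.
move=> kn; rewrite /ypos add_col_colen ?subn_gt0 // addnA; congr (_ + nat_of_bool _)%N.
by rewrite /c; lia.
Qed.

End AddCol.

Lemma covers_add_col n mu la : intpart mu -> intpart la -> (part1 mu <= n)%N ->
  covers mu la -> exists i, [/\ (i <= n)%N, addable n mu i & la = add_col n mu i].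
Proof.
move=> pmu pla mun /coversP[r rs E]; pose c := (nth 0%N mu r).+1.
have cn : (c <= n.+1)%N.
  by rewrite ltnS; apply: leq_trans mun; rewrite /part1 -nth0; exact: intpart_geq.
have cr : colen c mu = r.
  have H r' : (r' < colen c mu)%N = (r' < r)%N.
    rewrite -colenP ?intpart_sorted // /c; case: (ltnP r' r) => rr.
      have := intpart_geq pla (ltnW rr); rewrite E !nth_incr_nth eqxx.
      by rewrite gtn_eqF.
    by have := intpart_geq pmu rr; lia.
  by apply/eqP; rewrite eqn_leq leqNgt H ltnn /= leqNgt -H ltnn.
exists (n.+1 - c)%N; split; first by rewrite /c; lia.
  rewrite /addable subKn // cr; case: (posnP c.-1) => c1.
    by apply/orP; left; rewrite /c in c1 *; lia.
  apply/orP; right; rewrite (_ : (n - (n.+1 - c) = c.-1)%N); last by lia.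
  by rewrite -colenP ?intpart_sorted.
by rewrite /add_col subKn // cr.
Qed.

End Cover.

Section Pieri.
Variable R : comNzRingType.

Lemma p1_elem : p1 R = elem 1.
Proof.
apply/funext => m; rewrite /p1 /lfsum elemE /xmon.
have [/andP[/eqP sm _]|nm] := boolP (_ && _).
  have [i mi] : exists i, m = [mset i]%mset.
    have := seq_mset_id m; case: (m : seq nat) sm => [|i [|]] //= _ <-.
    by exists i; apply/msetP => j; rewrite mset_seqE msetnE /= addn0 eq_sym.
  rewrite (fsum_seq (r := [:: i])) ?big_seq1 ?mi ?eqxx // => j _; rewrite inE.
  move=> ji; case: eqP => // E; have : [mset j]%mset j = 1%N by rewrite msetnxx.
  by rewrite -E msetnE (negPf ji).
apply: fsbig1 => i _; case: eqP => // E; case/negP: nm.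
by rewrite E enum_msetn.
Qed.

(** One extra column, empty in [mu], gives room for a new column and supplies the position 0 that
    [jt_pieri] asks for. Where a box cannot be added, raising the position makes two rows equal. *)
Lemma pieri_schur mu : intpart mu ->
  p1 R * schur mu = lfsum [set la | intpart la && covers mu la] (@schur R).
Proof.
move=> pmu; pose n := part1 mu; have smu := intpart_sorted pmu.
have E0 : ypos n.+1 mu 0 = 0%N.
  rewrite /ypos add0n subn0 /colen; apply/eqP; rewrite eqn0Ngt -has_count.
  by apply/hasPn => p /(allP (all_head smu (leqnn _))) pn; rewrite -ltnNge.
have := @jt_pieri (fps R) elem n (fun k => (ypos n.+1 mu k)%:Z) (elem0 R) (elem_neg R).
rewrite /= E0 => /(_ erefl).
rewrite -(schur_det R smu (leqnSn n)) -p1_elem => <-.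
pose F (i : 'I_n.+1) : fps R := schur (add_col n mu i).
transitivity (\sum_(i < n.+1 | addable n mu i) F i).
  rewrite [RHS]big_mkcond; apply: eq_bigr => i _.
  have iln : (i <= n)%N by rewrite -ltnS.
  case: ifP => gi.
    rewrite /F (@schur_det _ n.+1); last 2 first.
    - exact/intpart_sorted/(add_col_intpart (n := n)).
    - exact: add_col_part1.
    congr (\det _); apply/matrixP => k j; rewrite !mxE.
    have -> : ypos n.+1 (add_col n mu i) k = (ypos n.+1 mu k + (val k == val i))%N.
      by apply: add_col_ypos => //; rewrite -ltnS; exact: ltn_ord.
    rewrite PoszD val_eqE; congr (elem (_ + _ - _)).
    by case: (k == i).
  have i1 : (i.+1 < n.+1)%N by move: gi; rewrite /addable; case: eqP => //=; lia.
  apply: (@determinant_alternate _ _ _ i (Ordinal i1)) => [|j].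
    by rewrite -val_eqE /= ltn_eqF.
  rewrite !mxE eqxx -val_eqE /= gtn_eqF // addr0; congr elem.
  have := @ypos_incr n.+1 mu i i.+1 (ltnSn i).
  move: gi; rewrite /addable /ypos subSS => /norP/= [_]; rewrite -leqNgt.
  have : (colen (n.+1 - i) mu <= colen (n - i) mu)%N.
    by apply: sub_count => p /=; lia.
  by lia.
apply/funext => m; rewrite fps_sumE.
rewrite /lfsum (fsum_seq (r :=
  [seq add_col n mu (nat_of_ord i) | i <- [seq i <- index_enum 'I_n.+1 | addable n mu (nat_of_ord i)]])).
- by rewrite big_map big_filter.
- rewrite map_inj_in_uniq ?filter_uniq ?index_enum_uniq // => i j.
  rewrite !mem_filter => /andP[gi _] /andP[gj _] E.
  have := add_col_ypos pmu (leqnn _) (ltn_ord i) gi (ltn_ord i).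
  rewrite E (add_col_ypos pmu (leqnn _) (ltn_ord j) gj (ltn_ord i)) eqxx.
  move/eqP; rewrite eqn_add2l; case: (eqVneq (i : nat) j) => // ij _; exact: val_inj.
- move=> la /mapP[i]; rewrite mem_filter => /andP[gi _] ->.
  rewrite /= (add_col_intpart pmu (leqnn _) (ltn_ord i) gi) /=.
  by apply/coversP; exists (colen (n.+1 - i) mu) => //; exact: count_size.
- move=> la /andP[pla cla] /mapP[].
  have [i [iln gi ->]] := covers_add_col pmu pla (leqnn _) cla.
  exists (Ordinal (iln : (i < n.+1)%N)) => //.
  by rewrite mem_filter gi mem_index_enum.
Qed.

Lemma pieri_schurE mu (m : monomial) : intpart mu ->
  (p1 R * schur mu) m = \sum_(la <- parts (size m)) (covers mu la)%:R * schur la m.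
Proof.
move=> pmu; rewrite pieri_schur // /lfsum.
rewrite (fsum_seq (r := [seq la <- parts (size m) | covers mu la])).
- rewrite big_filter big_mkcond; apply: eq_bigr => la _.
  by case: (covers mu la); rewrite ?mul1r ?mul0r.
- by rewrite filter_uniq // parts_uniq.
- by move=> la; rewrite mem_filter mem_parts /= => /and3P[-> ->].
- move=> la /= /andP[pla cla]; rewrite mem_filter mem_parts cla pla /= => sz.
  by rewrite schur_size // eq_sym.
Qed.

End Pieri.

Section Adjoint.
Variable R : comNzRingType.
Implicit Types (f g h : fps R) (la mu : seq nat).

Lemma schur_coef_p1M g : symmetric_fps g -> schur_coef (p1 R * g) =
  fun la => if intpart la then
    \sum_(mu <- parts (sumn la).-1) (covers mu la)%:R * schur_coef g mu else 0.
Proof.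
move=> sg; have [_ Eg] := schur_coefP sg.
rewrite -[RHS]schur_coef_series; last by move=> la /negPf ->.
congr schur_coef; apply/funext => m.
transitivity (\sum_(mu <- parts (size m).-1) schur_coef g mu * (p1 R * schur mu) m).
  rewrite fps_coefM; under [RHS]eq_bigr do rewrite fps_coefM mulr_sumr.
  rewrite [RHS]exchange_big; apply: eq_big_seq => a; rewrite mem_mdivs => am /=.
  rewrite p1_elem elemE; case: eqP => [sa|_] /=; last first.
    by rewrite mul0r big1 // => mu _; rewrite mul0r mulr0.
  rewrite {1}Eg schur_seriesE.
  have -> : size (m `\` a)%mset = (size m).-1.
    by rewrite -[in RHS](msubKD am) size_msetD sa.
  by rewrite mulr_sumr; apply: eq_bigr => mu _; rewrite mulrCA.
rewrite schur_seriesE.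
under eq_big_seq => mu.
  rewrite mem_parts => /andP[pmu _]; rewrite pieri_schurE // mulr_sumr; over.
rewrite exchange_big; apply: eq_big_seq => la; rewrite mem_parts => /andP[-> /eqP ->] /=.
by rewrite mulr_suml; apply: eq_bigr => mu _; rewrite mulrCA mulrA.
Qed.

(** The transpose of the Pieri rule on coefficients. *)
Definition skew1_coef f mu : R :=
  if intpart mu then
    \sum_(la <- parts (sumn mu).+1) (covers mu la)%:R * schur_coef f la
  else 0.

Definition skew1 f : fps R := schur_series (skew1_coef f).

Lemma schur_coef_skew1 f : schur_coef (skew1 f) = skew1_coef f.
Proof. by apply: schur_coef_series => la; rewrite /skew1_coef => /negPf ->. Qed.

Lemma hall_skew1 f g : symmetric_fps g -> bounded_degree g ->
  hall (skew1 f) g = hall f (p1 R * g).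
Proof.
move=> sg [D gD]; have cgD := schur_coef_bounded sg gD.
rewrite (hallE _ cgD) (@hallE _ _ _ D.+1); last first.
  move=> la lt; rewrite schur_coef_p1M //; case: ifP => // _.
  rewrite big_seq big1 // => mu; rewrite mem_parts => /andP[_ /eqP smu].
  by rewrite cgD ?mulr0 // smu; lia.
rewrite [RHS]big_ord_recl [X in _ = X + _]big_seq [X in _ = X + _]big1 ?add0r; last first.
  move=> la; rewrite mem_parts => /andP[pla /eqP sla].
  rewrite schur_coef_p1M // pla big1 ?mulr0 // => mu _.
  by case: (boolP (covers mu la)) => [/covers_sumn|_]; rewrite ?sla // mul0r.
apply: eq_bigr => d _.
transitivity (\sum_(mu <- parts d) \sum_(la <- parts d.+1)
    schur_coef f la * ((covers mu la)%:R * schur_coef g mu)).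
  apply: eq_big_seq => mu; rewrite mem_parts => /andP[pmu /eqP smu].
  rewrite schur_coef_skew1 /skew1_coef pmu smu mulr_suml; apply: eq_bigr => la _.
  by rewrite mulrCA mulrA.
rewrite exchange_big; apply: eq_big_seq => la; rewrite mem_parts => /andP[pla /eqP sla] /=.
by rewrite schur_coef_p1M // pla sla mulr_sumr.
Qed.

(** Testing an adjoint against Schur functions determines all its coefficients, which gives the
    uniqueness that [xget] needs. *)
Lemma p1perp_skew1 f : p1perp f = skew1 f.
Proof.
apply: xget_unique.
  by split; [exact: symmetric_schur_series|exact: hall_skew1].
move=> h [sh H]; have [_ ->] := schur_coefP sh; rewrite /skew1; congr schur_series.
apply/funext => la; case: (boolP (intpart la)) => pla; last first.
  by rewrite /skew1_coef (negPf pla); have [-> //] := schur_coefP sh.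
have sla := symmetric_schur R pla; have bla := bounded_schur R la.
by rewrite -hall_schur // H // -hall_skew1 // hall_schur // schur_coef_skew1.
Qed.

Lemma p1perpD f g : symmetric_fps f -> symmetric_fps g ->
  p1perp (f + g) = p1perp f + p1perp g.
Proof.
move=> sf sg; rewrite !p1perp_skew1; apply/funext => m; rewrite fps_addE /skew1 !schur_seriesE.
rewrite -big_split; apply: eq_bigr => la _ /=; rewrite -mulrDl; congr (_ * _).
rewrite /skew1_coef; case: ifP => _; last by rewrite addr0.
by rewrite -big_split; apply: eq_bigr => mu _ /=; rewrite schur_coefD // mulrDr.
Qed.

Lemma p1perpN f : symmetric_fps f -> p1perp (- f) = - p1perp f.
Proof.
move=> sf; rewrite !p1perp_skew1; apply/funext => m; rewrite fps_oppE /skew1 !schur_seriesE.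
rewrite -sumrN; apply: eq_bigr => la _; rewrite -mulNr; congr (_ * _).
rewrite /skew1_coef; case: ifP => _; last by rewrite oppr0.
by rewrite -sumrN; apply: eq_bigr => mu _; rewrite schur_coefN // mulrN.
Qed.

End Adjoint.

(** * Two-column shapes and the series g_d *)

Section TwoColumns.

Definition twocol a k : seq nat := nseq a 2%N ++ nseq k 1%N.

Lemma nth_twocol a k j : nth 0%N (twocol a k) j = ((j < a) + (j < a + k))%N.
Proof.
rewrite /twocol nth_cat size_nseq !nth_nseq.
case: (ltnP j a) => ja; first by rewrite ltn_addr.
by rewrite ltn_subLR //; case: (ltnP j _).
Qed.

Lemma size_twocol a k : size (twocol a k) = (a + k)%N.
Proof. by rewrite size_cat !size_nseq. Qed.

Lemma twocol_intpart a k : intpart (twocol a k).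
Proof.
apply/andP; split; last by rewrite all_cat !all_nseq !orbT.
by apply/(sortedP 0%N) => j _; rewrite !nth_twocol /=; lia.
Qed.

Lemma colen_twocol c a k : colen c (twocol a k) = ((c <= 2) * a + (c <= 1) * k)%N.
Proof. by rewrite /colen count_cat !count_nseq. Qed.

Lemma covers_twocol mu a k : intpart mu ->
  covers mu (twocol a k) = ((0 < a)%N && (mu == twocol a.-1 k.+1)) ||
                           ((0 < k)%N && (mu == twocol a k.-1)).
Proof.
move=> pmu; apply/coversP/orP => [[r _ E]|].
  have N j : (nth 0 mu j + (r == j) = (j < a) + (j < a + k))%N.
    by rewrite -nth_twocol E nth_incr_nth addnC.
  have ge := intpart_geq pmu (leqnSn r).
  have N0 := N r; have N1 := N r.+1; rewrite eqxx in N0; rewrite ltn_eqF // in N1.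
  have [ra|ar] := ltnP r a; [left|right]; apply/andP; split; try lia.
    have ar : r = a.-1 by lia.
    apply/eqP/eq_intpart => //; first exact: twocol_intpart.
    by move=> j; rewrite nth_twocol; have := N j; lia.
  have ark : r = (a + k).-1 by lia.
  apply/eqP/eq_intpart => //; first exact: twocol_intpart.
  by move=> j; rewrite nth_twocol; have := N j; lia.
case=> /andP[pos /eqP ->]; [exists a.-1|exists (a + k.-1)%N]; rewrite ?size_twocol; try lia;
  apply: (@eq_from_nth _ 0%N); rewrite ?size_incr_nth ?size_twocol; try (case: ifP; lia);
  by move=> j _; rewrite nth_incr_nth !nth_twocol; lia.
Qed.

End TwoColumns.

Section FserDiff.
Variable R : comNzRingType.

Definition gser (d : int) : fps R := fser d - fser (d + 2).

Lemma symmetric_fser r : symmetric_fps (@fser R r).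
Proof.
by apply: symmetric_lfsum => n _; apply: symmetricM; exact: symmetric_elem.
Qed.

Lemma symmetric_gser d : symmetric_fps (gser d).
Proof. by apply: symmetricD; [|apply: symmetricN]; exact: symmetric_fser. Qed.

Lemma trunc_gser N d : trunc N (gser d) = corr2 N (fun n => trunc N (elem n)) d.
Proof. by rewrite rmorphB /= !trunc_fser. Qed.

Lemma gser_anti d : gser (- 2 - d) = - gser d.
Proof.
apply: fps_trunc_eq => N; rewrite rmorphN /= !trunc_gser corr2_anti //.
exact: trunc_elem_supported.
Qed.

Lemma gserN1 : gser (-1) = 0.
Proof.
apply: fps_trunc_eq => N; rewrite rmorph0 trunc_gser corr2_N1 //.
exact: trunc_elem_supported.
Qed.

Lemma det2 (A : comNzRingType) (M : 'M[A]_2) :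
  \det M = M ord0 ord0 * M ord_max ord_max - M ord0 ord_max * M ord_max ord0.
Proof.
rewrite (expand_det_row _ ord0) big_ord_recl big_ord1 /cofactor !det_mx11 !mxE.
rewrite /= expr0 expr1 mul1r mulN1r mulrN; congr (_ * M _ _ - M _ _ * M _ _);
  exact: val_inj.
Qed.

Lemma schur_twocol a k : schur (twocol a k) =
  elem a%:Z * elem (a + k)%N%:Z - elem (a%:Z - 1) * elem (a + k).+1%:Z :> fps R.
Proof.
have h2 : (head 0 (twocol a k) <= 2)%N by rewrite -nth0 nth_twocol; lia.
rewrite (schur_det R (intpart_sorted (twocol_intpart a k)) h2) det2 !mxE.
rewrite /ypos !colen_twocol /=.
by apply: (congr2 (fun x y => x - y)); apply: (congr2 *%R); apply: (congr1 elem); lia.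
Qed.

(** The parameter a is read off as the length of the second column, which avoids an infinite sum
    over a. *)
Definition twocol_coef k la : R := (la == twocol (colen 2 la) k)%:R.

Lemma twocol_coef_sum k la M : (colen 2 la < M)%N ->
  twocol_coef k la = \sum_(a < M) (la == twocol a k)%:R.
Proof.
move=> lt; rewrite (bigD1 (Ordinal lt)) //= big1 ?addr0 // => a.
rewrite -val_eqE /= => na; case: eqP => // E; case/negP: na.
by rewrite E colen_twocol /= mul1n mul0n addn0.
Qed.

Lemma twocol_coef_supp k la : ~~ intpart la -> twocol_coef k la = 0.
Proof. by rewrite /twocol_coef; case: eqP => // ->; rewrite twocol_intpart. Qed.

Lemma trunc_schur_twocol N a k : trunc N (@schur R (twocol a k)) =
  trunc N (elem a%:Z) * trunc N (elem (a + k)%N%:Z) -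
  trunc N (elem (a%:Z - 1)) * trunc N (elem (a + k).+1%:Z).
Proof. by rewrite schur_twocol rmorphB !rmorphM. Qed.

(** Shifting the summation index of f_(k+2) by one gives the products e_(a-1) e_(a+k+1); the
    boundary terms vanish. *)
Lemma corr2_twocol (A : comNzRingType) N (e : int -> A) (k : nat) : supported N e ->
  corr2 N e k = \sum_(a < N.+1)
    (e a%:Z * e (a + k)%N%:Z - e (a%:Z - 1) * e (a + k).+1%:Z).
Proof.
move=> [e0 eN]; rewrite sumrB /corr2 /corr; congr (_ - _).
rewrite [RHS]big_ord_recl /= (e0 0%N) mul0r add0r [LHS]big_ord_recr /=.
rewrite (_ : N%:Z + (k%:Z + 2) = (N + k).+2%:Z); last by lia.
rewrite (eN (N + k).+2) ?mulr0 ?addr0; last by lia.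
by apply: eq_bigr => s _; rewrite /bump /=; congr (e _ * e _); lia.
Qed.

Lemma gser_series (k : nat) : gser k%:Z = schur_series (twocol_coef k).
Proof.
apply: fps_trunc_eq => N; rewrite trunc_gser.
have sup := @trunc_elem_supported R N.
rewrite corr2_twocol //; apply/funext => m; rewrite fps_sumE.
under eq_bigr do rewrite -trunc_schur_twocol.
rewrite /trunc; case: ifP => mN; last by rewrite big1.
rewrite /schur_series /lfsum.
rewrite (fsum_seq (r := [seq twocol a k | a <- index_iota 0 N.+1])).
- rewrite big_map big_mkord; apply: eq_bigr => a _.
  by rewrite /twocol_coef colen_twocol /= mul1n mul0n addn0 eqxx mul1r.
- rewrite map_inj_uniq ?iota_uniq // => a b /(congr1 (colen 2)).
  by rewrite !colen_twocol /= !mul1n !mul0n !addn0.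
- by move=> la /mapP[a _ ->]; exact: twocol_intpart.
- move=> la _ nla; rewrite /twocol_coef; case: eqP => [E|_]; last by rewrite mul0r.
  have aN : (N < colen 2 la)%N.
    rewrite ltnNge; apply: contra nla => le; apply/mapP; exists (colen 2 la) => //.
    by rewrite mem_index_iota.
  rewrite mul1r; have -> : schur la m = trunc N (schur la) m :> R by rewrite /trunc mN.
  rewrite E trunc_schur_twocol; have [_ eN] := sup.
  rewrite (eN (colen 2 la)) // (eN (_ + _).+1) ?mul0r ?mulr0 ?subrr //.
  by lia.
Qed.

Lemma schur_coef_gser (k : nat) : schur_coef (gser k%:Z) = twocol_coef k.
Proof. by rewrite gser_series schur_coef_series //; exact: twocol_coef_supp. Qed.

Lemma colen_sumn c la : (0 < c)%N -> (colen c la <= sumn la)%N.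
Proof.
by move=> c0; elim: la => //= p la; rewrite /colen /=; lia.
Qed.

Lemma p1perp_gser_nat (k : nat) : p1perp (gser k%:Z) = nbsum gser k%:Z.
Proof.
rewrite p1perp_skew1 /nbsum.
rewrite (_ : k%:Z + 1 = k.+1%:Z); last by lia.
(* For k = 0 the factor expresses g_(-1) = 0, matching the fact that the first column of 2^a has no
   removable box. *)
have -> : gser (k%:Z - 1) = schur_series (fun mu => (0 < k)%N%:R * twocol_coef k.-1 mu).
  case: k => [|k].
    rewrite (gserN1 : gser (0%:Z - 1) = 0); apply/funext => m; rewrite schur_seriesE.
    by rewrite big1 // => la _; rewrite !mul0r.
  rewrite (_ : k.+1%:Z - 1 = k); last by lia.
  rewrite gser_series; congr schur_series; apply/funext => mu.
  by rewrite mul1r.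
rewrite (gser_series k.+1); apply/funext => m; rewrite fps_addE /skew1 !schur_seriesE -big_split /=.
apply: eq_big_seq => mu; rewrite mem_parts => /andP[pmu _] /=; rewrite -mulrDl.
congr (_ * _); rewrite /skew1_coef pmu schur_coef_gser.
pose M := (sumn mu).+2.
transitivity (\sum_(a < M) (covers mu (twocol a k))%:R : R).
  transitivity (\sum_(la <- parts (sumn mu).+1) \sum_(a < M)
      (la == twocol a k)%:R * (covers mu (twocol a k))%:R : R).
    apply: eq_big_seq => la; rewrite mem_parts => /andP[_ /eqP sla].
    rewrite (@twocol_coef_sum k la M); last by rewrite ltnS -sla colen_sumn.
    rewrite mulr_sumr; apply: eq_bigr => a _.
    by case: eqP => [->|_]; rewrite ?mulr1 ?mul1r ?mulr0 ?mul0r.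
  rewrite exchange_big; apply: eq_bigr => a _ /=; rewrite -mulr_suml.
  case: (boolP (covers _ _)) => [/covers_sumn sE|_]; last by rewrite mulr0.
  rewrite (bigD1_seq (twocol a k)) ?parts_uniq ?mem_parts ?twocol_intpart ?sE //=.
  by rewrite eqxx big1 ?addr0 ?mulr1 // => la /negPf ->.
have lt : (colen 2 mu < (sumn mu).+1)%N by rewrite ltnS colen_sumn.
rewrite (twocol_coef_sum k.+1 lt) (@twocol_coef_sum k.-1 mu M); last exact: ltnW.
(* The two ways to remove a box leave second columns of different lengths, so the disjunction
   becomes a sum. *)
transitivity (\sum_(a < M) ((0 < a)%N && (mu == twocol a.-1 k.+1))%:R +
   \sum_(a < M) ((0 < k)%N && (mu == twocol a k.-1))%:R : R).
  rewrite -big_split; apply: eq_bigr => a _; rewrite covers_twocol //=.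
  case: (boolP (0 < a)%N) => a0; last by rewrite add0r.
  case: (eqVneq mu (twocol a.-1 k.+1)) => [E1|_]; last by rewrite add0r.
  case: (eqVneq mu (twocol a k.-1)) => [E2|_]; last by rewrite andbF addr0.
  have := congr1 (colen 2) (etrans (esym E1) E2).
  by rewrite !colen_twocol; move: a0; lia.
congr (_ + _); first by rewrite big_ord_recl /= add0r.
by rewrite mulr_sumr; apply: eq_bigr => a _; case: (0 < k)%N; rewrite ?mul1r ?mul0r.
Qed.

Lemma p1perp0 : p1perp (0 : fps R) = 0.
Proof.
have := p1perpD (@symmetric0 R) (@symmetric0 R); rewrite addr0 => E.
by apply: (addrI (p1perp 0)); rewrite -E addr0.
Qed.

Lemma p1perp_gser d : p1perp (gser d) = nbsum gser d.
Proof.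
case: d => [k|[|k]]; first exact: p1perp_gser_nat.
  rewrite (gserN1 : gser (Negz 0) = 0) p1perp0 /nbsum.
  rewrite (_ : Negz 0 + 1 = 0) // (_ : Negz 0 - 1 = - 2 - 0) // gser_anti.
  by rewrite subrr.
rewrite (_ : Negz k.+1 = - 2 - k%:Z); last by lia.
have anti := @iter_nbsum_anti _ gser (- 2) 1 gser_anti; rewrite /= in anti.
by rewrite anti gser_anti p1perpN ?p1perp_gser_nat //; exact: symmetric_gser.
Qed.

Lemma iter_p1perp (G : int -> fps R) j d : (forall d, symmetric_fps (G d)) ->
  (forall d, p1perp (G d) = nbsum G d) ->
  iter j (@p1perp R) (G d) = iter j (@nbsum _) G d.
Proof.
elim: j G d => [//|j IH] G d sG pG; rewrite !iterSr pG; apply: IH => d'.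
  by apply: symmetricD.
by rewrite p1perpD // !pG.
Qed.

Lemma iter_p1perp_gser j d :
  iter j (@p1perp R) (gser d) = iter j (@nbsum _) gser d.
Proof. by apply: iter_p1perp; [exact: symmetric_gser|exact: p1perp_gser]. Qed.

Lemma trunc_iter_gser N j d : trunc N (iter j (@nbsum _) gser d) =
  iter j (@nbsum _) (corr2 N (fun n => trunc N (@elem R n))) d.
Proof.
elim: j d => [|j IH] d; first exact: trunc_gser.
by rewrite !iterS /nbsum rmorphD /= !IH.
Qed.

End FserDiff.

(** * Sums of Schur functions *)

Section PartitionOfMinor.
Implicit Types la mu : seq nat.

Lemma eq_part_ypos n la mu : intpart la -> intpart mu ->
  (part1 la <= n)%N -> (part1 mu <= n)%N ->
  (forall i, (i < n)%N -> ypos n la i = ypos n mu i) -> la = mu.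
Proof.
move=> pla pmu lan mun E; apply: eq_intpart => // r.
have colE c : (0 < c)%N -> colen c la = colen c mu.
  move=> c0; have [cn|nc] := leqP c n.
    have := E (n - c)%N; rewrite /ypos subKn // => H.
    by apply/eqP; rewrite -(eqn_add2l (n - c)); apply/eqP/H; lia.
  have col0 l : intpart l -> (part1 l <= n)%N -> colen c l = 0%N.
    move=> pl ln; apply/eqP; rewrite eqn0Ngt -has_count; apply/hasPn => p.
    by move=> /(allP (all_head (intpart_sorted pl) ln)) /= pn; rewrite -ltnNge; lia.
  by rewrite !col0.
have le l l' : sorted geq l -> sorted geq l' ->
    (forall c, (0 < c)%N -> colen c l = colen c l') -> (nth 0 l r <= nth 0 l' r)%N.
  move=> sl sl' H; have [->//|c0] := posnP (nth 0%N l r).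
  by rewrite colenP // -H // -colenP.
apply/eqP; rewrite eqn_leq !le //; try exact: intpart_sorted.
by move=> c c0; rewrite colE.
Qed.

Lemma colen_filter c l : (0 < c)%N -> colen c [seq p <- l | (0 < p)%N] = colen c l.
Proof.
move=> c0; rewrite /colen count_filter; apply: eq_count => p /=.
by case: (leqP c p) => //= cp; rewrite (leq_trans c0).
Qed.

Lemma colen1 la : intpart la -> colen 1 la = size la.
Proof. by move=> /andP[_ pos]; apply/eqP; rewrite -all_count. Qed.

Section Fixed.
Variables (n N : nat).

(** Increasing selections among N + n columns encode the shapes with at most [n] columns and [N]
    rows. *)
Definition minor_part (y : {ffun 'I_n -> 'I_(N + n)}) : seq nat :=
  [seq p <- part_of n (natval y) N | (0 < p)%N].

Implicit Types y : {ffun 'I_n -> 'I_(N + n)}.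

Lemma minor_part_intpart y : intpart (minor_part y).
Proof.
apply/andP; split; last exact: filter_all.
by apply: sorted_filter; [exact: geq_trans|exact: part_of_sorted].
Qed.

Lemma minor_part_part1 y : (part1 (minor_part y) <= n)%N.
Proof.
have : all (leq^~ n) (minor_part y).
  by rewrite all_filter; apply: sub_all (part_of_le n (natval y) N) => p /= ->; rewrite implybT.
by rewrite /part1; case: (minor_part y) => //= p l /andP[].
Qed.

Lemma minor_part_ypos y i : incr y -> (i < n)%N -> ypos n (minor_part y) i = natval y i.
Proof.
move=> /incrP inc ilt.
have zinc j k : (j < k < n)%N -> (natval y j < natval y k)%N.
  move=> /andP[jk kn]; have jn := ltn_trans jk kn.
  by rewrite (natvalE y (Ordinal jn)) (natvalE y (Ordinal kn)); exact: inc.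
have zlo j : (j < n)%N -> (j <= natval y j)%N.
  elim: j => // j IH jn; apply: leq_ltn_trans (IH (ltnW jn)) (zinc _ _ _).
  by rewrite ltnSn.
have zhi d : (d < n)%N -> (natval y (n - d.+1) + d < N + n)%N.
  elim: d => [|d IH] dn.
    have n1 : (n - 1 < n)%N by lia.
    by rewrite addn0 (natvalE y (Ordinal n1)) ltn_ord.
  have := IH (ltnW dn); have := zinc (n - d.+2)%N (n - d.+1)%N.
  have -> : (n - d.+2 < n - d.+1 < n)%N by lia.
  by move=> /(_ isT); lia.
rewrite /ypos colen_filter ?subn_gt0 // part_of_colen //.
  by rewrite subnKC // zlo.
rewrite zlo //=; have := zhi (n - i.+1)%N.
rewrite (_ : (n - (n - i.+1).+1 = i)%N); last by lia.
by lia.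
Qed.

Lemma minor_part_inj y1 y2 : incr y1 -> incr y2 -> minor_part y1 = minor_part y2 -> y1 = y2.
Proof.
move=> i1 i2 E; apply/ffunP => i; apply: val_inj => /=.
by rewrite -!natvalE -!minor_part_ypos ?E.
Qed.

Lemma minor_part_surj la : intpart la -> (part1 la <= n)%N -> (size la <= N)%N ->
  exists2 y, incr y & minor_part y = la.
Proof.
move=> pla lan laN.
have lt (i : 'I_n) : (ypos n la i < N + n)%N.
  have := ltn_ord i; have : (colen (n - i) la <= size la)%N by exact: count_size.
  by rewrite /ypos; lia.
pose y := [ffun i => Ordinal (lt i)]; have yi : incr y.
  by apply/incrP => i j ij; rewrite !ffunE /=; exact: ypos_incr.
exists y => //; apply: (@eq_part_ypos n) => //.
- exact: minor_part_intpart.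
- exact: minor_part_part1.
- by move=> i iln; rewrite minor_part_ypos // (natvalE y (Ordinal iln)) ffunE.
Qed.

End Fixed.

Lemma colen_part1 n la : intpart la -> (part1 la <= n)%N ->
  (colen n la == 0%N) = (part1 la < n)%N || (n == 0%N) && (la == [::]).
Proof.
move=> pla lan; have [->|n0] := posnP n.
  rewrite ltn0 /= /colen -size_eq0 -[in RHS](count_predT la).
  by congr (_ == 0)%N; apply: eq_count.
rewrite orbF eqn0Ngt -colenP ?intpart_sorted // -ltnNge /part1 nth0.
by case: ltnP => //.
Qed.

Lemma sum_odd_count w p : (p <= w + w)%N ->
  (\sum_(i < w + w | ~~ odd i) ((w + w - i.+1 == p)%N : nat) = odd p)%N.
Proof.
move=> pn; case: (boolP (odd p)) => op.
  have pn' : (w + w - p.+1 < w + w)%N by lia.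
  rewrite (bigD1 (Ordinal pn')) /=; last by lia.
  rewrite (_ : (_ == p) = true); last by lia.
  rewrite big1 // => i /andP[oi]; rewrite -val_eqE /= => ni.
  by have := ltn_ord i; lia.
by rewrite big1 // => i oi; have := ltn_ord i; lia.
Qed.

Lemma colen_diff c la : (colen c la - colen c.+1 la = count (fun p => c == p) la)%N.
Proof.
rewrite /colen; elim: la => //= p la; have : (count (leq c.+1) la <= count (leq c) la)%N.
  by apply: sub_count => x /=; exact: ltnW.
by case: (ltngtP c p) => /=; lia.
Qed.

(** For even i the gap y_(i+1) - y_i - 1 is a difference of consecutive column lengths, hence the
    number of rows of length n - i - 1, which is odd since n = 2w. *)
Lemma altsum_oddrows w N (y : {ffun 'I_(w + w) -> 'I_(N + (w + w))}) : incr y ->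
  altsum y = oddrows (minor_part y).
Proof.
move=> inc; set la := minor_part y; set n := (w + w)%N in y inc la *.
transitivity (\sum_(i < n | ~~ odd i) count (fun p => (n - i.+1)%N == p) la)%N.
  apply: eq_bigr => i oi; have iln := ltn_ord i.
  have i1n : (i.+1 < n)%N.
    rewrite ltn_neqAle iln andbT; apply: contraNneq oi => E.
    by have := congr1 odd E; rewrite /n oddD addbb /= => /negbFE.
  rewrite -!minor_part_ypos // -/la /ypos -colen_diff addSn subSS subnDl subnSK //.
have : all (leq^~ n) la.
  exact: all_head (intpart_sorted (minor_part_intpart y)) (minor_part_part1 y).
elim: la => [_|p la IH /= /andP[pn lan]]; first by rewrite big1.
rewrite big_split /= IH //; congr (_ + _)%N; exact: sum_odd_count.
Qed.

End PartitionOfMinor.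

Section SchurSums.
Variable R : comNzRingType.

(** The last row of the determinant contains only e_k with k at least the number of rows. *)
Lemma trunc_schur_eq0 N la : intpart la -> (N < size la)%N -> trunc N (@schur R la) = 0.
Proof.
move=> pla lt; have sla := intpart_sorted pla.
case E : (part1 la) => [|n].
  by move: lt pla E; case: (la) => //= -[|p] l _ /andP[_].
rewrite (@schur_det R n.+1 la) //; last by rewrite -E.
rewrite -det_map_mx (expand_det_row _ ord_max) big1 // => j _; rewrite !mxE.
have [_ eN] := @trunc_elem_supported R N.
rewrite /ypos /= subSnn colen1 //.
have -> : (n + size la)%N%:Z - j%:Z = (n + size la - j)%N%:Z by have := ltn_ord j; lia.
by rewrite eN ?mul0r //; have := ltn_ord j; lia.
Qed.

Lemma trunc_schur_sum N n (P : pred (seq nat)) :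
  trunc N (lfsum [set la | [&& intpart la, (part1 la <= n)%N & P la]] (@schur R)) =
  \sum_(y : {ffun 'I_n -> 'I_(N + n)} | incr y && P (minor_part y))
     \det (\matrix_(i, j) trunc N (elem ((y i)%:Z - j%:Z))).
Proof.
transitivity (\sum_(y : {ffun 'I_n -> 'I_(N + n)} | incr y && P (minor_part y))
     trunc N (@schur R (minor_part y))); last first.
  apply: eq_bigr => y /andP[inc _].
  rewrite (schur_det R (intpart_sorted (minor_part_intpart y)) (minor_part_part1 y)).
  rewrite -det_map_mx; congr (\det _); apply/matrixP => i j; rewrite !mxE.
  by rewrite minor_part_ypos // natvalE.
apply/funext => m; rewrite fps_sumE {1}/trunc; case: ifP => mN; last first.
  by rewrite big1 // => y _; rewrite /trunc mN.
under eq_bigr do rewrite /trunc mN.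
pose r : seq (seq nat) := [seq minor_part y | y <-
  [seq y <- index_enum {ffun 'I_n -> 'I_(N + n)} | incr y && P (minor_part y)]].
rewrite /lfsum (fsum_seq (r := r)).
- by rewrite big_map big_filter.
- rewrite map_inj_in_uniq ?filter_uniq ?index_enum_uniq // => y1 y2.
  rewrite !mem_filter => /andP[/andP[i1 _] _] /andP[/andP[i2 _] _].
  exact: minor_part_inj.
- move=> la /mapP[y]; rewrite mem_filter => /andP[/andP[_ Py] _] ->.
  by rewrite /= minor_part_intpart minor_part_part1.
- move=> la /and3P[pla lan Pla] nla.
  have -> : schur la m = trunc N (schur la) m :> R by rewrite /trunc mN.
  rewrite trunc_schur_eq0 // ltnNge; apply: contra nla => laN.
  have [y inc E] := minor_part_surj pla lan laN.
  by apply/mapP; exists y => //; rewrite mem_filter inc E Pla mem_index_enum.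
Qed.

Lemma even_schur_sum w k :
  lfsum [set la | [/\ intpart la, (part1 la <= 2 * w.+1)%N & oddrows la = k]] (@schur R) =
  \det (\matrix_(i < w.+1, j < w.+1)
     iter j (@nbsum _) (@gser R) (if (i < w)%N then i : nat else w + k)%N%:Z).
Proof.
apply: fps_trunc_eq => N.
have -> : [set la | [/\ intpart la, (part1 la <= 2 * w.+1)%N & oddrows la = k]] =
    [set la | [&& intpart la, (part1 la <= w.+1 + w.+1)%N & oddrows la == k]].
  rewrite mul2n -addnn; apply/seteqP; split=> la /=; first by case=> -> -> ->; rewrite eqxx.
  by case/and3P=> -> -> /eqP.
rewrite (trunc_schur_sum N (w.+1 + w.+1) (fun la => oddrows la == k)).
transitivity (\sum_(y : {ffun 'I_(w.+1 + w.+1) -> 'I_(N + (w.+1 + w.+1))}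
        | incr y && (altsum y == k)) \det (\matrix_(i, j) trunc N (@elem R ((y i)%:Z - j%:Z)))).
  by apply: eq_bigl => y; case: (boolP (incr y)) => //= inc; rewrite altsum_oddrows.
rewrite even_identity_elem -det_map_mx; congr (\det _); apply/matrixP => i j.
by rewrite !mxE; apply/esym/trunc_iter_gser.
Qed.

Lemma odd_schur_sum w k :
  lfsum [set la | [/\ intpart la, (part1 la <= 2 * w + 1)%N & oddrows la = k]] (@schur R) =
  elem k%:Z * \det (\matrix_(i < w, j < w) iter (i + j) (@nbsum _) (@gser R) 0).
Proof.
apply: fps_trunc_eq => N.
(* Shapes with at most 2w+1 columns are shapes with 2w+2 columns, the last one empty; this becomes
   position 0 having value 0. *)
have -> : [set la | [/\ intpart la, (part1 la <= 2 * w + 1)%N & oddrows la = k]] =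
    [set la | [&& intpart la, (part1 la <= w.+1 + w.+1)%N
      & (part1 la < w.+1 + w.+1)%N && (oddrows la == k)]].
  apply/seteqP; split=> la /=.
    by case=> -> le ->; rewrite eqxx andbT /=; apply/andP; split; lia.
  by case/and4P=> -> _ lt /eqP ->; split=> //; lia.
rewrite (trunc_schur_sum N (w.+1 + w.+1)
  (fun la => (part1 la < w.+1 + w.+1)%N && (oddrows la == k))).
transitivity (\sum_(y : {ffun 'I_(w.+1 + w.+1) -> 'I_(N + (w.+1 + w.+1))}
        | [&& incr y, natval y 0 == 0%N & altsum y == k])
     \det (\matrix_(i, j) trunc N (@elem R ((y i)%:Z - j%:Z)))).
  apply: eq_bigl => y; case: (boolP (incr y)) => //= inc.
  rewrite altsum_oddrows // -minor_part_ypos // /ypos add0n subn0.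
  by rewrite colen_part1 ?orbF //; [exact: minor_part_intpart|exact: minor_part_part1].
rewrite odd_identity_elem rmorphM /= -det_map_mx.
apply: (congr2 *%R) => //; congr (\det _); apply/matrixP => i j.
by rewrite !mxE; apply/esym/trunc_iter_gser.
Qed.

End SchurSums.

Theorem theorem1p5 (R : comNzRingType) (w k : nat) :
  lfsum [set la | [/\ intpart la, (part1 la <= 2 * w + 1)%N & oddrows la = k]]
        (@schur R)
    = elem k%:Z
      * \det (\matrix_(i < w, j < w)
                iter (i + j) (@p1perp R) (fser 0 - fser 2%:Z))
  /\
  ((0 < w)%N \/ k = 0%N ->
   lfsum [set la | [/\ intpart la, (part1 la <= 2 * w)%N & oddrows la = k]]
         (@schur R)
     = \det (\matrix_(i < w, j < w)
               iter j (@p1perp R)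
                 (fser ((i.+1 + k * (i.+1 == w))%N%:Z - 1)
                  - fser ((i.+1 + k * (i.+1 == w))%N%:Z + 1)))).
Proof.
split.
  rewrite odd_schur_sum; congr (_ * \det _); apply/matrixP => i j; rewrite !mxE.
  by rewrite -iter_p1perp_gser.
(* Without columns only the empty partition remains. It has no odd rows, which matches the empty
   determinant at k = 0. *)
case: w => [[//|->]|w _].
  rewrite det_mx00 (_ : [set _ | _] = [set [::]]).
    apply/funext => m; rewrite /lfsum fsbig_set1.
    by rewrite (@schur_det R 0 [::]) // det_mx00.
  apply/seteqP; split=> [la [/andP[_ pos] le _]|la ->] //=.
  by case: la pos le => //= p la /andP[p0 _]; rewrite leqNgt p0.
rewrite even_schur_sum; congr (\det _); apply/matrixP => i j; rewrite !mxE.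
rewrite -iter_p1perp_gser; apply: (congr1 (iter j (@p1perp R))).
rewrite /gser; apply: (congr2 (fun x y => x - y)); apply: (congr1 fser);
  by have := ltn_ord i; rewrite eqSS; case: (ltngtP i w) => iw; lia.
Qed.
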